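(* Let $k$ be an algebraically closed field of arbitrary characteristic, and let $n\ge 2$ and $1\le d\le n$ be integers. Then a general Fano hypersurface of degree $d$ in $\mathbb{P}^n_k$ is separably rationally connected.
   Context: A Fano variety is a smooth projective variety with ample anticanonical bundle; a smooth hypersurface of degree $d$ in $\mathbb{P}^n$ is Fano iff $d\le n$. ''General'' means: for all hypersurfaces in a nonempty (hence dense) Zariski open subset of the projective space $\mathbb{P}(H^0(\mathbb{P}^n_k,\mathcal{O}(d)))$ parametrizing hypersurfaces of degree $d$ (smooth ones forming an open dense subset). A variety $X$ over $k$ is separably rationally connected if there exists a morphism $f:\mathbb{P}^1_k\to X$ whose image lies in the smooth locus of $X$ and such that the pullback $f^*TX$ of the tangent sheaf is ample (such an $f$ is called a very free curve). *)

(* Defs.v *)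
From HB Require Import structures.
From mathcomp Require Import all_boot all_order all_algebra.
From mathcomp Require Export mpoly.

Set Implicit Arguments.
Unset Strict Implicit.
Unset Printing Implicit Defensive.

Import GRing.Theory.
Local Open Scope ring_scope.

Definition monom (n d : nat) : finType :=
  {a : 'X_{1..n < d.+1} | mdeg a == d}.

Definition monom_exp (n d : nat) (a : monom n d) : 'X_{1..n} := val (val a).

(* [F] is the equation of a hypersurface of degree [d] in P^n; the points of
   P(H^0(P^n, O(d))) are such [F] up to a nonzero scalar. *)
Definition hypersurface (k : fieldType) (n d : nat) (F : {mpoly k[n.+1]}) :=
  (F != 0) && (F \is d.-homog).

(* The value at the point [F] of P(H^0(P^n, O(d))) of a polynomial [G] in the
   homogeneous coordinates of that space, which are the coefficients of [F]. *)
Definition coeff_eval (k : fieldType) (n d : nat)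
    (G : {mpoly k[#|monom n.+1 d|]}) (F : {mpoly k[n.+1]}) : k :=
  G.@[fun i : 'I_#|monom n.+1 d| => F@_(monom_exp (enum_val i))].

(* A Zariski open subset is the complement of the common zero locus of a set
   [I] of homogeneous polynomials.  A general hypersurface satisfies [P] when
   all points of some nonempty open subset do. *)
Definition for_general_hypersurface (k : fieldType) (n d : nat)
    (P : {mpoly k[n.+1]} -> Prop) : Prop :=
  exists I : {mpoly k[#|monom n.+1 d|]} -> Prop,
    let U F := exists2 G, I G & coeff_eval G F != 0 in
    [/\ forall G, I G -> exists e : nat, G \is e.-homog,
        exists2 F, hypersurface d F & U F
      & forall F, hypersurface d F -> U F -> P F].

(* Homogeneous coordinates of a point of projective space. *)
Definition proj_point (k : fieldType) (n : nat) (p : 'I_n.+1 -> k) : Prop :=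
  exists i, p i != 0.

(* The scheme F = 0 is smooth at its point [p] (Jacobian criterion). *)
Definition smooth_at (k : fieldType) (n : nat) (F : {mpoly k[n.+1]})
    (p : 'I_n.+1 -> k) : Prop :=
  exists i : 'I_n.+1, (F^`M(i)).@[p] != 0.

Definition smooth_hypersurface (k : fieldType) (n : nat)
    (F : {mpoly k[n.+1]}) : Prop :=
  forall p, proj_point p -> F.@[p] = 0 -> smooth_at F p.

(* P^1 has homogeneous coordinates (s, t) and is covered by the charts
     U_0 = {s <> 0} = Spec k[x], x = t / s,
     U_1 = {t <> 0} = Spec k[y], y = s / t,
   with U_0 /\ U_1 = Spec k[x, y] / (x y - 1).  A module over the latter ring
   is encoded as a module over k[x, y] on which x y acts as the identity, and
   an element of that ring by a representative in k[x, y]. *)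
Definition ovx (k : fieldType) : {mpoly k[2]} := 'X_ord0.
Definition ovy (k : fieldType) : {mpoly k[2]} := 'X_ord_max.

Definition restr_x (k : fieldType) (p : {poly k}) : {mpoly k[2]} :=
  (map_poly (@mpolyC 2 k) p).[ovx k].
Definition restr_y (k : fieldType) (p : {poly k}) : {mpoly k[2]} :=
  (map_poly (@mpolyC 2 k) p).[ovy k].

Definition eq_overlap (k : fieldType) (p q : {mpoly k[2]}) : Prop :=
  exists h : {mpoly k[2]}, p = q + h * (ovx k * ovy k - 1).

Definition generates (R : nzRingType) (M : lmodType R) (S : M -> Prop) : Prop :=
  forall z : M, exists (q : nat) (c : 'I_q -> R) (v : 'I_q -> M),
    (forall i, S (v i)) /\ z = \sum_(i < q) c i *: v i.

Definition finitely_generated (R : nzRingType) (M : lmodType R) : Prop :=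
  exists s : seq M, generates (fun z : M => z \in s).

(* A coherent sheaf, given by its finitely generated modules of sections over
   U_0 and U_1 and its module of sections over the overlap, which is the
   localization of the first one at x and of the second one at y. *)
Record coherent_P1 (k : fieldType) := CoherentP1 {
  sect0 : lmodType {poly k};
  sect1 : lmodType {poly k};
  sect01 : lmodType {mpoly k[2]};
  res0 : {additive sect0 -> sect01};
  res1 : {additive sect1 -> sect01};
  sect01_xy : forall z : sect01, (ovx k * ovy k) *: z = z;
  res0_scale : forall p u, res0 (p *: u) = restr_x p *: res0 u;
  res1_scale : forall p u, res1 (p *: u) = restr_y p *: res1 u;
  res0_ker : forall u, res0 u = 0 -> exists N : nat, 'X^N *: u = 0;
  res1_ker : forall u, res1 u = 0 -> exists N : nat, 'X^N *: u = 0;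
  res0_loc : forall z, exists (N : nat) u, ovx k ^+ N *: z = res0 u;
  res1_loc : forall z, exists (N : nat) u, ovy k ^+ N *: z = res1 u;
  sect0_fg : finitely_generated sect0;
  sect1_fg : finitely_generated sect1
}.

(* A rank [r] vector bundle E on P^1 is given by frames e_i over U_0 and e'_j
   over U_1 with transition matrix [g]: e'_j = \sum_i g_ji e_i on the overlap.
   The transition matrix of S^m(E) expresses the monomials of degree [m] in the
   e'_j through those in the e_i: this is its entry at e'^b, e^a. *)
Definition sym_transition (k : fieldType) (r m : nat)
    (g : 'M[{mpoly k[2]}]_r) (b a : monom r m) : {mpoly k[2]} :=
  (\prod_(j < r)
     (\sum_(i < r) g j i *: ('X_i : {mpoly {mpoly k[2]}[r]})) ^+ monom_exp b j)
    @_(monom_exp a).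

(* Over U_0 (resp. U_1) a section of L (x) S^m(E) is a sum of the
   u0_a (x) e^a (resp. of the u1_b (x) e'^b); a global section is a pair of
   such sections which agree on the overlap. *)
Definition global_section (k : fieldType) (r m : nat)
    (g : 'M[{mpoly k[2]}]_r) (L : coherent_P1 k)
    (u0 : {ffun monom r m -> sect0 L}) (u1 : {ffun monom r m -> sect1 L}) :=
  forall a : monom r m,
    res0 L (u0 a) = \sum_(b : monom r m) sym_transition g b a *: res1 L (u1 b).

Definition globally_generated (k : fieldType) (r m : nat)
    (g : 'M[{mpoly k[2]}]_r) (L : coherent_P1 k) : Prop :=
  generates (fun u0 => exists u1, @global_section k r m g L u0 u1) /\
  generates (fun u1 => exists u0, @global_section k r m g L u0 u1).

(* Hartshorne's definition: E is ample if for every coherent sheaf L, the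
   sheaf L (x) S^m(E) is globally generated for all large m. *)
Definition ample (k : fieldType) (r : nat) (g : 'M[{mpoly k[2]}]_r) : Prop :=
  forall L : coherent_P1 k, exists m0 : nat, forall m : nat, (m0 <= m)%N ->
    globally_generated m g L.

(* Restriction to U_0 and U_1 of a binary form in the variables (s, t). *)
Definition dehom0 (k : fieldType) (p : {mpoly k[2]}) : {poly k} :=
  mmap (@polyC k) (fun i : 'I_2 => [:: 1; 'X]`_i) p.
Definition dehom1 (k : fieldType) (p : {mpoly k[2]}) : {poly k} :=
  mmap (@polyC k) (fun i : 'I_2 => [:: 'X; 1]`_i) p.

(* A morphism from P^1 to P^n is given by n + 1 binary forms of the same degree
   [e] without common zero on P^1; it factors through the hypersurface F = 0
   when F vanishes identically on these forms. *)
Definition morphism_to (k : fieldType) (n : nat) (F : {mpoly k[n.+1]})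
    (e : nat) (f : n.+1.-tuple {mpoly k[2]}) : Prop :=
  [/\ forall i, tnth f i \is e.-homog,
      forall a : 'I_2 -> k, proj_point a -> proj_point (fun i => (tnth f i).@[a])
    & F \mPo f = 0].

Definition image_in_smooth_locus (k : fieldType) (n : nat)
    (F : {mpoly k[n.+1]}) (f : n.+1.-tuple {mpoly k[2]}) : Prop :=
  forall a : 'I_2 -> k, proj_point a ->
    smooth_at F (fun i => (tnth f i).@[a]).

Definition coords (k : fieldType) (n : nat) (dehom : {mpoly k[2]} -> {poly k})
    (f : n.+1.-tuple {mpoly k[2]}) : 'rV[{poly k}]_n.+1 :=
  \row_i dehom (tnth f i).

Definition gradient (k : fieldType) (n : nat) (dehom : {mpoly k[2]} -> {poly k})
    (F : {mpoly k[n.+1]}) (f : n.+1.-tuple {mpoly k[2]}) : 'rV[{poly k}]_n.+1 :=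
  \row_i dehom (F^`M(i) \mPo f).

(* By the Euler sequence 0 -> O -> O(1)^(n+1) -> T_{P^n} -> 0 and the normal
   sequence 0 -> T_X -> T_{P^n}|_X -> O_X(d) -> 0 of a hypersurface X : F = 0
   on its smooth locus, one has f^*T_X = K / O f, where K is the kernel of
   (dF/dx_i o f)_i : O(e)^(n+1) -> O(d e).  Over a chart, with O(e) trivialized
   by s^e or t^e, sections of K are row vectors; the rows of [V] represent a
   frame of f^*T_X when their classes are a basis of K / O f. *)
Definition tangent_frame (k : fieldType) (n r : nat)
    (dehom : {mpoly k[2]} -> {poly k}) (F : {mpoly k[n.+1]})
    (f : n.+1.-tuple {mpoly k[2]}) (V : 'M[{poly k}]_(r, n.+1)) : Prop :=
  (forall v : 'rV[{poly k}]_n.+1,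
      v *m (gradient dehom F f)^T = 0 <->
      exists (c : 'rV[{poly k}]_r) (h : {poly k}),
        v = c *m V + h *: coords dehom f)
  /\ (forall (c : 'rV[{poly k}]_r) (h : {poly k}),
      c *m V = h *: coords dehom f -> c = 0).

(* [g] is a transition matrix of f^*T_X, a bundle of rank n - 1.  A section of
   O(e)^(n+1) given over U_1 by [v] is given by x^e v(y) in the trivialization
   over U_0, since t^e = x^e s^e. *)
Definition tangent_transition (k : fieldType) (n : nat) (F : {mpoly k[n.+1]})
    (e : nat) (f : n.+1.-tuple {mpoly k[2]}) (g : 'M[{mpoly k[2]}]_n.-1) : Prop :=
  exists (V0 V1 : 'M[{poly k}]_(n.-1, n.+1)) (h : 'cV[{mpoly k[2]}]_n.-1),
    [/\ tangent_frame (@dehom0 k) F f V0,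
        tangent_frame (@dehom1 k) F f V1
      & forall j l,
          eq_overlap
            ((ovx k ^+ e *: map_mx (@restr_y k) V1) j l)
            ((g *m map_mx (@restr_x k) V0
              + h *m map_mx (@restr_x k) (coords (@dehom0 k) f)) j l)].

Definition pullback_tangent_ample (k : fieldType) (n : nat)
    (F : {mpoly k[n.+1]}) (e : nat) (f : n.+1.-tuple {mpoly k[2]}) : Prop :=
  exists2 g, tangent_transition F e f g & ample g.

Definition separably_rationally_connected (k : fieldType) (n : nat)
    (F : {mpoly k[n.+1]}) : Prop :=
  exists (e : nat) (f : n.+1.-tuple {mpoly k[2]}),
    [/\ morphism_to F e f, image_in_smooth_locus F f
      & pullback_tangent_ample F e f].

(* Main.v *)
(* A hypersurface X : F = 0 is shown to be separably rationally connected by a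
   curve f of degree e = n (e = 1 if d = 1) for which f^*T_X(-1) is globally
   generated; f^*T_X is then a quotient of a sum of copies of O(1), hence ample.
   By Castelnuovo-Mumford regularity this follows from H^1(f^*T_X(-2)) = 0, an
   open condition on the equations F0 of the hypersurfaces containing a fixed
   curve f0.  For d >= 2 the curve f0 is the rational normal curve and the
   condition holds for an explicit F0, in all characteristics; it also makes the
   map (A, F0) |-> F0 o A submersive at (1, F0), hence dominant, so that a general
   F is F0 o A with such an F0 and contains the curve A^-1 o f0.  That the image of
   a dominant map of affine spaces contains a nonempty open set is proved by
   extending homomorphisms to k one generator at a time.  Smoothness is an open
   condition because it is the existence of an N such that the Jacobian ideal
   contains all monomials of degree N. *)

From HB Require Import structures.
Require Import Defs.
From mathcomp Require Import all_boot all_order all_algebra.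
From mathcomp Require Import ring zify.
From Stdlib Require Import ClassicalEpsilon.

Set Implicit Arguments.
Unset Strict Implicit.
Unset Printing Implicit Defensive.

Import GRing.Theory.
Local Open Scope ring_scope.

(** * Extension of homomorphisms and Chevalley's theorem *)

(** The degree n of the curve serves two purposes. The coordinates of the rational normal curve form
    a basis of the binary forms of degree n, so infinitesimal changes of coordinates move it in
    every direction; and in the extreme case d = n the bundle f^*T_X, of rank n - 1, has degree n,
    which leaves room for ampleness. The obstacle is the characteristic. With K the kernel of the
    gradient along f, f^*T_X = K / O, and it would be natural to prove H^1(K(-2)) = 0. For the
    explicit F0 and d = n this contains a second-difference equation with zero values at both ends,
    of determinant n up to sign, so it fails when the characteristic divides n. The class coming
    from H^1(O(-2)) supplies exactly the missing initial value. Cohomology never appears as such: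
    its vanishing is the surjectivity of a linear map between spaces of forms. Fixing the
    multipliers that work for F0 turns it into the nonvanishing of a determinant, polynomial in the
    coefficients of the equation; smoothness is made open by the same device. *)

Section HomExtension.

Variables (k : closedFieldType) (R : idomainType).
Implicit Types (A : R -> Prop) (phi : R -> k).

Definition subring A : Prop :=
  [/\ A 1, forall x y, A x -> A y -> A (x + y), forall x, A x -> A (- x)
    & forall x y, A x -> A y -> A (x * y)].

(** The function is total, with unconstrained values outside [A], so that extending it to a larger
    subring does not change its type. *)
Definition hom_on A phi : Prop :=
  [/\ phi 1 = 1, forall x y, A x -> A y -> phi (x + y) = phi x + phi y
    & forall x y, A x -> A y -> phi (x * y) = phi x * phi y].

Definition coefs_in A (P : {poly R}) : Prop := forall i, A P`_i.

Definition adjoin A b z : Prop := exists2 P, coefs_in A P & z = P.[b].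

Section OneSubring.

Variables (A : R -> Prop) (subA : subring A).

Lemma subring0 : A 0.
Proof. by case: subA => A1 AD AN AM; rewrite -(subrr 1); apply: AD => //; apply: AN. Qed.

Lemma subring1 : A 1. Proof. by case: subA. Qed.
Lemma subringD x y : A x -> A y -> A (x + y). Proof. by case: subA => _ h _ _; apply: h. Qed.
Lemma subringN x : A x -> A (- x). Proof. by case: subA => _ _ h _; apply: h. Qed.
Lemma subringM x y : A x -> A y -> A (x * y). Proof. by case: subA => _ _ _ h; apply: h. Qed.

Lemma subring_sum (I : Type) (r : seq I) (F : I -> R) :
  (forall i, A (F i)) -> A (\sum_(i <- r) F i).
Proof. by move=> AF; apply: big_ind => //; [apply: subring0 | apply: subringD]. Qed.

Lemma subringX x m : A x -> A (x ^+ m).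
Proof.
move=> Ax; elim: m => [|m IH]; first by rewrite expr0; apply: subring1.
by rewrite exprS; apply: subringM.
Qed.

Lemma coefs_inD P Q : coefs_in A P -> coefs_in A Q -> coefs_in A (P + Q).
Proof. by move=> hP hQ i; rewrite coefD; apply: subringD. Qed.

Lemma coefs_inN P : coefs_in A P -> coefs_in A (- P).
Proof. by move=> hP i; rewrite coefN; apply: subringN. Qed.

Lemma coefs_inM P Q : coefs_in A P -> coefs_in A Q -> coefs_in A (P * Q).
Proof. by move=> hP hQ i; rewrite coefM; apply: subring_sum => j; apply: subringM. Qed.

Lemma coefs_inC c : A c -> coefs_in A c%:P.
Proof. by move=> hc i; rewrite coefC; case: ifP => _ //; apply: subring0. Qed.

Lemma coefs_inXn m : coefs_in A 'X^m.
Proof. by move=> i; rewrite coefXn; case: eqP => _; [apply: subring1 | apply: subring0]. Qed.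

Lemma coefs_in_lead P : coefs_in A P -> A (lead_coef P).
Proof. by move=> h; rewrite lead_coefE. Qed.

Lemma subring_adjoin b : subring (adjoin A b).
Proof.
split.
- by exists 1%:P; [apply: coefs_inC; apply: subring1 | rewrite hornerC].
- move=> _ _ [P hP ->] [Q hQ ->].
  by exists (P + Q); [apply: coefs_inD | rewrite hornerD].
- by move=> _ [P hP ->]; exists (- P); [apply: coefs_inN | rewrite hornerN].
- move=> _ _ [P hP ->] [Q hQ ->].
  by exists (P * Q); [apply: coefs_inM | rewrite hornerM].
Qed.

Lemma adjoin_base b x : A x -> adjoin A b x.
Proof. by move=> Ax; exists x%:P; [apply: coefs_inC | rewrite hornerC]. Qed.

Lemma adjoin_gen b : adjoin A b b.
Proof. by exists 'X; [rewrite -['X]expr1; apply: coefs_inXn | rewrite hornerX]. Qed.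

(** Leading coefficients are not invertible in [A]; multiplying [Q] by that of [P] at each step
    avoids dividing by it. *)
Lemma pseudo_division P Q : coefs_in A P -> P != 0 -> coefs_in A Q ->
  exists m S T, [/\ coefs_in A S, coefs_in A T,
    (lead_coef P ^+ m)%:P * Q = S * P + T & (size T < size P)%N].
Proof.
move=> hP P0.
have [n] := ubnP (size Q); elim: n Q => // n IH Q szQ hQ.
have [ltQP|lePQ] := ltnP (size Q) (size P).
  exists 0%N, 0, Q; split=> //; first by move=> i; rewrite coef0; apply: subring0.
  by rewrite expr0 mul1r mul0r add0r.
have Q0 : Q != 0 by rewrite -size_poly_gt0 (leq_trans _ lePQ) // size_poly_gt0.
pose U := (lead_coef Q)%:P * 'X^(size Q - size P).
have hU : coefs_in A U.
  by apply: coefs_inM; [apply/coefs_inC/coefs_in_lead | apply: coefs_inXn].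
pose Q' := (lead_coef P)%:P * Q - U * P.
have hQ' : coefs_in A Q'.
  apply: coefs_inD; last by apply/coefs_inN/coefs_inM.
  by apply: coefs_inM => //; apply/coefs_inC/coefs_in_lead.
have szQ' : (size Q' < size Q)%N.
  have sQ : (0 < size Q)%N by rewrite size_poly_gt0.
  have sP : (0 < size P)%N by rewrite size_poly_gt0.
  rewrite -(prednK sQ) ltnS; apply/leq_sizeP => j hj.
  rewrite coefB coefCM -mulrA coefCM coefXnM.
  have [ltj|lej] := ltnP j (size Q - size P).
    by exfalso; lia.
  have [->|nej] := eqVneq j (size Q).-1.
    have -> : ((size Q).-1 - (size Q - size P) = (size P).-1)%N by lia.
    by rewrite -!lead_coefE mulrC subrr.
  have ltQj : (size Q <= j)%N by rewrite -(prednK sQ) ltn_neqAle eq_sym nej.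
  have ltPj : (size P <= j - (size Q - size P))%N by lia.
  by rewrite !nth_default // !mulr0 subrr.
have [m [S [T [hS hT eqT szT]]]] := IH Q' (leq_trans szQ' szQ) hQ'.
exists m.+1, (S + (lead_coef P ^+ m)%:P * U), T; split=> //.
  apply: coefs_inD => //; apply: coefs_inM => //.
  by apply/coefs_inC/subringX/coefs_in_lead.
rewrite exprSr polyCM -mulrA.
have -> : (lead_coef P)%:P * Q = Q' + U * P by rewrite subrK.
by rewrite mulrDr eqT; ring.
Qed.

Section Hom.

Variables (phi : R -> k) (hom_phi : hom_on A phi).

Lemma hom_on0 : phi 0 = 0.
Proof.
case: hom_phi => _ hD _; have := hD 0 0 subring0 subring0.
by rewrite addr0 -{1}[phi 0]addr0 => /addrI.
Qed.

Lemma hom_onD x y : A x -> A y -> phi (x + y) = phi x + phi y.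
Proof. by case: hom_phi => _ h _; apply: h. Qed.

Lemma hom_onM x y : A x -> A y -> phi (x * y) = phi x * phi y.
Proof. by case: hom_phi => _ _ h; apply: h. Qed.

Lemma hom_on_sum (I : Type) (r : seq I) (F : I -> R) : (forall i, A (F i)) ->
  phi (\sum_(i <- r) F i) = \sum_(i <- r) phi (F i).
Proof.
move=> AF; elim: r => [|i r IH]; first by rewrite !big_nil hom_on0.
by rewrite !big_cons hom_onD ?IH //; apply: subring_sum.
Qed.

Lemma map_polyD_on P Q : coefs_in A P -> coefs_in A Q ->
  map_poly phi (P + Q) = map_poly phi P + map_poly phi Q.
Proof.
move=> hP hQ; apply/polyP => i.
by rewrite coefD !coef_map_id0 ?hom_on0 // coefD hom_onD.
Qed.

Lemma map_polyM_on P Q : coefs_in A P -> coefs_in A Q ->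
  map_poly phi (P * Q) = map_poly phi P * map_poly phi Q.
Proof.
move=> hP hQ; apply/polyP => i.
rewrite coef_map_id0 ?hom_on0 // !coefM hom_on_sum; last by move=> j; apply: subringM.
by apply: eq_bigr => j _; rewrite hom_onM // !coef_map_id0 ?hom_on0.
Qed.

Lemma map_polyC_on c : map_poly phi c%:P = (phi c)%:P.
Proof.
by apply/polyP => i; rewrite coef_map_id0 ?hom_on0 // !coefC; case: ifP; rewrite ?hom_on0.
Qed.

Lemma map_polyN_on P : coefs_in A P -> map_poly phi (- P) = - map_poly phi P.
Proof.
move=> hP; apply/eqP; rewrite -addr_eq0 -map_polyD_on //; last exact: coefs_inN.
by rewrite addNr map_polyC_on hom_on0.
Qed.

(** The hypothesis sends every relation for [b] to a relation for [xi], which makes the value at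
    [Q.[b]] independent of [Q]. *)
Lemma extend_hom b xi :
    (forall Q, coefs_in A Q -> Q.[b] = 0 -> (map_poly phi Q).[xi] = 0) ->
  exists2 phi', hom_on (adjoin A b) phi' &
    forall Q, coefs_in A Q -> phi' Q.[b] = (map_poly phi Q).[xi].
Proof.
move=> compat.
have ex z : exists y, forall Q, coefs_in A Q -> z = Q.[b] -> y = (map_poly phi Q).[xi].
  have [[P hP zP]|nz] := excluded_middle_informative (adjoin A b z); last first.
    by exists 0 => Q hQ zQ; case: nz; exists Q.
  exists (map_poly phi P).[xi] => Q hQ zQ; apply/eqP.
  rewrite -subr_eq0 -hornerN -map_polyN_on // -hornerD -map_polyD_on //; last exact: coefs_inN.
  apply/eqP/compat; first by apply: coefs_inD => //; apply: coefs_inN.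
  by rewrite hornerD hornerN -zP -zQ subrr.
pose phi' z := proj1_sig (constructive_indefinite_description _ (ex z)).
have phi'E Q : coefs_in A Q -> phi' Q.[b] = (map_poly phi Q).[xi].
  by move=> hQ; rewrite /phi'; case: constructive_indefinite_description => y /=; apply.
exists phi' => //; split.
- have -> : 1 = (1%:P : {poly R}).[b] by rewrite hornerC.
  rewrite phi'E; last by apply/coefs_inC/subring1.
  by rewrite map_polyC_on hornerC; case: hom_phi.
- move=> _ _ [P hP ->] [Q hQ ->]; rewrite -hornerD !phi'E //; last exact: coefs_inD.
  by rewrite map_polyD_on // hornerD.
- move=> _ _ [P hP ->] [Q hQ ->]; rewrite -hornerM !phi'E //; last exact: coefs_inM.
  by rewrite map_polyM_on // hornerM.
Qed.

End Hom.

(* [P] is a relation of minimal degree for [b], hence irreducible over the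
   fraction field of [A]: it is coprime to [Q], since [Q.[b] != 0]. *)
Lemma algebraic_bezout b P : coefs_in A P -> P != 0 -> P.[b] = 0 ->
    (forall Q, coefs_in A Q -> Q != 0 -> Q.[b] = 0 -> (size P <= size Q)%N) ->
  forall Q, coefs_in A Q -> Q.[b] != 0 ->
  exists2 V, coefs_in A V & A (V.[b] * Q.[b]) /\ V.[b] * Q.[b] != 0.
Proof.
move=> hP P0 Pb minP Q.
have [n] := ubnP (size Q); elim: n Q => // n IH Q szQ hQ Qb.
have Q0 : Q != 0 by apply: contraNneq Qb => ->; rewrite horner0.
have lP0 : lead_coef P != 0 by rewrite lead_coef_eq0.
have lQ0 : lead_coef Q != 0 by rewrite lead_coef_eq0.
have [lePQ|ltQP] := leqP (size P) (size Q).
  have [m [S [T [hS hT eqT szT]]]] := pseudo_division hP P0 hQ.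
  have Tb : T.[b] = lead_coef P ^+ m * Q.[b].
    have := congr1 (horner^~ b) eqT.
    by rewrite hornerD !hornerM Pb mulr0 add0r hornerC.
  have Tb0 : T.[b] != 0 by rewrite Tb mulf_neq0 // expf_neq0.
  have ltTQ := leq_trans szT lePQ.
  have [V hV [AVT VT0]] := IH T (leq_trans ltTQ szQ) hT Tb0.
  exists ((lead_coef P ^+ m)%:P * V).
    by apply: coefs_inM => //; apply/coefs_inC/subringX/coefs_in_lead.
  by move: AVT VT0; rewrite Tb hornerM hornerC mulrCA mulrA.
have [sz1|szQ1] := leqP (size Q) 1.
  have QC := size1_polyC sz1.
  exists 1%:P; first by apply/coefs_inC/subring1.
  rewrite hornerC mul1r; split=> //; rewrite QC hornerC; exact: hQ.
have [m [S [T [hS hT eqT szT]]]] := pseudo_division hQ Q0 hP.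
have Tb : T.[b] = - (S.[b] * Q.[b]).
  have := congr1 (horner^~ b) eqT.
  by rewrite hornerD !hornerM Pb mulr0 => /eqP; rewrite eq_sym addrC addr_eq0 => /eqP.
(* Otherwise [T = 0] by minimality of [P], and [S] is a relation for [b] smaller than [P]. *)
have Tb0 : T.[b] != 0.
  apply/negP => /eqP Tb0.
  have T0 : T = 0.
    apply/eqP/negP => /negP nT0; have := minP T hT nT0 Tb0.
    by rewrite leqNgt (ltn_trans szT ltQP).
  have Sb : S.[b] = 0.
    move: Tb; rewrite Tb0 => /eqP; rewrite eq_sym oppr_eq0 mulf_eq0.
    by rewrite (negPf Qb) orbF => /eqP.
  have cm0 : (lead_coef Q ^+ m)%:P != 0 :> {poly R} by rewrite polyC_eq0 expf_neq0.
  have S0 : S != 0.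
    apply: contraTneq isT => S0; move/eqP: eqT.
    by rewrite S0 T0 mul0r addr0 mulf_eq0 (negPf cm0) (negPf P0).
  have := minP S hS S0 Sb; rewrite leqNgt => /negP; apply.
  have := congr1 (fun p : {poly R} => size p) eqT.
  rewrite /= T0 addr0 size_Cmul ?expf_neq0 // (size_mul S0 Q0) => ->.
  by rewrite -subn1 ltn_subRL addnC ltn_add2l.
have [V hV [AVT VT0]] := IH T (leq_trans szT (ltnSE szQ)) hT Tb0.
exists (- (V * S)); first by apply/coefs_inN/coefs_inM.
by move: AVT VT0; rewrite Tb hornerN hornerM mulNr mulrN mulrA.
Qed.

(* If [b] is transcendental over [A], it can be sent anywhere and [alpha] is a
   leading coefficient.  If it is algebraic, it must go to a root of the image
   of its minimal relation [P], and [alpha] is the leading coefficient of [P]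
   times an element of [A] divisible by [beta]. *)
Lemma extend_hom_avoiding b beta : adjoin A b beta -> beta != 0 ->
  exists alpha, [/\ A alpha, alpha != 0 & forall phi, hom_on A phi ->
    phi alpha != 0 -> exists phi', [/\ hom_on (adjoin A b) phi',
      forall x, A x -> phi' x = phi x & phi' beta != 0]].
Proof.
move=> [Q hQ ->] Qb.
have finish phi xi : hom_on A phi ->
    (forall Q, coefs_in A Q -> Q.[b] = 0 -> (map_poly phi Q).[xi] = 0) ->
    (map_poly phi Q).[xi] != 0 ->
    exists phi', [/\ hom_on (adjoin A b) phi',
      forall x, A x -> phi' x = phi x & phi' Q.[b] != 0].
  move=> hphi compat ne; have [phi' hom' phi'E] := extend_hom hphi compat.
  exists phi'; split=> //; last by rewrite phi'E.
  move=> x Ax; rewrite -[x in LHS](hornerC x b) phi'E; last exact: coefs_inC.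
  by rewrite map_polyC_on // hornerC.
pose rel P := [/\ coefs_in A P, P != 0 & P.[b] = 0].
have [[P0 relP0]|norel] := excluded_middle_informative (exists P, rel P); last first.
  exists (lead_coef Q).
  have Q0 : Q != 0 by apply: contraNneq Qb => ->; rewrite horner0.
  split; [exact: coefs_in_lead | by rewrite lead_coef_eq0 |] => phi hphi phi0.
  have mQ0 : map_poly phi Q != 0.
    apply: contraNneq phi0 => mQ0; rewrite lead_coefE.
    by rewrite -(coef_map_id0 _ _ (hom_on0 hphi)) mQ0 coef0.
  have [xi xiP] := closed_nonrootP _ mQ0.
  apply: (finish phi xi) => // P hP Pb.
  have [->|nP0] := eqVneq P 0; first by rewrite map_polyC_on // hornerC hom_on0.
  by case: norel; exists P.
have [P [hP nP0 Pb] minP] : exists2 P, rel P & forall Q, rel Q -> (size P <= size Q)%N.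
  have [n] := ubnP (size P0); elim: n P0 relP0 => // n IH P relP szP.
  have [[P' relP' lt]|no] :=
    excluded_middle_informative (exists2 P', rel P' & (size P' < size P)%N).
    by apply: (IH P') => //; apply: leq_trans lt _.
  exists P => // P' relP'; rewrite leqNgt; apply/negP => lt; apply: no; by exists P'.
have minP' Q' : coefs_in A Q' -> Q' != 0 -> Q'.[b] = 0 -> (size P <= size Q')%N.
  by move=> *; apply: minP.
have [V hV [AVQ VQ0]] := algebraic_bezout hP nP0 Pb minP' hQ Qb.
exists (lead_coef P * (V.[b] * Q.[b])).
split; [by apply: subringM => //; apply: coefs_in_lead | |].
  by rewrite mulf_neq0 // lead_coef_eq0.
move=> phi hphi; rewrite (hom_onM hphi) //; last exact: coefs_in_lead.
rewrite mulf_eq0 negb_or => /andP[phil phiVQ].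
have szP : (1 < size P)%N.
  rewrite ltnNge; apply/negP => sz1; have PC := size1_polyC sz1.
  by move: Pb nP0; rewrite PC hornerC => ->; rewrite eqxx.
(* The leading coefficient of [P] survives under [phi], so the image of [P] is nonconstant and has a
   root to which [b] can go. *)
have szmP : size (map_poly phi P) != 1%N.
  suff: (1 < size (map_poly phi P))%N by case: (size _) => [|[]].
  rewrite ltnNge; apply/negP => /leq_sizeP/(_ (size P).-1).
  rewrite coef_map_id0 ?hom_on0 // -lead_coefE => h.
  by move/eqP: phil; apply; apply: h; rewrite -ltnS prednK // ltnW.
have [xi rt] := closed_rootP _ szmP.
(* Every relation is a multiple of [P] up to a power of its leading coefficient, which [phi] does
   not kill. *)
have compat Q' : coefs_in A Q' -> Q'.[b] = 0 -> (map_poly phi Q').[xi] = 0.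
  move=> hQ' Q'b; have [m [S [T [hS hT eqT szT]]]] := pseudo_division hP nP0 hQ'.
  have hlm : coefs_in A (lead_coef P ^+ m)%:P.
    by apply/coefs_inC/subringX/coefs_in_lead.
  have T0 : T = 0.
    apply/eqP/negP => /negP nT0.
    have Tb0 : T.[b] = 0.
      have := congr1 (horner^~ b) eqT.
      by rewrite hornerD !hornerM Pb Q'b !mulr0 add0r.
    by have := minP' T hT nT0 Tb0; rewrite leqNgt szT.
  have := congr1 (fun p => (map_poly phi p).[xi]) eqT.
  rewrite /= T0 addr0 !map_polyM_on // !hornerM (rootP rt) mulr0 map_polyC_on // hornerC.
  move/eqP; rewrite mulf_eq0 => /orP[|/eqP //] /eqP h.
  have powE j : phi (lead_coef P ^+ j) = phi (lead_coef P) ^+ j.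
    elim: j => [|j IH]; first by rewrite !expr0; case: hphi.
    rewrite !exprS (hom_onM hphi) ?IH //; first exact: coefs_in_lead.
    by apply/subringX/coefs_in_lead.
  by case/negP: phil; move/eqP: h; rewrite powE expf_eq0 => /andP[].
apply: (finish phi xi) => //.
have [phi' hom' phi'E] := extend_hom hphi compat.
apply: contraNneq phiVQ => Q0.
have A' := adjoin_base b AVQ.
have -> : phi (V.[b] * Q.[b]) = phi' (V.[b] * Q.[b]).
  by rewrite -[in RHS](hornerC (V.[b] * Q.[b]) b) phi'E ?map_polyC_on ?hornerC //; apply: coefs_inC.
by rewrite -hornerM phi'E ?map_polyM_on // ?hornerM ?Q0 ?mulr0 //; apply: coefs_inM.
Qed.

End OneSubring.

Fixpoint adjoin_seq A bs := if bs is b :: bs' then adjoin_seq (adjoin A b) bs' else A.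

Lemma subring_adjoin_seq A bs : subring A -> subring (adjoin_seq A bs).
Proof. by elim: bs A => //= b bs IH A hA; apply/IH/subring_adjoin. Qed.

Lemma adjoin_seq_base A bs x : subring A -> A x -> adjoin_seq A bs x.
Proof.
elim: bs A => //= b bs IH A hA Ax; apply: IH; first exact: subring_adjoin.
exact: adjoin_base.
Qed.

Lemma adjoin_seq_gen A bs x : subring A -> x \in bs -> adjoin_seq A bs x.
Proof.
elim: bs A => //= b bs IH A hA; rewrite inE => /orP[/eqP->|xbs].
  by apply: adjoin_seq_base; [apply: subring_adjoin | apply: adjoin_gen].
by apply: IH => //; apply: subring_adjoin.
Qed.

Lemma extend_hom_seq A bs beta : subring A -> adjoin_seq A bs beta -> beta != 0 ->
  exists alpha, [/\ A alpha, alpha != 0 & forall phi, hom_on A phi ->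
    phi alpha != 0 -> exists phi', [/\ hom_on (adjoin_seq A bs) phi',
      forall x, A x -> phi' x = phi x & phi' beta != 0]].
Proof.
elim: bs A => [|b bs IH] A hA /= hbeta beta0.
  by exists beta; split=> // phi hphi phi0; exists phi.
have [gamma [hg g0 extg]] := IH _ (subring_adjoin hA b) hbeta beta0.
have [alpha [ha a0 exta]] := extend_hom_avoiding hA hg g0.
exists alpha; split=> // phi hphi phi0.
have [phi1 [hom1 ext1 phi10]] := exta phi hphi phi0.
have [phi2 [hom2 ext2 phi20]] := extg phi1 hom1 phi10.
exists phi2; split=> // x Ax; rewrite ext2 ?ext1 //; exact: adjoin_base.
Qed.

End HomExtension.

(* Chevalley's theorem for a dominant map of affine spaces: a point of the
   target is a homomorphism on k[Phi], extended generator by generator. *)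
Theorem dominant_image_open (k : closedFieldType) (M N : nat)
    (Phi : N.-tuple {mpoly k[M]}) (H : {mpoly k[M]}) :
    (forall P : {mpoly k[N]}, P \mPo Phi = 0 -> P = 0) -> H != 0 ->
  exists2 G : {mpoly k[N]}, G != 0 & forall c : 'I_N -> k, G.@[c] != 0 ->
    exists x : 'I_M -> k, (forall j, (tnth Phi j).@[x] = c j) /\ H.@[x] != 0.
Proof.
move=> indep H0.
pose A z := exists P : {mpoly k[N]}, z = P \mPo Phi.
have hA : subring A.
  split; first by exists 1; rewrite comp_mpoly1.
  - by move=> _ _ [P ->] [Q ->]; exists (P + Q); rewrite comp_mpolyD.
  - by move=> _ [P ->]; exists (- P); rewrite comp_mpolyN.
  - by move=> _ _ [P ->] [Q ->]; exists (P * Q); rewrite rmorphM.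
pose bs : seq {mpoly k[M]} := [seq 'X_i | i <- enum 'I_M].
have hAbs := subring_adjoin_seq bs hA.
have AC c : A c%:MP by exists c%:MP; rewrite comp_mpolyC.
have AbsC c : adjoin_seq A bs c%:MP by apply: adjoin_seq_base.
have AbsX i : adjoin_seq A bs 'X_i.
  by apply: adjoin_seq_gen => //; apply: map_f; rewrite mem_enum.
have all_in p : adjoin_seq A bs p.
  rewrite [p]mpolyE; apply: subring_sum => // m.
  rewrite -mul_mpolyC mpolyXE_id; apply: subringM => //.
  apply: big_ind => [||i _]; [exact: subring1 | by move=> *; apply: subringM |].
  exact: subringX.
have [alpha [[G ->] a0 ext]] := extend_hom_seq k hA (all_in H) H0.
exists G; first by apply: contraNneq a0 => ->; rewrite comp_mpoly0.
move=> c Gc.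
have ex z : exists y, forall P : {mpoly k[N]}, z = P \mPo Phi -> y = P.@[c].
  have [[P hP]|nz] := excluded_middle_informative (A z); last first.
    by exists 0 => P hP; case: nz; exists P.
  exists P.@[c] => Q hQ; congr _.@[_]; apply/eqP; rewrite -subr_eq0; apply/eqP/indep.
  by rewrite comp_mpolyB -hP -hQ subrr.
pose phi z := proj1_sig (constructive_indefinite_description _ (ex z)).
have phiE P : phi (P \mPo Phi) = P.@[c].
  by rewrite /phi; case: constructive_indefinite_description => y /=; apply.
have hphi : hom_on A phi.
  split; first by rewrite -(comp_mpoly1 Phi) phiE meval1.
  - by move=> _ _ [P ->] [Q ->]; rewrite -comp_mpolyD !phiE mevalD.
  - by move=> _ _ [P ->] [Q ->]; rewrite -rmorphM !phiE mevalM.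
have phi0 : phi (G \mPo Phi) != 0 by rewrite phiE.
have [psi [hpsi psiE psiH]] := ext phi hphi phi0.
(* A homomorphism on the whole polynomial ring that fixes constants is evaluation at a point: the
   required preimage of [c]. *)
have psi_eval p : psi p = p.@[fun i => psi 'X_i].
  rewrite {1}[p]mpolyE (hom_on_sum hAbs hpsi); last by [].
  rewrite mevalE; apply: eq_bigr => m _.
  rewrite -mul_mpolyC (hom_onM hpsi) //; congr (_ * _).
    by rewrite psiE // -(comp_mpolyC _ Phi) phiE mevalC.
  have psiX x j : psi (x ^+ j) = psi x ^+ j.
    elim: j => [|j IH]; first by rewrite !expr0; case: hpsi.
    by rewrite !exprS (hom_onM hpsi) ?IH.
  rewrite mpolyXE_id.
  elim/big_rec2: _ => [|i x y _ <-]; first by case: hpsi.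
  by rewrite (hom_onM hpsi) // psiX.
exists (fun i => psi 'X_i); split=> [j|]; last by rewrite -psi_eval.
rewrite -psi_eval.
have PhiE : tnth Phi j = 'X_j \mPo Phi by rewrite comp_mpolyXU -tnth_nth.
rewrite psiE; last by exists 'X_j.
by rewrite PhiE phiE mevalXU.
Qed.

(** * Submersions *)
Lemma poly_eq0_horner (k : closedFieldType) (p : {poly k}) :
  (forall t, p.[t] = 0) -> p = 0.
Proof.
move=> p0; apply/eqP/negP => /negP nz; have [t] := closed_nonrootP _ nz.
by rewrite /root p0 eqxx.
Qed.

Lemma mpoly_nonroot (k : closedFieldType) (M : nat) (H : {mpoly k[M]}) :
  H != 0 -> exists v, H.@[v] != 0.
Proof.
(* Chevalley's theorem for the map to a point. *)
move=> H0; have [P|G G0 hG] := @dominant_image_open k M 0 [tuple] H _ H0.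
  by rewrite [P]nvar0_mpolyC comp_mpolyC => /eqP; rewrite mpolyC_eq0 => /eqP ->; rewrite mpolyC0.
case: (hG (fun=> 0)) => [|x [_ Hx]]; last by exists x.
by move: G0; rewrite [G]nvar0_mpolyC mevalC mpolyC_eq0.
Qed.

Lemma mevalX_scale (k : comNzRingType) (M : nat) (m : 'X_{1..M}) (t : k) (v : 'I_M -> k) :
  ('X_[m]).@[fun i => t * v i] = t ^+ mdeg m * ('X_[m]).@[v].
Proof.
rewrite !mevalX mdegE expr_sum -big_split /=.
by apply: eq_bigr => i _; rewrite exprMn.
Qed.

Lemma mcoeff_pihomog (k : nzRingType) (M d : nat) (p : {mpoly k[M]}) m :
  (pihomog mdeg d p)@_m = if mdeg m == d then p@_m else 0.
Proof.
rewrite pihomogE raddf_sum /=.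
transitivity (\sum_(m' <- msupp p | (mdeg m' == d) && (m' == m)) p@_m').
  rewrite big_mkcondr /=; apply: eq_bigr => m' _.
  by rewrite mcoeffZ mcoeffX; case: eqP; rewrite ?mulr1 ?mulr0.
have [mp|mp] := boolP (m \in msupp p); last first.
  rewrite (memN_msupp_eq0 mp) if_same big1_seq // => m' /andP[/andP[_ /eqP ->]].
  by rewrite (negPf mp).
rewrite -big_filter; case: ifP => hd.
  have -> : [seq i <- msupp p | (mdeg i == d) && (i == m)] = [:: m].
    rewrite (eq_in_filter (a2 := pred1 m)) ?filter_pred1_uniq //.
    by move=> x _ /=; case: (eqVneq x m) => [->|_]; rewrite ?hd ?andbF.
  by rewrite big_seq1.
have -> : [seq i <- msupp p | (mdeg i == d) && (i == m)] = [::].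
  rewrite (eq_in_filter (a2 := pred0)) ?filter_pred0 //.
  by move=> x _ /=; case: (eqVneq x m) => [->|]; rewrite ?hd ?andbF.
by rewrite big_nil.
Qed.

(* The lowest order term of [P (Phi (p + t v))] in [t] is, up to translation,
   the lowest homogeneous component of [P] evaluated at the derivative. *)
Lemma submersion_dominant (k : closedFieldType) (M N : nat)
    (Phi : N.-tuple {mpoly k[M]}) (p : 'I_M -> k) :
    (forall c : 'I_N -> k, exists v : 'I_M -> k, forall j, exists g : {poly k},
      forall t, (tnth Phi j).@[fun i => p i + t * v i]
        = (tnth Phi j).@[p] + t * c j + t ^+ 2 * g.[t]) ->
  forall P : {mpoly k[N]}, P \mPo Phi = 0 -> P = 0.
Proof.
move=> sub P PPhi; apply/eqP/negP => /negP P0.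
pose q j := (tnth Phi j).@[p].
pose P' := P \mPo [tuple 'X_i + (q i)%:MP | i < N].
have P'E v : P'.@[v] = P.@[fun i => v i + q i].
  rewrite comp_mpoly_meval; apply: meval_eq => i.
  by rewrite tnth_mktuple mevalD mevalXU mevalC.
have P'0 : P' != 0.
  have [v Pv] := mpoly_nonroot P0.
  apply: contraNneq Pv => P'0.
  have <- : P'.@[fun i => v i - q i] = P.@[v].
    by rewrite P'E; apply: meval_eq => i; rewrite subrK.
  by rewrite P'0 meval0.
(* The monomial order refines the degree, so the least monomial of the support has the lowest
   degree. *)
pose e := mdeg (mlast P').
have le_e m : m \in msupp P' -> (e <= mdeg m)%N.
  by move=> hm; apply/lemc_mdeg/mlast_lemc.
have Pe0 : pihomog mdeg e P' != 0.
  apply: contraTneq (mlast_supp P'0) => h.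
  by rewrite -mcoeff_eq0; have := mcoeff_pihomog e P' (mlast P'); rewrite h mcoeff0 eqxx => <-.
have [c Pec] := mpoly_nonroot Pe0.
have [v hv] := sub c.
have [g hg] := fin_all_exists hv.
(* ['X^e * W] is [P'] along the arc [t * (c + t * g)], and [W.[0]] is its lowest component at
   [c]. *)
pose W : {poly k} := \sum_(m <- msupp P')
  (P'@_m)%:P * 'X^(mdeg m - e) * \prod_i ((c i)%:P + 'X * g i) ^+ m i.
have W0 : 'X^e * W = 0.
  apply: poly_eq0_horner => t.
  have h : P'.@[fun j => t * (c j + t * (g j).[t])] = 0.
    rewrite P'E -(meval0 (fun i => p i + t * v i)) -PPhi comp_mpoly_meval.
    by apply: meval_eq => j; rewrite hg /q; ring.
  rewrite -{}h [P' in RHS]mpolyE raddf_sum /= hornerM horner_sum mulr_sumr.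
  apply: eq_big_seq => m hm; rewrite mevalZ mevalX_scale !hornerM !hornerXn hornerC.
  rewrite -{2}(subnKC (le_e m hm)) exprD horner_prod mevalX -!mulrA mulrCA; congr (_ * (_ * (_ * _))).
  by apply: eq_bigr => i _; rewrite horner_exp hornerD hornerM hornerC hornerX.
have {}W0 : W = 0.
  by move/eqP: W0; rewrite mulf_eq0 expf_eq0 polyX_eq0 andbF /= => /eqP.
case/eqP: Pec; have <- : W.[0] = (pihomog mdeg e P').@[c]; last by rewrite W0 horner0.
rewrite pihomogE raddf_sum horner_sum [RHS]big_mkcond /=.
apply: eq_big_seq => m hm; rewrite !hornerM hornerC hornerXn expr0n subn_eq0.
rewrite eqn_leq (le_e m hm) andbT; case: ifP => // _; last by rewrite mulr0 mul0r.
rewrite mulr1 mevalZ mevalX horner_prod; congr (_ * _); apply: eq_bigr => i _.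
by rewrite horner_exp hornerD hornerM hornerC hornerX mul0r addr0.
Qed.

(** * Polynomial functions of finitely many coordinates *)

Section PolynomialFunctions.

Variable k : closedFieldType.

(** Functions rather than polynomials, so that coordinates can be indexed by any finite type and
    determinants or coefficients treated pointwise. *)
Definition polyfun (T : finType) (h : (T -> k) -> k) : Prop :=
  exists p : {mpoly k[#|T|]}, forall v, h v = p.@[fun i => v (enum_val i)].

Section OneType.
Variable T : finType.
Implicit Types h : (T -> k) -> k.

Lemma polyfun_ext h1 h2 : h1 =1 h2 -> polyfun h1 -> polyfun h2.
Proof. by move=> e [p hp]; exists p => v; rewrite -e. Qed.

Lemma polyfunC c : polyfun (fun _ : T -> k => c).
Proof. by exists c%:MP => v; rewrite mevalC. Qed.

Lemma polyfunX s : polyfun (fun v : T -> k => v s).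
Proof. by exists 'X_(enum_rank s) => v; rewrite mevalXU enum_rankK. Qed.

Lemma polyfunD h1 h2 : polyfun h1 -> polyfun h2 -> polyfun (fun v => h1 v + h2 v).
Proof. by move=> [p hp] [q hq]; exists (p + q) => v; rewrite mevalD hp hq. Qed.

Lemma polyfunM h1 h2 : polyfun h1 -> polyfun h2 -> polyfun (fun v => h1 v * h2 v).
Proof. by move=> [p hp] [q hq]; exists (p * q) => v; rewrite mevalM hp hq. Qed.

Lemma polyfun_sum (I : Type) (r : seq I) (P : pred I) (F : I -> (T -> k) -> k) :
  (forall i, polyfun (F i)) -> polyfun (fun v => \sum_(i <- r | P i) F i v).
Proof.
move=> hF; elim: r => [|i r IH].
  by apply: polyfun_ext (polyfunC 0) => v; rewrite big_nil.
case Pi : (P i); last by apply: polyfun_ext IH => v; rewrite big_cons Pi.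
by apply: polyfun_ext (polyfunD (hF i) IH) => v; rewrite big_cons Pi.
Qed.

Lemma polyfun_prod (I : Type) (r : seq I) (P : pred I) (F : I -> (T -> k) -> k) :
  (forall i, polyfun (F i)) -> polyfun (fun v => \prod_(i <- r | P i) F i v).
Proof.
move=> hF; elim: r => [|i r IH].
  by apply: polyfun_ext (polyfunC 1) => v; rewrite big_nil.
case Pi : (P i); last by apply: polyfun_ext IH => v; rewrite big_cons Pi.
by apply: polyfun_ext (polyfunM (hF i) IH) => v; rewrite big_cons Pi.
Qed.

Lemma polyfun_det m (B : (T -> k) -> 'M[k]_m) :
  (forall i j, polyfun (fun v => B v i j)) -> polyfun (fun v => \det (B v)).
Proof.
move=> hB; apply: polyfun_sum => s; apply: polyfunM; first exact: polyfunC.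
exact: polyfun_prod.
Qed.

Lemma polyfun_comp (S : finType) (Psi : (T -> k) -> S -> k) (h : (S -> k) -> k) :
  (forall s, polyfun (fun v => Psi v s)) -> polyfun h -> polyfun (fun v => h (Psi v)).
Proof.
move=> hPsi [p hp]; have [q hq] := fin_all_exists hPsi.
exists (p \mPo [tuple q (enum_val i) | i < #|S|]) => v.
by rewrite comp_mpoly_meval hp; apply: meval_eq => i; rewrite tnth_mktuple hq.
Qed.

End OneType.

(** Irreducibility of affine space: two nonempty principal open sets meet. *)
Lemma polyfunM_nonzero (T : finType) (h1 h2 : (T -> k) -> k) :
  polyfun h1 -> polyfun h2 -> (exists v, h1 v != 0) -> (exists v, h2 v != 0) ->
  exists v, h1 v * h2 v != 0.
Proof.
move=> [p hp] [q hq] [v1 n1] [v2 n2].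
have p0 : p != 0 by apply: contraNneq n1 => p0; rewrite hp p0 meval0.
have q0 : q != 0 by apply: contraNneq n2 => q0; rewrite hq q0 meval0.
have [v nz] := mpoly_nonroot (mulf_neq0 p0 q0).
exists (fun s => v (enum_rank s)); rewrite hp hq -mevalM.
by apply: contraNneq nz => <-; apply/eqP/meval_eq => i; rewrite enum_valK.
Qed.

(** The last hypothesis is surjectivity of the differential at [p], stated through first-order
    expansions along lines. [H] cuts out the open subset whose image is taken. *)
Theorem submersion_image_open (T S : finType) (Phi : (T -> k) -> S -> k)
    (H : (T -> k) -> k) (p : T -> k) :
    (forall s, polyfun (fun v => Phi v s)) -> polyfun H -> H p != 0 ->
    (forall c : S -> k, exists v : T -> k, forall s, exists g : {poly k},
      forall t, Phi (fun i => p i + t * v i) s = Phi p s + t * c s + t ^+ 2 * g.[t]) ->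
  exists G : (S -> k) -> k, [/\ polyfun G, exists c, G c != 0 &
    forall c, G c != 0 -> exists x, Phi x =1 c /\ H x != 0].
Proof.
move=> /fin_all_exists[q hq] [h hh] Hp sub.
pose Q := [tuple q (enum_val i) | i < #|S|].
have h0 : h != 0 by apply: contraNneq Hp => h0; rewrite hh h0 meval0.
have dom : forall P : {mpoly k[#|S|]}, P \mPo Q = 0 -> P = 0.
  apply: (@submersion_dominant _ _ _ _ (fun i => p (enum_val i))) => c.
  have [v hv] := sub (fun s => c (enum_rank s)).
  exists (fun i => v (enum_val i)) => j.
  have [g hg] := hv (enum_val j); exists g => t.
  by have := hg t; rewrite !hq enum_valK tnth_mktuple.
have [G G0 hG] := dominant_image_open dom h0.
exists (fun c => G.@[fun i => c (enum_val i)]); split; first by exists G.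
  have [v Gv] := mpoly_nonroot G0; exists (fun s => v (enum_rank s)).
  by apply: contraNneq Gv => <-; apply/eqP/meval_eq => i; rewrite enum_valK.
move=> c /hG[x [hx hx']]; exists (fun s => x (enum_rank s)); split.
  move=> s; rewrite hq -[s]enum_rankK -hx tnth_mktuple.
  by apply: meval_eq => i; rewrite enum_valK.
rewrite hh; apply: contraNneq hx' => <-; apply/eqP/meval_eq => i.
by rewrite enum_valK.
Qed.

End PolynomialFunctions.

(** * Smooth hypersurfaces *)
Section Forms.

Variables (k : comNzRingType) (n d : nat).

Definition coefs (F : {mpoly k[n]}) (a : monom n d) : k := F@_(monom_exp a).

Definition form (c : monom n d -> k) : {mpoly k[n]} := \sum_a c a *: 'X_[monom_exp a].

Lemma mdeg_monom (a : monom n d) : mdeg (monom_exp a) = d.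
Proof. exact/eqP/(valP a). Qed.

Lemma monom_exp_inj : injective (@monom_exp n d).
Proof. by move=> a b /val_inj/val_inj. Qed.

Lemma monom_of (m : 'X_{1..n}) : mdeg m = d -> {a : monom n d | monom_exp a = m}.
Proof.
move=> hm; have lt : (mdeg m < d.+1)%N by rewrite hm.
have hm' : mdeg (BMultinom lt) == d by rewrite hm.
by exists (Sub (BMultinom lt) hm').
Qed.

Lemma form_homog c : form c \is d.-homog.
Proof.
by apply: rpred_sum => a _; apply: rpredZ; rewrite dhomogX; apply/eqP/mdeg_monom.
Qed.

Lemma coefs_form c : coefs (form c) =1 c.
Proof.
move=> a; rewrite /coefs raddf_sum /= (bigD1 a) //= mcoeffZ mcoeffX eqxx mulr1.
rewrite big1 ?addr0 // => b ba; rewrite mcoeffZ mcoeffX.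
by rewrite (inj_eq monom_exp_inj) (negPf ba) mulr0.
Qed.

Lemma form_coefs F : F \is d.-homog -> form (coefs F) = F.
Proof.
move=> hF; apply/mpolyP => m; have [hm|hm] := eqVneq (mdeg m) d.
  by have [a <-] := monom_of hm; apply: coefs_form.
by rewrite (dhomog_nemf_coeff hF hm) (dhomog_nemf_coeff (form_homog _) hm).
Qed.

Lemma form_comp l (c : monom n d -> k) (g : n.-tuple {mpoly k[l]}) :
  form c \mPo g = \sum_a c a *: \prod_i tnth g i ^+ monom_exp a i.
Proof. by rewrite raddf_sum; apply: eq_bigr => a _; rewrite /= comp_mpolyZ comp_mpolyX. Qed.

Lemma prod_homog (I : Type) (r : seq I) (e : I -> nat) (f : I -> {mpoly k[n]}) :
  (forall i, f i \is (e i).-homog) -> \prod_(i <- r) f i \is (\sum_(i <- r) e i)%N.-homog.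
Proof.
move=> hf; elim: r => [|i r IH]; first by rewrite !big_nil dhomog1.
by rewrite !big_cons; apply: dhomogM.
Qed.

Lemma mderiv_homog (F : {mpoly k[n]}) i : F \is d.-homog -> F^`M(i) \is d.-1.-homog.
Proof.
move=> hF; apply/dhomogP => m; rewrite mcoeff_msupp mcoeff_deriv => hm.
suff : mdeg (m + U_(i))%MM = d by rewrite mdegD mdeg1 addn1 => <-.
apply/eqP; apply: contraNT hm => hm.
by rewrite (dhomog_nemf_coeff hF hm) mul0rn.
Qed.

Lemma homog_scale (F : {mpoly k[n]}) t (v : 'I_n -> k) : F \is d.-homog ->
  F.@[fun i => t * v i] = t ^+ d * F.@[v].
Proof.
move=> hF; rewrite [F]mpolyE !raddf_sum mulr_sumr /=.
apply: eq_big_seq => m hm; rewrite !mevalZ mevalX_scale.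
by rewrite (dhomog_mf hF hm) mulrCA.
Qed.

Lemma mderivXU (i j : 'I_n) : ('X_i : {mpoly k[n]})^`M(j) = (i == j)%:R.
Proof.
rewrite mderivX mnm1E; case: eqP => [->|]; last by rewrite scale0r.
have -> : (U_(j) - U_(j))%MM = 0%MM :> 'X_{1..n}.
  by apply/mnmP => l; rewrite mnmBE mnm0E subnn.
by rewrite scale1r mpolyX0.
Qed.

Lemma mderivXn (p : {mpoly k[n]}) m i : (p ^+ m)^`M(i) = p ^+ m.-1 * p^`M(i) *+ m.
Proof.
elim: m => [|m IH]; first by rewrite expr0 -mpolyC1 mderivC mulr0n.
rewrite exprS mderivM IH /= mulrS [p^`M(i) * _]mulrC; congr (_ + _).
case: m {IH} => [|m]; first by rewrite !mulr0n mulr0.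
by rewrite exprS mulrnAr mulrA.
Qed.

End Forms.

(** On the line through [p], [R] is a polynomial in [t] whose coefficients are the values at [p] of
    its homogeneous components. *)
Lemma pihomog_eq0_on_line (k : closedFieldType) (n : nat) (R : {mpoly k[n]}) (p : 'I_n -> k) :
  (forall t, t != 0 -> R.@[fun i => t * p i] = 0) -> forall e, (pihomog mdeg e R).@[p] = 0.
Proof.
move=> h e; pose W : {poly k} := \sum_(m <- msupp R) (R@_m * ('X_[m]).@[p]) *: 'X^(mdeg m).
(* The factor ['X] takes care of the excluded value [t = 0]. *)
have W0 : 'X * W = 0.
  apply: poly_eq0_horner => t; rewrite hornerM hornerX.
  have [->|t0] := eqVneq t 0; first by rewrite mul0r.
  rewrite -[RHS](mulr0 t) -(h t t0) [R in RHS]mpolyE raddf_sum horner_sum; congr (_ * _).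
  apply: eq_bigr => m _; rewrite hornerZ hornerXn /= mevalZ mevalX_scale.
  by rewrite -mulrA [_ * t ^+ _]mulrC.
have {}W0 : W = 0 by move/eqP: W0; rewrite mulf_eq0 polyX_eq0 => /eqP.
rewrite pihomogE raddf_sum -[RHS](coef0 k e) -W0 coef_sum [LHS]big_mkcond /=.
apply: eq_bigr => m _; rewrite coefZ coefXn [in RHS]eq_sym mevalZ.
by case: eqP; rewrite ?mulr1 ?mulr0.
Qed.

(** * Families of polynomials whose coefficients are polynomial functions *)

Section PolynomialFamilies.

Variables (k : closedFieldType) (T : finType).

Definition mpolyfun n (f : (T -> k) -> {mpoly k[n]}) :=
  forall m, polyfun (fun v => (f v)@_m).

Lemma mpolyfun_ext n (f g : (T -> k) -> {mpoly k[n]}) :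
  f =1 g -> mpolyfun f -> mpolyfun g.
Proof. by move=> e h m; apply: polyfun_ext (h m) => v; rewrite e. Qed.

Lemma mpolyfunC n (p : {mpoly k[n]}) : mpolyfun (fun=> p).
Proof. by move=> m; apply: polyfunC. Qed.

Lemma mpolyfunM n (f g : (T -> k) -> {mpoly k[n]}) :
  mpolyfun f -> mpolyfun g -> mpolyfun (fun v => f v * g v).
Proof.
move=> hf hg m.
apply: (@polyfun_ext _ _ (fun v => \sum_(q : 'X_{1..n < (mdeg m).+1, (mdeg m).+1}
   | m == (q.1 + q.2)%MM) (f v)@_q.1 * (g v)@_q.2)); first by move=> v; rewrite mcoeffM.
by apply: polyfun_sum => q; apply: polyfunM.
Qed.

Lemma mpolyfunZ n (c : (T -> k) -> k) (f : (T -> k) -> {mpoly k[n]}) :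
  polyfun c -> mpolyfun f -> mpolyfun (fun v => c v *: f v).
Proof. by move=> hc hf m; apply: polyfun_ext (polyfunM hc (hf m)) => v; rewrite mcoeffZ. Qed.

Lemma mpolyfun_sum n (I : Type) (r : seq I) (P : pred I) (F : I -> (T -> k) -> {mpoly k[n]}) :
  (forall i, mpolyfun (F i)) -> mpolyfun (fun v => \sum_(i <- r | P i) F i v).
Proof.
move=> hF m; apply: polyfun_ext (polyfun_sum r P (fun i => hF i m)) => v.
by rewrite raddf_sum.
Qed.

Lemma mpolyfun_prod n (I : Type) (r : seq I) (P : pred I) (F : I -> (T -> k) -> {mpoly k[n]}) :
  (forall i, mpolyfun (F i)) -> mpolyfun (fun v => \prod_(i <- r | P i) F i v).
Proof.
move=> hF; elim: r => [|i r IH].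
  by apply: mpolyfun_ext (mpolyfunC 1) => v; rewrite big_nil.
case Pi : (P i); last by apply: mpolyfun_ext IH => v; rewrite big_cons Pi.
by apply: mpolyfun_ext (mpolyfunM (hF i) IH) => v; rewrite big_cons Pi.
Qed.

Lemma mpolyfunXn n (f : (T -> k) -> {mpoly k[n]}) m :
  mpolyfun f -> mpolyfun (fun v => f v ^+ m).
Proof.
move=> hf; elim: m => [|m IH].
  by apply: mpolyfun_ext (mpolyfunC 1) => v; rewrite expr0.
by apply: mpolyfun_ext (mpolyfunM hf IH) => v; rewrite exprS.
Qed.

Lemma mpolyfun_deriv n (f : (T -> k) -> {mpoly k[n]}) i :
  mpolyfun f -> mpolyfun (fun v => (f v)^`M(i)).
Proof.
move=> hf m.
apply: polyfun_ext (polyfunM (polyfunC _ (m i).+1%:R) (hf (m + U_(i))%MM)) => v.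
by rewrite mcoeff_deriv mulr_natl.
Qed.

Lemma mpolyfun_form n d (c : (T -> k) -> monom n d -> k) :
  (forall a, polyfun (fun v => c v a)) -> mpolyfun (fun v => form (c v)).
Proof. by move=> hc; apply: mpolyfun_sum => a; apply: mpolyfunZ => //; apply: mpolyfunC. Qed.

Lemma mpolyfun_form_comp n l d (c : (T -> k) -> monom n d -> k)
    (g : (T -> k) -> n.-tuple {mpoly k[l]}) :
  (forall a, polyfun (fun v => c v a)) -> (forall i, mpolyfun (fun v => tnth (g v) i)) ->
  mpolyfun (fun v => form (c v) \mPo g v).
Proof.
move=> hc hg; apply: (mpolyfun_ext (fun v => esym (form_comp (c v) (g v)))).
by apply: mpolyfun_sum => a; apply: mpolyfunZ => //; apply: mpolyfun_prod => i; apply: mpolyfunXn.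
Qed.

End PolynomialFamilies.

Section SmoothOpen.

Variables (k : closedFieldType) (n d : nat).
Implicit Types F x y : {mpoly k[n.+1]}.

(** [F] itself is included because Euler's formula recovers it from the derivatives only if the
    degree is invertible. *)
Definition jacobian_gen F (g : option 'I_n.+1) := if g is Some i then F^`M(i) else F.

Definition in_jacobian F x : Prop :=
  exists h : option 'I_n.+1 -> {mpoly k[n.+1]}, x = \sum_g h g * jacobian_gen F g.

Definition in_jacobian_rad F x : Prop := exists N, in_jacobian F (x ^+ N).

Lemma in_jacobianD F x y : in_jacobian F x -> in_jacobian F y -> in_jacobian F (x + y).
Proof.
move=> [h ->] [h' ->]; exists (fun g => h g + h' g).
by rewrite -big_split; apply: eq_bigr => g _; rewrite mulrDl.
Qed.

Lemma in_jacobianM F x y : in_jacobian F x -> in_jacobian F (y * x).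
Proof.
move=> [h ->]; exists (fun g => y * h g).
by rewrite mulr_sumr; apply: eq_bigr => g _; rewrite mulrA.
Qed.

Lemma in_jacobian0 F : in_jacobian F 0.
Proof. by exists (fun=> 0); rewrite big1 // => g _; rewrite mul0r. Qed.

Lemma in_jacobian_gen F g : in_jacobian F (jacobian_gen F g).
Proof.
exists (fun g' => (g' == g)%:R); rewrite (bigD1 g) //= eqxx mul1r big1 ?addr0 //.
by move=> g' /negPf ->; rewrite mul0r.
Qed.

Lemma in_rad F x : in_jacobian F x -> in_jacobian_rad F x.
Proof. by exists 1%N. Qed.

Lemma in_radX F x m : in_jacobian_rad F (x ^+ m) -> in_jacobian_rad F x.
Proof. by move=> [N h]; exists (m * N)%N; rewrite exprM. Qed.

Lemma in_radM F x y : in_jacobian_rad F x -> in_jacobian_rad F (y * x).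
Proof. by move=> [N h]; exists N; rewrite exprMn; apply: in_jacobianM. Qed.

Lemma in_radD F x y :
  in_jacobian_rad F x -> in_jacobian_rad F y -> in_jacobian_rad F (x + y).
Proof.
move=> [N hx] [M hy]; exists (N + M)%N; rewrite exprDn.
apply: (big_ind (in_jacobian F)) => [||[i /= hi] _]; [exact: in_jacobian0 | exact: in_jacobianD |].
rewrite -mulr_natl; apply: in_jacobianM; have [leMi|ltiM] := leqP M i.
  by rewrite -(subnK leMi) exprD mulrA; apply: in_jacobianM.
have leN : (N <= N + M - i)%N by lia.
by rewrite -(subnK leN) exprD mulrAC; apply: in_jacobianM.
Qed.

Lemma in_rad_sum F (I : Type) (r : seq I) (P : pred I) (f : I -> {mpoly k[n.+1]}) :
  (forall i, P i -> in_jacobian_rad F (f i)) ->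
  in_jacobian_rad F (\sum_(i <- r | P i) f i).
Proof.
move=> hf; apply: (big_ind (in_jacobian_rad F)) => //; last exact: in_radD.
exact/in_rad/in_jacobian0.
Qed.

(** Pigeonhole: in a monomial of degree [\sum_i N i] some exponent reaches [N i]. *)
Lemma jacobian_monomials F : (forall i, in_jacobian_rad F 'X_i) ->
  exists N, forall m, mdeg m = N -> in_jacobian F 'X_[m].
Proof.
move=> /fin_all_exists[N hN]; exists (\sum_i N i)%N => m hm.
have [/existsP[i hi]|/existsPn no] := boolP [exists i, (N i <= m i)%N].
  have le : (U_(i) *+ N i <= m)%MM.
    apply/mnm_lepP => j; rewrite mulmnE mnm1E.
    by case: eqP => [<-|]; rewrite ?mul1n ?mul0n.
  by rewrite -(submK le) mpolyXD -mpolyXn; apply: in_jacobianM.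
have : (mdeg m < \sum_i N i)%N.
  rewrite mdegE !big_ord_recl -addSn leq_add // ?ltnNge ?no //.
  by apply: leq_sum => i _; rewrite ltnW // ltnNge no.
by rewrite hm ltnn.
Qed.

(* Writing the monomials of degree [N] as combinations of the generators of the
   Jacobian ideal of [F0], the same combinations for [F] still span all monomials
   when a determinant does not vanish; this bars a common zero. *)
Lemma smooth_from_jacobian F0 N : F0 \is d.-homog ->
    (forall m, mdeg m = N -> in_jacobian F0 'X_[m]) ->
  exists G : (monom n.+1 d -> k) -> k, [/\ polyfun G, exists c, G c != 0 &
    forall F, F \is d.-homog -> G (coefs F) != 0 -> smooth_hypersurface F].
Proof.
move=> hF0 inF0.
have /fin_all_exists[h hh] (c : monom n.+1 N) := inF0 _ (mdeg_monom c).
pose Rem F c := \sum_g h c g * jacobian_gen F g.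
pose m := #|{: monom n.+1 N}|.
pose B F : 'M[k]_m := \matrix_(i, j) (Rem F (enum_val i))@_(monom_exp (enum_val j)).
exists (fun c => \det (B (form c))); split.
- apply: polyfun_det => i j.
  have hform : mpolyfun (fun v => @form k n.+1 d v).
    by apply: mpolyfun_form => a; apply: polyfunX.
  have hrem : mpolyfun (fun v => Rem (@form k n.+1 d v) (enum_val i)).
    apply: mpolyfun_sum => -[l|]; apply: mpolyfunM => //; try exact: mpolyfunC.
    exact: mpolyfun_deriv.
  by apply: polyfun_ext (hrem (monom_exp (enum_val j))) => v; rewrite mxE.
- exists (coefs F0); rewrite form_coefs //.
  suff -> : B F0 = 1%:M by rewrite det1 oner_neq0.
  apply/matrixP => i j; rewrite !mxE /Rem -hh mcoeffX.
  by rewrite (inj_eq (@monom_exp_inj _ _)) (inj_eq enum_val_inj).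
move=> F hF; rewrite form_coefs // => detB p [i pi0] Fp.
have [/existsP[j Fj]|/existsPn no] := boolP [exists j, F^`M(j).@[p] != 0].
  by exists j.
have hgen g : (jacobian_gen F g).@[p] = 0.
  by case: g => [j|] //=; apply/eqP; rewrite -[_ == _]negbK no.
(* The multipliers need not be homogeneous. Vanishing on the whole line through [p] passes to the
   component of degree [N], the only one seen by [B]. *)
have hline c t : (Rem F c).@[fun i => t * p i] = 0.
  rewrite raddf_sum big1 //= => g _; rewrite mevalM.
  case: g (hgen g) => [j|] /= hg; last by rewrite (homog_scale _ _ hF) hg !mulr0.
  by rewrite (homog_scale _ _ (mderiv_homog j hF)) hg !mulr0.
pose u : 'cV[k]_m := \col_j ('X_[monom_exp (enum_val j)]).@[p].
have Bu : B F *m u = 0.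
  apply/colP => a; rewrite !mxE.
  have := pihomog_eq0_on_line (fun t _ => hline (enum_val a) t) N.
  rewrite -(form_coefs (pihomogP mdeg N _)) raddf_sum /= => h0.
  apply: etrans h0; rewrite [RHS](reindex _ (onW_bij _ (@enum_val_bij (monom n.+1 N)))) /=.
  apply: eq_bigr => b _; rewrite !mxE mevalZ /coefs mcoeff_pihomog.
  by rewrite mdeg_monom eqxx.
have u0 : u = 0.
  have uB : B F \in unitmx by rewrite unitmxE unitfE.
  by rewrite -[u](mulKmx uB) Bu mulmx0.
have mdegi : mdeg (U_(i) *+ N)%MM = N by rewrite mdegMn mdeg1 mul1n.
have [a ha] := monom_of mdegi.
have := congr1 (fun w : 'cV_m => w (enum_rank a) 0) u0.
rewrite !mxE enum_rankK ha -mpolyXn rmorphXn /= mevalXU => /eqP.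
by rewrite expf_eq0 (negPf pi0) andbF.
Qed.

Lemma general_smooth : (1 <= n)%N -> (1 <= d)%N ->
  exists G : (monom n.+1 d -> k) -> k, [/\ polyfun G, exists c, G c != 0 &
    forall F, F \is d.-homog -> G (coefs F) != 0 -> smooth_hypersurface F].
Proof.
move=> n0 d0.
suff [F0 hF0 hrad] : exists2 F0, F0 \is d.-homog & forall i, in_jacobian_rad F0 'X_i.
  by have [N hN] := jacobian_monomials hrad; apply: smooth_from_jacobian hN.
have mX i : ('X_i : {mpoly k[n.+1]}) \is 1.-homog by rewrite dhomogX; apply/eqP/mdeg1.
have mXn i m : ('X_i : {mpoly k[n.+1]}) ^+ m \is m.-homog.
  by have := dhomogMn m (mX i); rewrite mul1n.
(* Fermat's equation if [d] is invertible, and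
   x_0^d + \sum_(i < n) x_i x_(i+1)^(d-1) otherwise. *)
have [dk|dk] := eqVneq (d%:R : k) 0; last first.
  exists (\sum_i 'X_i ^+ d); first by apply: rpred_sum.
  move=> i; apply: (@in_radX _ _ d.-1); apply: in_rad.
  have -> : 'X_i ^+ d.-1 = (d%:R^-1)%:MP * jacobian_gen (\sum_i 'X_i ^+ d) (Some i).
    rewrite /= raddf_sum /= (bigD1 i) //= big1 ?addr0 => [|j ji].
      rewrite mderivXn mderivXU eqxx mulr1 -[X in _ * X]mulr_natl mulrA -mpolyC_nat -mpolyCM mulVf //.
      by rewrite mpolyC1 mul1r.
    by rewrite mderivXn mderivXU (negPf ji) mulr0 mul0rn.
  exact/in_jacobianM/in_jacobian_gen.
have d1 : (1 < d)%N.
  by case: d d0 dk => [|[|]] // _ /eqP; rewrite oner_eq0.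
pose x j : {mpoly k[n.+1]} := 'X_(inord j).
have dx i j : (i <= n)%N -> (j <= n)%N -> (x i)^`M(inord j) = (i == j)%:R.
  by move=> hi hj; rewrite mderivXU -val_eqE /= !inordK.
pose F0 := x 0%N ^+ d + \sum_(0 <= i < n) x i * x i.+1 ^+ d.-1.
have inF g : in_jacobian_rad F0 (jacobian_gen F0 g) by apply/in_rad/in_jacobian_gen.
have dF j : (0 < j < n)%N ->
    F0^`M(inord j) = x j.+1 ^+ d.-1 + x j.-1 * (x j ^+ d.-2 *+ d.-1).
  move=> /andP[j0 jn];
  rewrite mderivD mderivXn dx //; last by lia.
  rewrite eq_sym (negPf (lt0n_neq0 j0)) mulr0 mul0rn add0r raddf_sum /=.
  rewrite big_mkord (eq_bigr (fun i : 'I_n => (i == j :> nat)%:R * x i.+1 ^+ d.-1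
    + (i.+1 == j)%:R * (x i * (x i.+1 ^+ d.-2 *+ d.-1)))); last first.
    move=> i _; have hi := ltn_ord i.
    by rewrite mderivM mderivXn !dx //; [case: (_ == _); case: (_ == _) => /=; ring | lia..].
  rewrite big_split /= (bigD1 (Ordinal jn)) //= eqxx mul1r big1 ?addr0; last first.
    by move=> i; rewrite -val_eqE /= => /negPf ->; rewrite mul0r.
  have jn1 : (j.-1 < n)%N by lia.
  rewrite (bigD1 (Ordinal jn1)) //= prednK // eqxx mul1r big1 ?addr0 // => i.
  by rewrite -val_eqE /= -(eqn_add2r 1) !addn1 prednK // => /negPf ->; rewrite mul0r.
have dF0 : F0^`M(inord 0) = x 1%N ^+ d.-1.
  rewrite mderivD mderivXn dx // mulr1 -mulr_natl -mpolyC_nat dk mpolyC0 mul0r add0r.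
  rewrite raddf_sum big_mkord /= (bigD1 (Ordinal n0)) //= big1 ?addr0.
    by rewrite mderivM mderivXn !dx // mul1r /= !mulr0 mul0rn mulr0 addr0.
  move=> i; rewrite -val_eqE /= => /negPf i0; have hi := ltn_ord i.
  rewrite mderivM mderivXn !dx //; last by lia.
  by rewrite i0 mul0r !mulr0 mul0rn mulr0 addr0.
have d1' : d.-1 = d.-2.+1 by lia.
(* The derivative at [x_0] gives [x_1], since [d = 0] in [k]; steps of two give all odd indices.
   Each product in [F0] has a factor of odd index, so [F0] gives [x_0], and the same steps give the
   even ones. *)
have step j : (0 < j < n)%N -> in_jacobian_rad F0 (x j.-1) -> in_jacobian_rad F0 (x j.+1).
  move=> hj hr; apply: (@in_radX _ _ d.-1).
  have := inF (Some (inord j)); rewrite /= dF // => h1.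
  rewrite -[_ ^+ _](addrK (x j.-1 * (x j ^+ d.-2 *+ d.-1))); apply: in_radD => //.
  by rewrite -mulrN mulrC; apply: in_radM.
have rad1 : in_jacobian_rad F0 (x 1%N).
  by apply: (@in_radX _ _ d.-1); have := inF (Some (inord 0)); rewrite /= dF0.
have radodd i : ((i.*2).+1 <= n)%N -> in_jacobian_rad F0 (x (i.*2).+1).
  elim: i => [|i IH] hi //; apply: (step (i.*2).+2); first by lia.
  by apply: IH; lia.
have rad0 : in_jacobian_rad F0 (x 0%N).
  apply: (@in_radX _ _ d).
  rewrite -[_ ^+ _](addrK (\sum_(0 <= i < n) x i * x i.+1 ^+ d.-1)).
  apply: in_radD; first exact: (inF None).
  rewrite -sumrN big_mkord; apply: in_rad_sum => i _; have hi := ltn_ord i.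
  have [oi|ei] := boolP (odd i).
    rewrite -mulrN mulrC -[val i](odd_double_half i) oi add1n; apply/in_radM/radodd.
    by rewrite -[i in (_ <= i)%N]odd_double_half; lia.
  rewrite -mulNr d1' exprSr mulrA -[val i](odd_double_half i) (negPf ei) add0n.
  by apply/in_radM/radodd; lia.
have radeven i : (i.*2 <= n)%N -> in_jacobian_rad F0 (x i.*2).
  elim: i => [|i IH] hi //; apply: (step (i.*2).+1); first by lia.
  by apply: IH; lia.
exists F0.
  apply: rpredD; first exact: mXn.
   apply: rpred_sum => i _.
  by have := dhomogM (mX (inord i)) (mXn (inord i.+1) d.-1); rewrite add1n prednK.
move=> i; have hi := ltn_ord i.
have -> : 'X_i = x i by rewrite /x inord_val.
rewrite -[val i](odd_double_half i); case: (odd i) (odd_double_half i) => /= e.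
  by apply: radodd; lia.
by apply: radeven; lia.
Qed.

End SmoothOpen.

(** * Ampleness on the projective line *)
Section Congruence.

Variables (R : comNzRingType) (u : R).

(** This is [eq_overlap] for [u = ovx k * ovy k - 1]; a general [u] also allows the constant [u%:MP]
    in a polynomial ring. *)
Definition congr_mod (p q : R) : Prop := exists h, p = q + h * u.

Lemma congr_refl p : congr_mod p p.
Proof. by exists 0; rewrite mul0r addr0. Qed.

Lemma congr_sym p q : congr_mod p q -> congr_mod q p.
Proof. by move=> [h ->]; exists (- h); ring. Qed.

Lemma congr_trans p q r : congr_mod p q -> congr_mod q r -> congr_mod p r.
Proof. by move=> [h ->] [h' ->]; exists (h + h'); ring. Qed.

Lemma congrD p q p' q' : congr_mod p q -> congr_mod p' q' -> congr_mod (p + p') (q + q').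
Proof. by move=> [h ->] [h' ->]; exists (h + h'); ring. Qed.

Lemma congrM p q p' q' : congr_mod p q -> congr_mod p' q' -> congr_mod (p * p') (q * q').
Proof. by move=> [h ->] [h' ->]; exists (h * q' + h' * q + h * h' * u); ring. Qed.

Lemma congrX p q m : congr_mod p q -> congr_mod (p ^+ m) (q ^+ m).
Proof.
move=> e; elim: m => [|m IH]; first by rewrite !expr0; apply: congr_refl.
by rewrite !exprS; apply: congrM.
Qed.

Lemma congr_sum (I : Type) (r : seq I) (F G : I -> R) :
  (forall i, congr_mod (F i) (G i)) -> congr_mod (\sum_(i <- r) F i) (\sum_(i <- r) G i).
Proof.
move=> e; elim: r => [|i r IH]; first by rewrite !big_nil; apply: congr_refl.
by rewrite !big_cons; apply: congrD.
Qed.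

Lemma congr_prod (I : Type) (r : seq I) (F G : I -> R) :
  (forall i, congr_mod (F i) (G i)) -> congr_mod (\prod_(i <- r) F i) (\prod_(i <- r) G i).
Proof.
move=> e; elim: r => [|i r IH]; first by rewrite !big_nil; apply: congr_refl.
by rewrite !big_cons; apply: congrM.
Qed.

End Congruence.

(** * Symmetric powers of matrices *)

Section SymmetricPower.

Variables (R : comNzRingType) (m : nat).

Definition sym_image s r (P : 'M[R]_(s, r)) (b : monom s m) : {mpoly R[r]} :=
  \prod_(j < s) (\sum_(i < r) P j i *: 'X_i) ^+ monom_exp b j.

(** The matrix of S^m(P) in the monomial bases; [sym_transition] is the case of a transition
    matrix. *)
Definition sym_mx s r (P : 'M[R]_(s, r)) (b : monom s m) (a : monom r m) : R :=
  (sym_image P b)@_(monom_exp a).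

Lemma sym_image_form s r (P : 'M[R]_(s, r)) b : sym_image P b = form (sym_mx P b).
Proof.
suff h : sym_image P b \is m.-homog by rewrite -[LHS](form_coefs h).
have e : (\sum_(j < s) 1 * monom_exp b j)%N = m.
  by rewrite -[RHS](mdeg_monom b) mdegE; apply: eq_bigr => j _; rewrite mul1n.
rewrite -[X in X.-homog]e.
apply: prod_homog => j; apply: dhomogMn; apply: rpred_sum => i _.
by apply: rpredZ; rewrite dhomogX; apply/eqP/mdeg1.
Qed.

Lemma sym_mxM s r l (P : 'M[R]_(s, r)) (Q : 'M[R]_(r, l)) b c :
  sym_mx (P *m Q) b c = \sum_a sym_mx P b a * sym_mx Q a c.
Proof.
pose q := [tuple \sum_(i < l) Q j i *: 'X_i | j < r] : r.-tuple {mpoly R[l]}.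
have -> : sym_mx (P *m Q) b c = (sym_image P b \mPo q)@_(monom_exp c).
  congr _@__; rewrite /sym_image rmorph_prod; apply: eq_bigr => j _.
  rewrite rmorphXn; congr (_ ^+ _); rewrite raddf_sum /=.
  rewrite (eq_bigr (fun i : 'I_r => \sum_(h < l) (P j i * Q i h) *: 'X_h)); last first.
    move=> i _; rewrite comp_mpolyZ comp_mpolyXU -tnth_nth tnth_mktuple scaler_sumr.
    by apply: eq_bigr => h _; rewrite scalerA.
  by rewrite exchange_big; apply: eq_bigr => h _; rewrite mxE scaler_suml.
rewrite sym_image_form form_comp raddf_sum; apply: eq_bigr => a _.
rewrite /= mcoeffZ; congr (_ * _@__); apply: eq_bigr => j _.
by rewrite tnth_mktuple.
Qed.

Lemma sym_mx1 r (b a : monom r m) : sym_mx 1%:M b a = (b == a)%:R.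
Proof.
rewrite -(inj_eq (@monom_exp_inj _ _)) -mcoeffX mpolyXE_id; congr _@__.
apply: eq_bigr => j _; congr (_ ^+ _).
rewrite (bigD1 j) //= mxE eqxx scale1r big1 ?addr0 // => i ij.
by rewrite mxE eq_sym (negPf ij) scale0r.
Qed.

Lemma sym_mxZ s r x (P : 'M[R]_(s, r)) b a : sym_mx (x *: P) b a = x ^+ m * sym_mx P b a.
Proof.
rewrite /sym_mx -mcoeffZ; congr _@__; rewrite -[X in _ ^+ X](mdeg_monom b) mdegE expr_sum.
rewrite -mul_mpolyC rmorph_prod -big_split; apply: eq_bigr => j _ /=.
rewrite rmorphXn -exprMn; congr (_ ^+ _); rewrite mulr_sumr.
by apply: eq_bigr => i _; rewrite mxE mul_mpolyC scalerA.
Qed.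

Lemma congr_sym_mx s r u (P Q : 'M[R]_(s, r)) b a :
  (forall j i, congr_mod u (P j i) (Q j i)) -> congr_mod u (sym_mx P b a) (sym_mx Q b a).
Proof.
move=> h.
have [g eg] : congr_mod u%:MP (sym_image P b) (sym_image Q b).
  apply: congr_prod => j; apply: congrX; apply: congr_sum => i.
  have [g ->] := h j i; exists (g *: 'X_i).
  by rewrite scalerDl [_ * u%:MP]mulrC mul_mpolyC scalerA [u * g]mulrC.
by exists g@_(monom_exp a); rewrite /sym_mx eg mcoeffD [g * _]mulrC mcoeffCM [u * _]mulrC.
Qed.

End SymmetricPower.

Lemma map_sym_mx (R S : comNzRingType) (f : {rmorphism R -> S}) m s r (P : 'M[R]_(s, r))
    (b : monom s m) (a : monom r m) : sym_mx (map_mx f P) b a = f (sym_mx P b a).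
Proof.
rewrite /sym_mx -mcoeff_map_mpoly; congr _@__; rewrite rmorph_prod; apply: eq_bigr => j _.
rewrite rmorphXn; congr (_ ^+ _); rewrite raddf_sum; apply: eq_bigr => i _ /=.
by rewrite map_mpolyZ map_mpolyX mxE.
Qed.

Section Generation.

Variables (R : comNzRingType).

Definition spanned (M : lmodType R) (S : M -> Prop) (z : M) : Prop :=
  exists (q : nat) (c : 'I_q -> R) (v : 'I_q -> M),
    (forall i, S (v i)) /\ z = \sum_(i < q) c i *: v i.

Lemma spanned0 (M : lmodType R) (S : M -> Prop) : spanned S 0.
Proof.
exists 0%N, (fun=> 0), (fun=> 0); split; first by case.
by rewrite big_ord0.
Qed.

Lemma spannedD (M : lmodType R) (S : M -> Prop) z z' :
  spanned S z -> spanned S z' -> spanned S (z + z').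
Proof.
move=> [q [c [v [hv ->]]]] [q' [c' [v' [hv' ->]]]].
exists (q + q')%N, (fun i => match split i with inl j => c j | inr j => c' j end),
  (fun i => match split i with inl j => v j | inr j => v' j end); split.
  by move=> i; case: (split i).
rewrite big_split_ord /=; congr (_ + _); apply: eq_bigr => i _.
  by rewrite (unsplitK (inl _ i)).
by rewrite (unsplitK (inr _ i)).
Qed.

Lemma spannedZ (M : lmodType R) (S : M -> Prop) a z : spanned S z -> spanned S (a *: z).
Proof.
move=> [q [c [v [hv ->]]]]; exists q, (fun i => a * c i), v; split=> //.
by rewrite scaler_sumr; apply: eq_bigr => i _; rewrite scalerA.
Qed.

Lemma spanned_sum (M : lmodType R) (S : M -> Prop) (I : Type) (r : seq I) (F : I -> M) :
  (forall i, spanned S (F i)) -> spanned S (\sum_(i <- r) F i).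
Proof.
by move=> hF; apply: (big_ind (spanned S)) => //; [apply: spanned0 | apply: spannedD].
Qed.

Lemma spanned_mem (M : lmodType R) (S : M -> Prop) z : S z -> spanned S z.
Proof.
move=> Sz; exists 1%N, (fun=> 1), (fun=> z); split=> //.
by rewrite big_ord1 scale1r.
Qed.

(** The image under S^m(P) of the basis monomial [b], tensored with [u]. *)
Definition sym_section (M : lmodType R) m s r (P : 'M[R]_(s, r)) (b : monom s m) (u : M) :
    {ffun monom r m -> M} :=
  [ffun a => sym_mx P b a *: u].

(** By functoriality S^m(Q) S^m(P) = 1, so the rows of S^m(P) generate, and generators of [M]
    suffice for [u]. *)
Lemma sym_section_generates (M : lmodType R) m s r (P : 'M[R]_(s, r)) (Q : 'M[R]_(r, s))
    (Sgen : M -> Prop) (S : {ffun monom r m -> M} -> Prop) :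
    Q *m P = 1%:M -> generates Sgen ->
    (forall b u, Sgen u -> S (sym_section P b u)) ->
  generates S.
Proof.
move=> QP gen hS z; change (spanned S z).
have -> : z = \sum_a \sum_b sym_mx Q a b *: sym_section P b (z a).
  apply/ffunP => c; rewrite sum_ffunE.
  rewrite (eq_bigr (fun a => (a == c)%:R *: z a)); last first.
    move=> a _; rewrite sum_ffunE -sym_mx1 -QP sym_mxM scaler_suml.
    by apply: eq_bigr => b _; rewrite !ffunE scalerA.
  rewrite (bigD1 c) //= eqxx scale1r big1 ?addr0 // => a /negPf ->.
  by rewrite scale0r.
apply: spanned_sum => a; apply: spanned_sum => b; apply: spannedZ.
have [q [c [v [hv ->]]]] := gen (z a).
have -> : sym_section P b (\sum_(i < q) c i *: v i) = \sum_(i < q) c i *: sym_section P b (v i).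
  apply/ffunP => e; rewrite sum_ffunE ffunE scaler_sumr; apply: eq_bigr => i _.
  by rewrite !ffunE !scalerA mulrC.
by apply: spanned_sum => i; apply: spannedZ; apply: spanned_mem; apply: hS.
Qed.

End Generation.

Section Restriction.

Variable k : fieldType.

Lemma restr_x_is_zmod_morphism : zmod_morphism (@restr_x k).
Proof. by move=> p q; rewrite /restr_x rmorphB hornerD hornerN. Qed.
Lemma restr_x_is_monoid_morphism : monoid_morphism (@restr_x k).
Proof.
by split=> [|p q]; rewrite /restr_x ?rmorph1 ?hornerC // rmorphM hornerM.
Qed.
HB.instance Definition _ := GRing.isZmodMorphism.Build _ _ (@restr_x k) restr_x_is_zmod_morphism.
HB.instance Definition _ := GRing.isMonoidMorphism.Build _ _ (@restr_x k) restr_x_is_monoid_morphism.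

Lemma restr_y_is_zmod_morphism : zmod_morphism (@restr_y k).
Proof. by move=> p q; rewrite /restr_y rmorphB hornerD hornerN. Qed.
Lemma restr_y_is_monoid_morphism : monoid_morphism (@restr_y k).
Proof.
by split=> [|p q]; rewrite /restr_y ?rmorph1 ?hornerC // rmorphM hornerM.
Qed.
HB.instance Definition _ := GRing.isZmodMorphism.Build _ _ (@restr_y k) restr_y_is_zmod_morphism.
HB.instance Definition _ := GRing.isMonoidMorphism.Build _ _ (@restr_y k) restr_y_is_monoid_morphism.

Lemma restr_xXn N : restr_x ('X^N : {poly k}) = ovx k ^+ N.
Proof. by rewrite rmorphXn /= /restr_x map_polyX hornerX. Qed.
Lemma restr_yXn N : restr_y ('X^N : {poly k}) = ovy k ^+ N.
Proof. by rewrite rmorphXn /= /restr_y map_polyX hornerX. Qed.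

End Restriction.

Section Ample.

Variable k : fieldType.

Lemma overlap_scale (L : coherent_P1 k) p q (z : sect01 L) : eq_overlap p q -> p *: z = q *: z.
Proof.
move=> [h ->]; rewrite scalerDl -scalerA scalerBl sect01_xy scale1r subrr.
by rewrite scaler0 addr0.
Qed.

Lemma overlap_scaleX (L : coherent_P1 k) N (z : sect01 L) :
  (ovx k ^+ N * ovy k ^+ N) *: z = z.
Proof.
rewrite -exprMn; elim: N => [|N IH]; first by rewrite expr0 scale1r.
by rewrite exprSr -scalerA sect01_xy.
Qed.

(** The equation says that [u] and [w] glue to a global section of L(m): a large twist absorbs the
    poles at the other chart's origin. *)
Lemma extend_from0 (L : coherent_P1 k) (u : sect0 L) :
  exists N, forall m, (N <= m)%N -> exists w : sect1 L, res0 L u = ovx k ^+ m *: res1 L w.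
Proof.
have [N [w hw]] := res1_loc (res0 L u).
exists N => m le; exists ('X^(m - N) *: w).
rewrite res1_scale -hw restr_yXn [ovy k ^+ _ *: _]scalerA -exprD subnK //.
by rewrite scalerA overlap_scaleX.
Qed.

Lemma extend_from1 (L : coherent_P1 k) (w : sect1 L) :
  exists N, forall m, (N <= m)%N -> exists u : sect0 L, res0 L u = ovx k ^+ m *: res1 L w.
Proof.
have [N [u hu]] := res0_loc (res1 L w).
exists N => m le; exists ('X^(m - N) *: u).
by rewrite res0_scale -hu scalerA restr_xXn -exprD subnK.
Qed.

Lemma uniform_bound (T : eqType) (s : seq T) (B : T -> nat -> Prop) :
  (forall u, exists N, forall m, (N <= m)%N -> B u m) ->
  exists N, forall u, u \in s -> forall m, (N <= m)%N -> B u m.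
Proof.
move=> h; elim: s => [|u s [N hN]]; first by exists 0%N.
have [N' hN'] := h u; exists (maxn N N') => v; rewrite inE => /orP[/eqP->|vs] m;
  rewrite geq_max => /andP[h1 h2]; [exact: hN' | exact: hN].
Qed.

(* The rows of [P0] and [P1] are sections of [E(-1)] generating [E], i.e. a
   surjection from a sum of copies of O(1) onto E; so Sym^m E (x) L is a quotient of a
   sum of copies of L(m). *)
Theorem ample_of_generated r s (P0 P1 : 'M[{poly k}]_(s, r)) (Q0 Q1 : 'M[{poly k}]_(r, s))
    (g : 'M[{mpoly k[2]}]_r) :
    Q0 *m P0 = 1%:M -> Q1 *m P1 = 1%:M ->
    (forall j i, eq_overlap ((map_mx (@restr_y k) P1 *m g) j i)
                            ((ovx k *: map_mx (@restr_x k) P0) j i)) ->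
  ample g.
Proof.
move=> QP0 QP1 hg L.
have [s0 gen0] := sect0_fg L; have [s1 gen1] := sect1_fg L.
have [N0 h0] := uniform_bound s0 (@extend_from0 L).
have [N1 h1] := uniform_bound s1 (@extend_from1 L).
exists (maxn N0 N1) => m; rewrite geq_max => /andP[le0 le1].
(* S^m raises the factor [ovx k] relating [P0] and [P1] to the power [m], which matches the gluing
   of [u] and [w] in L(m). *)
have glob (b : monom s m) (u : sect0 L) (w : sect1 L) :
    res0 L u = ovx k ^+ m *: res1 L w ->
    global_section g (sym_section P0 b u) (sym_section P1 b w).
  move=> e a; rewrite ffunE res0_scale e scalerA.
  rewrite (eq_bigr (fun c => (sym_mx (map_mx (@restr_y k) P1) b c * sym_mx g c a) *: res1 L w)); last first.
    by move=> c _; rewrite ffunE res1_scale scalerA mulrC map_sym_mx.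
  rewrite -scaler_suml -sym_mxM.
  rewrite (overlap_scale _ (congr_sym_mx b a hg)) sym_mxZ map_sym_mx.
  by rewrite mulrC.
split.
  apply: (sym_section_generates QP0 gen0) => b u /h0/(_ m le0)[w hw].
  by exists (sym_section P1 b w); apply: glob.
apply: (sym_section_generates QP1 gen1) => b w /h1/(_ m le1)[u hu].
by exists (sym_section P0 b u); apply: glob.
Qed.

End Ample.

(** * Unimodular matrices over k[x] *)
Section PolynomialMatrices.

Variable k : closedFieldType.
Local Notation A := {poly k}.

Lemma bezout_pair (p q : A) : exists g a b u w : A,
  [/\ p = g * a, q = g * b & u * a + w * b = 1].
Proof.
have [[u w] /= huw] := Bezoutp p q.
pose g := u * p + w * q.
have dp : g %| p by rewrite (eqp_dvdl _ huw) dvdp_gcdl.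
have dq : g %| q by rewrite (eqp_dvdl _ huw) dvdp_gcdr.
have [g0|g0] := eqVneq g 0.
  exists 0, 1, 0, 1, 0; rewrite !mul0r mulr1 addr0.
  by move: dp dq; rewrite g0 !dvd0p => /eqP -> /eqP ->.
exists g, (p %/ g), (q %/ g), u, w.
have ep : p = g * (p %/ g) by rewrite mulrC divpK.
have eq : q = g * (q %/ g) by rewrite mulrC divpK.
split=> //; apply: (mulfI g0); rewrite mulr1 mulrDr !(mulrCA g).
by rewrite -ep -eq.
Qed.

Lemma row_reduce m (v : 'rV[A]_m.+1) :
  exists2 T : 'M[A]_m.+1, T \in unitmx & exists g : A, v *m T = g *: delta_mx 0 0.
Proof.
elim: m v => [|m IH] v.
  exists 1%:M; first exact: unitmx1.
  by exists (v 0 0); apply/rowP => j; rewrite mulmx1 !mxE !ord1 eqxx mulr1.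
pose v' : 'rV[A]_(1 + m.+1) := v.
have [T' uT' [g' eT']] := IH (rsubmx v').
have [g [a [b [u [w [ep eq ebez]]]]]] := bezout_pair (v 0 0) g'.
pose T1 : 'M[A]_(1 + m.+1) := block_mx 1%:M 0 0 T'.
have uT1 : T1 \in unitmx by rewrite unitmxE det_ublock det1 mul1r -unitmxE.
have vT1 : v' *m T1 = row_mx (lsubmx v') (g' *: delta_mx 0 0).
  by rewrite -[v' in LHS]hsubmxK mul_row_block mulmx1 !mulmx0 addr0 add0r eT'.
(* [Z] has determinant [u * a + w * b = 1] and sends [(g * a, g * b)] to [(g, 0)]. *)
pose Z : 'M[A]_2 := \matrix_(i < 2, j < 2)
  if i == 0 then (if j == 0 then u else - b) else (if j == 0 then w else a).
pose T2 : 'M[A]_(2 + m) := block_mx Z 0 0 1%:M.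
have uT2 : T2 \in unitmx.
  rewrite unitmxE det_ublock det1 mulr1 (expand_det_row _ 0) !big_ord_recl big_ord0 addr0.
  rewrite /cofactor !det_mx11 !mxE /= expr0 mul1r expr1 mulN1r mulrN mulNr opprK [b * _]mulrC.
  by rewrite ebez unitr1.
exists (T1 *m T2 : 'M[A]_m.+2); first by rewrite unitmx_mul uT1.
exists g; rewrite mulmxA.
pose y : 'rV[A]_(2 + m) := v' *m T1.
have yE j (j' : 'I_(1 + m.+1)) : val j = val j' ->
    y 0 j = (row_mx (lsubmx v') (g' *: delta_mx 0 0)) 0 j'.
  by move=> e; rewrite -vT1; congr (y _ _); apply: val_inj.
have y0 : y 0 0 = g * a.
  by rewrite (yE _ (lshift _ 0)) // row_mxEl mxE -ep; congr (v _ _); apply: val_inj.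
have y1 : y 0 (lift 0 0) = g * b.
  by rewrite (yE _ (rshift _ 0)) // row_mxEr !mxE !eqxx mulr1.
have yr : rsubmx y = 0.
  by apply/rowP => j; rewrite mxE (yE _ (rshift _ (lift 0 j))) // row_mxEr !mxE /= mulr0.
have -> : v *m T1 *m T2 = y *m T2 by [].
rewrite -[y]hsubmxK yr mul_row_block !mulmx0 !mul0mx !addr0.
apply/rowP => j; rewrite -[j](@splitK 2 m); case: (@split 2 m j) => i /=; last first.
  by apply: etrans (row_mxEr (lsubmx y *m Z) 0 0 i) _; rewrite !mxE /= mulr0.
apply: etrans (row_mxEl (lsubmx y *m Z) 0 0 i) _.
have ly0 : lsubmx y 0 0 = g * a by rewrite mxE -y0; congr (y _ _); apply: val_inj.
have ly1 : lsubmx y 0 (lift 0 0) = g * b by rewrite mxE -y1; congr (y _ _); apply: val_inj.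
rewrite [LHS]mxE !big_ord_recl big_ord0 addr0 ly0 ly1 !mxE /=.
 case: i => [[|[|//]]] hi /=.
  by rewrite mulr1 -!mulrA -mulrDr [a * _]mulrC [b * _]mulrC ebez mulr1.
by rewrite mulr0; ring.
Qed.

(** Over a closed field, having no common zero on the affine line is the same as generating the unit
    ideal. *)
Definition unimodular r s (v : 'M[A]_(r, s)) : Prop :=
  forall a, exists i j, (v i j).[a] != 0.

(** The gcd left by row reduction has no root, hence is a nonzero constant. *)
Lemma unimodular_completion m (v : 'rV[A]_m.+1) : unimodular v ->
  exists2 T : 'M[A]_m.+1, T \in unitmx & v *m T = delta_mx 0 0.
Proof.
move=> uv; have [T uT [g eg]] := row_reduce v.
have g1 : size g == 1%N.
  apply: contraT => /closed_rootP[a /rootP ga]; have [i [j]] := uv a.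
  rewrite ord1 -[v](mulmxK uT) eg -scalemxAl mxE hornerM ga mul0r eqxx //.
have gC := size1_polyC (eq_leq (eqP g1)).
have c0 : g`_0 != 0 by apply: contraTneq g1 => c0; rewrite gC c0 size_poly0.
exists (((g`_0)^-1)%:P *: T).
  by rewrite unitmxZ // poly_unitE size_polyC coefC eqxx unitfE invr_eq0 c0.
by rewrite -scalemxAr eg scalerA {2}gC -polyCM mulVf // scale1r.
Qed.

Definition ev_mx (a : k) r s (P : 'M[A]_(r, s)) : 'M[k]_(r, s) := map_mx (horner_eval a) P.

(** Fibrewise injective implies split: the first column vanishes nowhere, so it can be made a unit
    vector, and the lower right block is again fibrewise injective. *)
Lemma full_rank_left_inverse s r (P : 'M[A]_(s, r)) :
    (forall a (x : 'cV[k]_r), ev_mx a P *m x = 0 -> x = 0) ->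
  exists Q : 'M[A]_(r, s), Q *m P = 1%:M.
Proof.
elim: r s P => [|r IH] s P full.
  by exists 0; rewrite [RHS]flatmx0 [LHS]flatmx0.
case: s P full => [|s] P full.
  have := full 0 (delta_mx 0 0); rewrite [ev_mx _ _ *m _]flatmx0 => /(_ erefl).
  by move/matrixP/(_ 0 0)/eqP; rewrite !mxE !eqxx oner_eq0.
pose P' : 'M[A]_(1 + s, 1 + r) := P.
have ucol : unimodular (lsubmx P')^T.
  move=> a; have [/existsP[i hi]|/existsPn no] := boolP [exists i, (P i 0).[a] != 0].
    exists 0, i; rewrite !mxE (_ : lshift r 0 = 0) //; exact: val_inj.
  have := full a (delta_mx 0 0).
  have -> : ev_mx a P *m delta_mx 0 0 = 0 :> 'cV_s.+1.
    apply/colP => i; rewrite !mxE (bigD1 0) //= !mxE eqxx mulr1 big1 ?addr0.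
      by apply/eqP; rewrite -[_ == _]negbK; apply: no.
    by move=> j j0; rewrite !mxE (negPf j0) mulr0.
  by move=> /(_ erefl)/matrixP/(_ 0 0)/eqP; rewrite !mxE !eqxx oner_eq0.
have [S uS eS] := unimodular_completion ucol.
pose T : 'M[A]_(1 + s) := S^T.
have uT : T \in unitmx by rewrite unitmx_tr.
have TP0 : T *m lsubmx P' = delta_mx 0 0 by rewrite -[LHS]trmxK trmx_mul trmxK eS trmx_delta.
pose TP : 'M[A]_(1 + s, 1 + r) := T *m P'.
pose b := ursubmx TP; pose P2 := drsubmx TP.
have eTP : TP = block_mx 1%:M b 0 P2.
  rewrite -[LHS]submxK.
  have el : lsubmx TP = delta_mx 0 0 by rewrite -TP0 /TP -[P' in LHS]hsubmxK mul_mx_row row_mxKl.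
  have elE i : TP i (lshift r 0) = (i == 0)%:R.
    by have := congr1 (fun M : 'cV_(1 + s) => M i 0) el; rewrite [LHS]mxE => ->; rewrite mxE andbT.
  congr (block_mx _ _ _ _); apply/matrixP => i j.
    by rewrite 2![LHS]mxE [j]ord1 elE [i]ord1 mxE.
  by rewrite 2![LHS]mxE [j]ord1 elE mxE.
have full2 a (x : 'cV[k]_r) : ev_mx a P2 *m x = 0 -> x = 0.
  (* The first entry of [y] is chosen to cancel the top row of the block matrix. *)
  move=> h; pose y : 'cV[k]_(1 + r) := col_mx (- (ev_mx a b *m x)) x.
  have : y = 0; last by rewrite -[0]vsubmxK => /eq_col_mx[_ ->]; rewrite linear0.
  apply: (full a); have uTa : ev_mx a T \in unitmx by rewrite unitmxE det_map_mx rmorph_unit // -unitmxE.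
  rewrite -[LHS](mulKmx uTa) [ev_mx a T *m _]mulmxA (_ : ev_mx a T *m ev_mx a P =
    map_mx (horner_eval a) (block_mx 1%:M b 0 P2)); last first.
    by rewrite -eTP [RHS](map_mxM (horner_eval a)).
  have E : map_mx (horner_eval a) (block_mx 1%:M b 0 P2) *m y = 0.
    rewrite (map_block_mx (horner_eval a)) mul_block_col [X in col_mx _ (_ + X)]h.
    rewrite (map_mx1 (horner_eval a)) mul1mx addNr.
    by rewrite (map_mx0 (horner_eval a)) mul0mx addr0 col_mx0.
  by rewrite [X in _ *m X]E mulmx0.
have [Q2 hQ2] := IH _ _ full2.
have QTP : block_mx 1%:M (- (b *m Q2)) 0 Q2 *m TP = 1%:M.
  rewrite eTP mulmx_block !mul1mx !mul0mx !mulmx0 !add0r !addr0.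
  by rewrite mulNmx -mulmxA hQ2 mulmx1 subrr -scalar_mx_block.
by exists ((block_mx 1%:M (- (b *m Q2)) 0 Q2 : 'M[A]_(1 + r, 1 + s)) *m T); rewrite -mulmxA.
Qed.

(* Completes [f] and [phi] to a pair of dual bases: [C] and [V] are the remaining
   columns of an invertible matrix and rows of its inverse, so [V] is a frame of
   ker phi / f and [v |-> v *m C] gives the coordinates in it. *)
Lemma chart_frame m (f phi : 'rV[A]_m.+2) :
    unimodular f -> unimodular phi -> f *m phi^T = 0 ->
  exists (rho : 'rV[A]_m.+2) (V : 'M[A]_(m, m.+2)) (tau : 'cV[A]_m.+2) (C : 'M[A]_(m.+2, m)),
    [/\ f *m C = 0, V *m phi^T = 0, V *m C = 1%:M
      & tau *m f + phi^T *m rho + C *m V = 1%:M].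
Proof.
move=> uf uphi fphi.
have [T1 uT1 eT1] := unimodular_completion uf.
pose phi1 : 'cV[A]_(1 + m.+1) := invmx T1 *m phi^T.
(* In the basis where [f] is the first unit vector, [f *m phi^T] is the first coordinate of
   [phi]. *)
have phi10 : usubmx phi1 = 0.
  have h : row 0 (invmx T1 *m phi^T) = 0 by rewrite rowE -eT1 -mulmxA mulKVmx.
  have := congr1 (fun M : 'M_1 => M 0 0) h; rewrite [LHS]mxE [RHS]mxE => h0.
  apply/colP => j; rewrite ord1 [LHS]mxE [RHS]mxE -h0.
  by congr (fun_of_matrix _ _ _); apply: val_inj.
have uphi2 : unimodular (dsubmx phi1)^T.
  move=> a; have [/existsP[i hi]|/existsPn no] := boolP [exists i, (dsubmx phi1 i 0).[a] != 0].
    by exists 0, i; rewrite mxE.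
  have [i [j]] := uphi a; rewrite ord1 -[phi]trmxK mxE -[phi^T](mulKVmx uT1) -/phi1.
  rewrite mxE horner_sum big1 ?eqxx // => l _; rewrite hornerM.
  suff -> : (phi1 l 0).[a] = 0 by rewrite mulr0.
  rewrite -[phi1]vsubmxK phi10 -[l](@splitK 1 m.+1); case: (split _) => l' /=.
    by rewrite col_mxEu mxE horner0.
  by rewrite col_mxEd; apply/eqP; rewrite -[_ == _]negbK; apply: no.
have [S uS eS] := unimodular_completion uphi2.
pose R : 'M[A]_(1 + m.+1) := block_mx 1%:M 0 0 S^T.
have uR : R \in unitmx by rewrite unitmxE det_ublock det1 mul1r det_tr -unitmxE.
pose T' : 'M[A]_(1 + (1 + m)) := R *m invmx T1.
pose T : 'M[A]_(1 + (1 + m)) := T1 *m invmx R.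
have TT' : T *m T' = 1%:M by rewrite /T /T' -mulmxA (mulKmx uR) mulmxV.
have T'T : T' *m T = 1%:M by rewrite /T /T' -mulmxA (mulKmx uT1) mulmxV.
have T'phi : T' *m phi^T = col_mx 0 (delta_mx 0 0).
  rewrite /T' -mulmxA -/phi1 -[phi1]vsubmxK phi10 mul_block_col mul1mx !mul0mx !add0r.
  by congr col_mx; rewrite -[LHS]trmxK trmx_mul trmxK eS trmx_delta.
pose f' := usubmx T'; pose D := dsubmx T'; pose rho := usubmx D; pose V := dsubmx D.
have eT' : T' = col_mx f' (col_mx rho V) by rewrite !vsubmxK.
have e0E : delta_mx 0 0 = row_mx 1%:M (0 : 'rV[A]_m.+1) :> 'rV[A]_(1 + m.+1).
  apply/rowP => j; rewrite -[j](@splitK 1 m.+1); case: (split _) => l /=.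
    by rewrite row_mxEl !mxE !ord1.
  by rewrite row_mxEr !mxE.
have f'E : f' = f.
  transitivity (row_mx 1%:M (0 : 'rV[A]_m.+1) *m T').
    by rewrite -[T']vsubmxK mul_row_col mul1mx mul0mx addr0.
  rewrite /T' mulmxA mul_row_block mul1mx !mul0mx mulmx0 !addr0 -e0E -[RHS](mulmxK uT1).
  by congr (_ *m _); rewrite eT1.
pose tau := lsubmx T; pose E := rsubmx T; pose phi' := lsubmx E; pose C := rsubmx E.
have eT : T = row_mx tau (row_mx phi' C) by rewrite !hsubmxK.
have phi'E : phi' = phi^T.
  have h : T *m col_mx 0 (delta_mx 0 0) = phi^T by rewrite -T'phi mulmxA TT' mul1mx.
  have e0E' : delta_mx 0 0 = col_mx 1%:M (0 : 'cV[A]_m) :> 'cV[A]_(1 + m).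
    apply/colP => j; rewrite -[j](@splitK 1 m); case: (split _) => l /=.
      by rewrite col_mxEu !mxE !ord1.
    by rewrite col_mxEd !mxE.
  rewrite -h eT mul_row_col mulmx0 add0r [X in _ *m X]e0E' mul_row_col mulmx1.
  by rewrite mulmx0 addr0.
exists rho, V, tau, C; move: TT' T'T; rewrite eT eT' f'E phi'E.
rewrite !mul_row_col addrA => -> T'T.
move: T'T; rewrite mul_col_row mul_mx_row mul_col_mx mul_col_row.
rewrite scalar_mx_block => /eq_block_mx[_ h1 h2 h3].
move: h1; rewrite -row_mx0 => /eq_row_mx[_ ->].
move: h3; rewrite scalar_mx_block => /eq_block_mx[_ _ -> ->].
by [].
Qed.

End PolynomialMatrices.

(** * Binary forms *)
Lemma comp_homog (k : comNzRingType) n l d e (F : {mpoly k[n]}) (f : n.-tuple {mpoly k[l]}) :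
  F \is d.-homog -> (forall i, tnth f i \is e.-homog) -> F \mPo f \is (d * e)%N.-homog.
Proof.
move=> hF hf; rewrite -(form_coefs hF) form_comp; apply: rpred_sum => a _; apply: rpredZ.
have E : (\sum_(i < n) e * monom_exp a i)%N = (d * e)%N.
  by rewrite -big_distrr /= -mdegE mdeg_monom mulnC.
by rewrite -E; apply: prod_homog => i; apply: dhomogMn.
Qed.

Lemma euler_formula (k : comNzRingType) n d (F : {mpoly k[n]}) :
  F \is d.-homog -> \sum_i 'X_i * F^`M(i) = F *+ d.
Proof.
move=> hF; rewrite -(form_coefs hF) /form -sumrMnl.
under eq_bigr => i _ do rewrite raddf_sum mulr_sumr.
rewrite exchange_big; apply: eq_bigr => a _ /=.
rewrite -[X in _ *+ X](mdeg_monom a) mdegE -sumrMnr; apply: eq_bigr => i _.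
rewrite mderivZ mderivX -scalerAr -scalerAr -mpolyXD scaler_nat scalerMnr.
have [->|h] := posnP (monom_exp a i); first by rewrite !mulr0n scaler0.
congr (_ *: _); congr (_ *+ _); congr 'X_[_]; apply/mnmP => j; rewrite mnmDE mnmBE mnm1E.
by case: eqP => [<-|_] /=; [rewrite subnKC | rewrite subn0].
Qed.

(** Linear relations between forms are the kernel of a finite matrix. This yields both the global
    sections of the twisted kernel bundle and the equations vanishing on a given curve. *)
Lemma relations_fin (k : fieldType) (l N : nat) (I : finType) (x : I -> {mpoly k[l]}) :
    (forall i, x i \is N.-homog) ->
  exists s (D : 'I_s -> I -> k), (forall r, \sum_i D r i *: x i = 0) /\
    forall c : I -> k, \sum_i c i *: x i = 0 ->
      exists lam : 'I_s -> k, forall i, c i = \sum_r lam r * D r i.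
Proof.
move=> hx; pose K : 'M[k]_(#|I|, #|{: monom l N}|) :=
  \matrix_(i, j) (x (enum_val i))@_(monom_exp (enum_val j)).
have hK (c : 'rV[k]_#|I|) : c *m K = 0 <-> \sum_i c 0 (enum_rank i) *: x i = 0.
  have E m : mdeg m = N -> exists j, (\sum_i c 0 (enum_rank i) *: x i)@_m = (c *m K) 0 j.
    move=> hm; have [b hb] := monom_of hm; exists (enum_rank b).
    rewrite raddf_sum mxE [RHS](reindex _ (onW_bij _ (@enum_rank_bij I))) /=.
    by apply: eq_bigr => i _; rewrite mcoeffZ mxE !enum_rankK hb.
  have hom : \sum_i c 0 (enum_rank i) *: x i \is N.-homog.
    by apply: rpred_sum => i _; apply: rpredZ.
  split=> h.
    apply/mpolyP => m; rewrite mcoeff0; have [/E[j ->]|hm] := eqVneq (mdeg m) N.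
      by rewrite h mxE.
    exact: dhomog_nemf_coeff hom hm.
  apply/rowP => j; rewrite [RHS]mxE -[RHS](mcoeff0 _ (monom_exp (enum_val j))) -h.
  rewrite raddf_sum mxE (reindex _ (onW_bij _ (@enum_rank_bij I))) /=.
  by apply: eq_bigr => i _; rewrite mcoeffZ mxE !enum_rankK.
exists #|I|, (fun r i => kermx K r (enum_rank i)); split.
  move=> r; transitivity (\sum_i row r (kermx K) 0 (enum_rank i) *: x i).
    by apply: eq_bigr => i _; rewrite [row _ _ _ _]mxE.
  by apply/hK; rewrite -row_mul mulmx_ker row0.
move=> c hc; pose cv : 'rV[k]_#|I| := \row_j c (enum_val j).
have : (cv <= kermx K)%MS.
  apply/sub_kermxP/hK; rewrite -[RHS]hc; apply: eq_bigr => i _.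
  by rewrite mxE enum_rankK.
case/submxP => D hD; exists (fun r => D 0 r) => i.
by have := congr1 (fun v : 'rV_#|I| => v 0 (enum_rank i)) hD; rewrite /= !mxE enum_rankK.
Qed.

Section BinaryForms.

Variable k : closedFieldType.

HB.instance Definition _ := GRing.RMorphism.copy (@dehom0 k)
  (mmap (@polyC k) (fun i : 'I_2 => [:: 1; 'X]`_i)).
HB.instance Definition _ := GRing.RMorphism.copy (@dehom1 k)
  (mmap (@polyC k) (fun i : 'I_2 => [:: 'X; 1]`_i)).

Lemma dehom0C c : dehom0 (c%:MP : {mpoly k[2]}) = c%:P.
Proof. by rewrite /dehom0 mmapC. Qed.
Lemma dehom1C c : dehom1 (c%:MP : {mpoly k[2]}) = c%:P.
Proof. by rewrite /dehom1 mmapC. Qed.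
Lemma dehom0X (b : 'X_{1..2}) : dehom0 ('X_[b] : {mpoly k[2]}) = 'X^(b (lift ord0 ord0)).
Proof. by rewrite /dehom0 mmapX /mmap1 !big_ord_recl big_ord0 /= expr1n mul1r mulr1. Qed.
Lemma dehom1X (b : 'X_{1..2}) : dehom1 ('X_[b] : {mpoly k[2]}) = 'X^(b ord0).
Proof. by rewrite /dehom1 mmapX /mmap1 !big_ord_recl big_ord0 /= expr1n !mulr1. Qed.

Definition pt0 (t : k) : 'I_2 -> k := fun i => [:: 1; t]`_i.
Definition pt1 (t : k) : 'I_2 -> k := fun i => [:: t; 1]`_i.

Lemma proj_pt0 t : proj_point (pt0 t).
Proof. by exists ord0; rewrite /= oner_neq0. Qed.
Lemma proj_pt1 t : proj_point (pt1 t).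
Proof. by exists (lift ord0 ord0); rewrite /= oner_neq0. Qed.

Lemma horner_dehom0 q t : (dehom0 q).[t] = q.@[pt0 t].
Proof.
rewrite [q]mpolyE !raddf_sum horner_sum; apply: eq_bigr => b _ /=.
rewrite -mul_mpolyC rmorphM /= dehom0C dehom0X mevalM mevalC hornerM hornerC hornerXn.
by rewrite mevalX !big_ord_recl big_ord0 /= expr1n mul1r mulr1.
Qed.

Lemma horner_dehom1 q t : (dehom1 q).[t] = q.@[pt1 t].
Proof.
rewrite [q]mpolyE !raddf_sum horner_sum; apply: eq_bigr => b _ /=.
rewrite -mul_mpolyC rmorphM /= dehom1C dehom1X mevalM mevalC hornerM hornerC hornerXn.
by rewrite mevalX !big_ord_recl big_ord0 /= expr1n !mulr1.
Qed.

(** A form of degree [m] is a section of O(m), whose trivializations differ by [x^m]. *)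
Lemma dehom_overlap m (q : {mpoly k[2]}) : q \is m.-homog ->
  eq_overlap (restr_x (dehom0 q)) (ovx k ^+ m * restr_y (dehom1 q)).
Proof.
move=> hq; rewrite -(form_coefs hq) /form (raddf_sum (@dehom0 k)) (raddf_sum (@dehom1 k)).
rewrite (raddf_sum (@restr_x k)) (raddf_sum (@restr_y k)) mulr_sumr.
apply: (@congr_sum _ (ovx k * ovy k - 1)) => b /=.
rewrite -mul_mpolyC !rmorphM /= dehom0C dehom1C dehom0X dehom1X restr_xXn restr_yXn mulrCA.
have -> c : restr_x (c%:P : {poly k}) = c%:MP by rewrite /restr_x map_polyC hornerC.
have -> c : restr_y (c%:P : {poly k}) = c%:MP by rewrite /restr_y map_polyC hornerC.
apply: congrM; first exact: congr_refl.
have em : m = (monom_exp b (lift ord0 ord0) + monom_exp b ord0)%N.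
  by rewrite -[LHS](mdeg_monom b) mdegE !big_ord_recl big_ord0 addn0 addnC.
rewrite [X in _ ^+ X * _]em exprD -mulrA -[X in congr_mod _ X _]mulr1 -exprMn.
apply: congrM; first exact: congr_refl.
apply: congr_sym; rewrite -[X in congr_mod _ _ X](expr1n _ (monom_exp b ord0)).
by apply: congrX; exists 1; ring.
Qed.

Definition pt_eqn (a : 'I_2 -> k) : {mpoly k[2]} :=
  a ord0 *: 'X_(lift ord0 ord0) - a (lift ord0 ord0) *: 'X_ord0.

Lemma pt_eqn_homog a : pt_eqn a \is 1.-homog.
Proof. by rewrite rpredB // rpredZ // dhomogX; apply/eqP/mdeg1. Qed.

Lemma meval_pt_eqn a : (pt_eqn a).@[a] = 0.
Proof. by rewrite mevalB !mevalZ !mevalXU mulrC subrr. Qed.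

(* A form of degree [N] is determined modulo the equation of the point [a] by its
   value at [a]; the linear form in [u] takes the value 1 at [a]. *)
Lemma pt_dual (a : 'I_2 -> k) : proj_point a ->
  exists2 u : 'I_2 -> k, u ord0 * a ord0 + u (lift ord0 ord0) * a (lift ord0 ord0) = 1 &
    forall N q, q \is N.-homog -> exists2 q', q' \is N.-1.-homog &
      q = q.@[a] *: (u ord0 *: 'X_ord0 + u (lift ord0 ord0) *: 'X_(lift ord0 ord0)) ^+ N
          + pt_eqn a * q'.
Proof.
move=> [i ai].
have [u hu] : exists u : 'I_2 -> k,
    u ord0 * a ord0 + u (lift ord0 ord0) * a (lift ord0 ord0) = 1.
  have [ei|ei] : i = ord0 \/ i = lift ord0 ord0.
    by case: i {ai} => [[|[|//]]] hi; [left | right]; apply: val_inj.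
  - by exists (fun j => if j == ord0 then (a ord0)^-1 else 0); rewrite /= mulVf -?ei // mul0r addr0.
  - exists (fun j => if j == ord0 then 0 else (a (lift ord0 ord0))^-1).
    by rewrite /= mulVf -?ei // mul0r add0r.
exists u => //; pose l := pt_eqn a.
pose m : {mpoly k[2]} := u ord0 *: 'X_ord0 + u (lift ord0 ord0) *: 'X_(lift ord0 ord0).
have mh : m \is 1.-homog by rewrite rpredD // rpredZ // dhomogX; apply/eqP/mdeg1.
have ma : m.@[a] = 1 by rewrite mevalD !mevalZ !mevalXU.
(* For [N = 0] the truncated degree would allow a nonzero constant [q'], and [m * q'] would have the
   wrong degree in the next step. *)
pose P N q := exists q', [/\ q' \is N.-1.-homog, N = 0%N -> q' = 0
  & q = q.@[a] *: m ^+ N + l * q'].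
have PX j : exists c, 'X_j = a j *: m + c *: l :> {mpoly k[2]}.
  have [->|->] : j = ord0 \/ j = lift ord0 ord0.
    by case: j => [[|[|//]]] hj; [left | right]; apply: val_inj.
  - exists (- u (lift ord0 ord0)); rewrite /m /l /pt_eqn -!mul_mpolyC.
    transitivity ((u ord0 * a ord0 + u (lift ord0 ord0) * a (lift ord0 ord0))%:MP * 'X_ord0 : {mpoly k[2]}).
      by rewrite hu mpolyC1 mul1r.
    by rewrite mpolyCD !mpolyCM mpolyCN; ring.
  - exists (u ord0); rewrite /m /l /pt_eqn -!mul_mpolyC.
    transitivity ((u ord0 * a ord0 + u (lift ord0 ord0) * a (lift ord0 ord0))%:MP * 'X_(lift ord0 ord0) : {mpoly k[2]}).
      by rewrite hu mpolyC1 mul1r.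
    by rewrite mpolyCD !mpolyCM; ring.
have Pmon N b : mdeg b = N -> P N 'X_[b].
  elim: N b => [|N IH] b hb.
    move/eqP: hb; rewrite mdeg_eq0 => /eqP ->; exists 0; split=> //; first exact: rpred0.
    by rewrite mpolyX0 meval1 scale1r expr0 mulr0 addr0.
  have [j hj] : exists j, b j != 0%N.
    apply/existsP; rewrite -[[exists _, _]]negbK; apply/negP => /existsPn no.
    suff : mdeg b = 0%N by rewrite hb.
    by rewrite mdegE big1 // => j _; apply/eqP; rewrite -[_ == _]negbK no.
  have le : (U_(j) <= b)%MM by rewrite lep1mP.
  have hb' : mdeg (b - U_(j))%MM = N.
    by have := congr1 mdeg (submK le); rewrite mdegD mdeg1 hb; lia.
  have [q' [hq' q'0 eq']] := IH _ hb'; have [c hc] := PX j.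
  rewrite -(submK le) mpolyXD; exists (c *: 'X_[b - U_(j)] + a j *: (m * q')); split=> //.
    rewrite rpredD // rpredZ //; first by rewrite dhomogX; apply/eqP.
    case: N hb' hq' q'0 {IH hb eq'} => [|N] _ hq' q'0; last exact: dhomogM mh hq'.
    by rewrite q'0 // mulr0 rpred0.
  rewrite mevalM mevalXU {1}hc mulrDr {1}eq' exprSr -!mul_mpolyC mpolyCM.
  by ring.
move=> N q hq; suff [q' [hq' _ eq']] : P N q by exists q'.
rewrite -(form_coefs hq) /form.
apply: (big_ind (P N)).
- by exists 0; rewrite ?rpred0 // meval0 scale0r mulr0 addr0.
- move=> x y [x' [hx' x0 ex]] [y' [hy' y0 ey]]; exists (x' + y'); split; first exact: rpredD.
    by move=> N0; rewrite x0 ?y0 ?addr0.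
  by rewrite {1}ex {1}ey mevalD scalerDl mulrDr addrACA.
- move=> b _; have [q' [hq' q'0 eq']] := Pmon N _ (mdeg_monom b).
  exists (coefs q b *: q'); split; [exact: rpredZ | by move=> /q'0 ->; rewrite scaler0 |].
  by rewrite {1}eq' mevalZ scalerDr scalerA scalerAr.
Qed.

End BinaryForms.

(** * Very free curves from sections of the twisted kernel bundle *)
Section MatrixCongruence.

Variables (R : comNzRingType) (u : R).

Definition congr_mx r s (A B : 'M[R]_(r, s)) := forall i j, congr_mod u (A i j) (B i j).

Lemma congr_mx_refl r s (A : 'M[R]_(r, s)) : congr_mx A A.
Proof. by move=> i j; apply: congr_refl. Qed.

Lemma congr_mx_trans r s (A B C : 'M[R]_(r, s)) : congr_mx A B -> congr_mx B C -> congr_mx A C.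
Proof. by move=> h h' i j; apply: congr_trans (h i j) (h' i j). Qed.

Lemma congr_mxD r s (A B A' B' : 'M[R]_(r, s)) :
  congr_mx A B -> congr_mx A' B' -> congr_mx (A + A') (B + B').
Proof. by move=> h h' i j; rewrite !mxE; apply: congrD. Qed.

Lemma congr_mxM r s t (A B : 'M[R]_(r, s)) (A' B' : 'M[R]_(s, t)) :
  congr_mx A B -> congr_mx A' B' -> congr_mx (A *m A') (B *m B').
Proof. by move=> h h' i j; rewrite !mxE; apply: congr_sum => l; apply: congrM. Qed.

Lemma congr_mxZ r s a (A B : 'M[R]_(r, s)) : congr_mx A B -> congr_mx (a *: A) (a *: B).
Proof. by move=> h i j; rewrite !mxE; apply: congrM => //; apply: congr_refl. Qed.

(** [V1] is expanded by the resolution of the identity of the other chart. Its [rho0] component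
    vanishes since [phi0] is a multiple of [phi1] on the overlap; what multiplies [V0] is the
    transition matrix. *)
Lemma congr_transition_frame m n (a b : R) (tau0 : 'cV[R]_n) (f0 : 'rV[R]_n)
    (phi0 phi1 : 'cV[R]_n) (rho0 : 'rV[R]_n) (C0 : 'M[R]_(n, m)) (V0 V1 : 'M[R]_(m, n)) :
    tau0 *m f0 + phi0 *m rho0 + C0 *m V0 = 1%:M -> V1 *m phi1 = 0 ->
    congr_mx phi0 (a *: phi1) ->
  congr_mx (b *: V1) (b *: (V1 *m C0) *m V0 + b *: (V1 *m tau0) *m f0).
Proof.
move=> one V1phi cphi.
have -> : b *: V1 = b *: (V1 *m C0) *m V0 + b *: (V1 *m tau0) *m f0 + b *: (V1 *m phi0) *m rho0.
  by rewrite -[V1 in LHS]mulmx1 -one !mulmxDr !scalerDr -!scalemxAl !mulmxA [LHS]addrC addrA.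
have z : congr_mx (b *: (V1 *m phi0) *m rho0) 0.
  apply: (congr_mx_trans (B := b *: (V1 *m (a *: phi1)) *m rho0)).
    apply: congr_mxM (congr_mx_refl _); apply/congr_mxZ/congr_mxM => //; exact: congr_mx_refl.
  by rewrite -scalemxAr V1phi !scaler0 mul0mx; apply: congr_mx_refl.
rewrite -[X in congr_mx _ X]addr0; apply: congr_mxD z; exact: congr_mx_refl.
Qed.

(** [W *m C] gives the coordinates of sections modulo [f]. The extra [x] reflects that the sections
    have degree one less than the curve. *)
Lemma congr_transition_sections m n s (x b : R) (tau1 : 'cV[R]_n) (f0 f1 : 'rV[R]_n)
    (phi1 : 'cV[R]_n) (rho1 : 'rV[R]_n) (C0 C1 : 'M[R]_(n, m)) (V1 : 'M[R]_(m, n))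
    (W0 W1 : 'M[R]_(s, n)) :
    tau1 *m f1 + phi1 *m rho1 + C1 *m V1 = 1%:M -> W1 *m phi1 = 0 -> f0 *m C0 = 0 ->
    congr_mx f0 ((x * b) *: f1) -> congr_mx W0 (b *: W1) ->
  congr_mx (W1 *m C1 *m ((x * b) *: (V1 *m C0))) (x *: (W0 *m C0)).
Proof.
move=> one W1phi fC cf cW.
have e1 : W1 *m C1 *m V1 = W1 - W1 *m tau1 *m f1.
  by rewrite -{2}[W1]mulmx1 -one !mulmxDr !mulmxA W1phi mul0mx addr0 [RHS]addrC addKr.
have -> : W1 *m C1 *m ((x * b) *: (V1 *m C0))
    = x *: (b *: W1 *m C0) - W1 *m tau1 *m ((x * b) *: f1 *m C0).
  by rewrite -scalemxAr [X in _ *: X]mulmxA e1 mulmxBl scalerBr -!scalemxAl -scalemxAr !mulmxA scalerA.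
have -> : x *: (W0 *m C0) = x *: (W0 *m C0) + - (W1 *m tau1) *m (f0 *m C0).
  by rewrite fC mulmx0 addr0.
rewrite -mulNmx; apply: congr_mxD.
  apply/congr_mxZ/congr_mxM; last exact: congr_mx_refl.
  by move=> i j; apply/congr_sym.
apply/congr_mxM/congr_mxM; try exact: congr_mx_refl.
by move=> i j; apply/congr_sym.
Qed.

End MatrixCongruence.

Section VeryFree.

Variables (k : closedFieldType) (m d e : nat).
Variables (F : {mpoly k[m.+2]}) (f : m.+2.-tuple {mpoly k[2]}).

Definition grad_along (i : 'I_m.+2) : {mpoly k[2]} := F^`M(i) \mPo f.

(* With K the kernel of the gradient of F along f, so that f^*T_X = K / O f, the
   global sections of K(-1) generate f^*T_X(-1). *)
Definition sections_generate : Prop :=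
  forall a, proj_point a -> forall kappa : 'I_m.+2 -> k,
    \sum_i kappa i * (grad_along i).@[a] = 0 ->
  exists w : 'I_m.+2 -> {mpoly k[2]},
    [/\ forall i, w i \is e.-1.-homog, \sum_i w i * grad_along i = 0
      & exists mu, forall i, (w i).@[a] = kappa i + mu * (tnth f i).@[a]].

Hypotheses (F_homog : F \is d.-homog) (f_morph : morphism_to F e f).
Hypothesis (F_smooth : smooth_hypersurface F).
Hypothesis gen : sections_generate.
Hypothesis e_gt0 : (0 < e)%N.

Lemma curve_homog i : tnth f i \is e.-homog.
Proof. by case: f_morph. Qed.

Lemma grad_along_homog i : grad_along i \is (d.-1 * e)%N.-homog.
Proof. by apply: comp_homog; [apply: mderiv_homog | apply: curve_homog]. Qed.

Lemma curve_smooth : image_in_smooth_locus F f.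
Proof.
move=> a pa; case: f_morph => _ base Ff; apply: F_smooth; first exact: base.
by rewrite -comp_mpoly_meval Ff meval0.
Qed.

Lemma curve_euler : \sum_i tnth f i * grad_along i = 0.
Proof.
have := congr1 (fun p : {mpoly k[m.+2]} => p \mPo f) (euler_formula F_homog).
case: f_morph => _ _ Ff; rewrite /= raddfMn /= Ff mul0rn raddf_sum /= => h; apply: etrans h.
by apply: eq_bigr => i _; rewrite rmorphM /= comp_mpolyXU -tnth_nth.
Qed.

(** An arbitrary dehomogenization treats both charts at once. By [gen] the rows of [W] span each
    fibre of f^*T_X, so their coordinate matrix has a left inverse. *)
Lemma chart_generators s (W : 'M[{mpoly k[2]}]_(s, m.+2))
    (dehom : {rmorphism {mpoly k[2]} -> {poly k}}) (pt : k -> 'I_2 -> k) :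
    (forall t, proj_point (pt t)) -> (forall q t, (dehom q).[t] = q.@[pt t]) ->
    (forall r, \sum_i W r i * grad_along i = 0) ->
    (forall w : 'I_m.+2 -> {mpoly k[2]}, (forall i, w i \is e.-1.-homog) ->
       \sum_i w i * grad_along i = 0 ->
       exists lam : 'I_s -> k, forall i, w i = \sum_r lam r *: W r i) ->
  exists rho V tau (C : 'M[{poly k}]_(m.+2, m)) Q,
    [/\ coords dehom f *m C = 0, V *m (gradient dehom F f)^T = 0,
        tau *m coords dehom f + (gradient dehom F f)^T *m rho + C *m V = 1%:M,
        map_mx dehom W *m (gradient dehom F f)^T = 0 /\ Q *m (map_mx dehom W *m C) = 1%:M
      & tangent_frame dehom F f V].
Proof.
move=> ppt ev hW spanW; set f0 := coords dehom f; set phi := gradient dehom F f.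
have uf : unimodular f0.
  move=> t; case: f_morph => _ /(_ _ (ppt t))[i hi] _.
  by exists 0, i; rewrite mxE ev.
have uphi : unimodular phi.
  move=> t; have [i hi] := curve_smooth (ppt t).
  by exists 0, i; rewrite mxE ev comp_mpoly_meval.
have dot r (v : 'M[{mpoly k[2]}]_(r, m.+2)) : (forall j, \sum_i v j i * grad_along i = 0) ->
    map_mx dehom v *m phi^T = 0.
  move=> hv; apply/matrixP => j l; rewrite [RHS]mxE -(rmorph0 dehom) -(hv j) mxE rmorph_sum.
  by apply: eq_bigr => i _; rewrite rmorphM !mxE.
have fphi : f0 *m phi^T = 0.
  have -> : f0 = map_mx dehom (\row_i tnth f i) by apply/rowP => i; rewrite !mxE.
  apply: dot => j; rewrite -[RHS]curve_euler; apply: eq_bigr => i _.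
  by rewrite mxE.
have [rho [V [tau [C [fC Vphi VC one]]]]] := chart_frame uf uphi fphi.
have [Q hQ] : exists Q, Q *m (map_mx dehom W *m C) = 1%:M.
  apply: full_rank_left_inverse => t x.
  rewrite /ev_mx (map_mxM (horner_eval t)) -mulmxA => Wx.
  (* A functional [x] killing all sections kills the kernel of the gradient at [t], in particular
     the rows of [V], where its values are its own entries. *)
  have kill (kap : 'rV[k]_m.+2) : kap *m map_mx (horner_eval t) phi^T = 0 ->
      kap *m (map_mx (horner_eval t) C *m x) = 0.
    move=> hk; have [|w [hw wphi [mu wmu]]] := gen (ppt t) (kappa := fun i => kap 0 i).
      move/matrixP/(_ 0 0): hk; rewrite [LHS]mxE [RHS]mxE => h; apply: etrans h; apply: eq_bigr => i _.
      by rewrite !mxE /horner_eval ev.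
    have [lam wlam] := spanW w hw wphi.
    have -> : kap = (\row_r lam r) *m map_mx (horner_eval t) (map_mx dehom W)
                    - mu *: map_mx (horner_eval t) f0.
      apply/rowP => i; have := wmu i; rewrite wlam raddf_sum !mxE /= => h.
      rewrite /horner_eval ev -[LHS](addrK (mu * (tnth f i).@[pt t])) -h; congr (_ - _).
      by apply: eq_bigr => r _; rewrite !mxE /horner_eval ev mevalZ.
    rewrite mulmxBl -mulmxA Wx mulmx0 -scalemxAl mulmxA -(map_mxM (horner_eval t)) fC.
    by rewrite (map_mx0 (horner_eval t)) mul0mx scaler0 subr0.
  have -> : x = map_mx (horner_eval t) V *m (map_mx (horner_eval t) C *m x).
    by rewrite mulmxA -(map_mxM (horner_eval t)) VC (map_mx1 (horner_eval t)) mul1mx.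
  apply/row_matrixP => i; rewrite row_mul row0; apply: kill.
  by rewrite -row_mul -(map_mxM (horner_eval t)) Vphi (map_mx0 (horner_eval t)) row0.
exists rho, V, tau, C, Q; split=> //; first by split=> //; apply: dot.
split=> [v|c h cV].
  split=> [vphi|[c [h ->]]]; last by rewrite mulmxDl -mulmxA Vphi mulmx0 -scalemxAl fphi scaler0 addr0.
  exists (v *m C), ((v *m tau) 0 0).
  rewrite -[LHS]mulmx1 -one !mulmxDr !mulmxA vphi mul0mx addr0 addrC.
  by congr (_ + _); rewrite -mul_scalar_mx -mx11_scalar.
by rewrite -[c]mulmx1 -VC mulmxA cV -scalemxAl fC scaler0.
Qed.

Lemma very_free_src : separably_rationally_connected F.
Proof.
exists e, f; split=> //; first exact: curve_smooth.
pose I := ('I_m.+2 * monom 2 e.-1)%type.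
pose x (p : I) := 'X_[monom_exp p.2] * grad_along p.1.
have hx p : x p \is (e.-1 + d.-1 * e)%N.-homog.
  by apply: dhomogM; [rewrite dhomogX; apply/eqP/mdeg_monom | apply: grad_along_homog].
(* In terms of coefficients, a global section of K(-1) is a linear relation between the forms [x p];
   the rows of [W] thus span all of them. *)
have [s [D [hD spanD]]] := relations_fin hx.
pose W : 'M[{mpoly k[2]}]_(s, m.+2) := \matrix_(r, i) form (fun b => D r (i, b)).
have sum_form (c : I -> k) :
    \sum_i form (fun b => c (i, b)) * grad_along i = \sum_p c p *: x p.
  transitivity (\sum_i \sum_b c (i, b) *: x (i, b)); last first.
    by rewrite pair_bigA; apply: eq_bigr => -[i b] _.
  apply: eq_bigr => i _.
  by rewrite /form mulr_suml; apply: eq_bigr => b _; rewrite -scalerAl.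
have hW r : \sum_i W r i * grad_along i = 0.
  by rewrite -[RHS](hD r) -sum_form; apply: eq_bigr => i _; rewrite mxE.
have spanW (w : 'I_m.+2 -> {mpoly k[2]}) : (forall i, w i \is e.-1.-homog) ->
    \sum_i w i * grad_along i = 0 ->
    exists lam : 'I_s -> k, forall i, w i = \sum_r lam r *: W r i.
  move=> hw wphi; have [|lam hlam] := spanD (fun p => coefs (w p.1) p.2).
    rewrite -sum_form -[RHS]wphi; apply: eq_bigr => i _ /=.
    by rewrite -[in RHS](form_coefs (hw i)).
  exists lam => i; rewrite -[LHS](form_coefs (hw i)).
  under [RHS]eq_bigr => r _ do rewrite mxE /form scaler_sumr.
  rewrite exchange_big; apply: eq_bigr => b _ /=; rewrite (hlam (i, b)) scaler_suml.
  by apply: eq_bigr => r _; rewrite scalerA.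
have hWh r i : W r i \is e.-1.-homog by rewrite mxE form_homog.
have [rho0 [V0 [tau0 [C0 [Q0 [fC0 V0phi one0 [W0phi QP0] frame0]]]]]] :=
  chart_generators (dehom := @dehom0 k) (@proj_pt0 k) (@horner_dehom0 k) hW spanW.
have [rho1 [V1 [tau1 [C1 [Q1 [fC1 V1phi one1 [W1phi QP1] frame1]]]]]] :=
  chart_generators (dehom := @dehom1 k) (@proj_pt1 k) (@horner_dehom1 k) hW spanW.
set f0 := coords _ f in fC0 one0; set f1 := coords _ f in fC1 one1.
set phi0 := gradient _ F f in V0phi one0; set phi1 := gradient _ F f in V1phi one1.
set W0 := map_mx _ W in QP0; set W1 := map_mx _ W in QP1.
pose u := ovx k * ovy k - 1.
pose X0 := fun r s => @map_mx _ _ (@restr_x k) r s.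
pose Y1 := fun r s => @map_mx _ _ (@restr_y k) r s.
have cf : congr_mx u (X0 _ _ f0) (ovx k ^+ e *: Y1 _ _ f1).
  by move=> i j; rewrite !mxE; apply: dehom_overlap; apply: curve_homog.
have cphi : congr_mx u (X0 _ _ phi0^T) (ovx k ^+ (d.-1 * e) *: Y1 _ _ phi1^T).
  by move=> i j; rewrite !mxE; apply: dehom_overlap; apply: grad_along_homog.
have cW : congr_mx u (X0 _ _ W0) (ovx k ^+ e.-1 *: Y1 _ _ W1).
  by move=> i j; rewrite !mxE; apply: dehom_overlap; apply: form_homog.
have X0M r t l (B : 'M[{poly k}]_(r, t)) (B' : 'M_(t, l)) : X0 _ _ (B *m B') = X0 _ _ B *m X0 _ _ B'.
  exact: map_mxM.
have Y1M r t l (B : 'M[{poly k}]_(r, t)) (B' : 'M_(t, l)) : Y1 _ _ (B *m B') = Y1 _ _ B *m Y1 _ _ B'.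
  exact: map_mxM.
have X0one : X0 _ _ tau0 *m X0 _ _ f0 + X0 _ _ phi0^T *m X0 _ _ rho0 + X0 _ _ C0 *m X0 _ _ V0 = 1%:M.
  by rewrite -!X0M -!(map_mxD (@restr_x k)) one0 (map_mx1 (@restr_x k)).
have Y1one : Y1 _ _ tau1 *m Y1 _ _ f1 + Y1 _ _ phi1^T *m Y1 _ _ rho1 + Y1 _ _ C1 *m Y1 _ _ V1 = 1%:M.
  by rewrite -!Y1M -!(map_mxD (@restr_y k)) one1 (map_mx1 (@restr_y k)).
have Y1V1phi : Y1 _ _ V1 *m Y1 _ _ phi1^T = 0 by rewrite -Y1M V1phi; apply: (map_mx0 (@restr_y k)).
have Y1W1phi : Y1 _ _ W1 *m Y1 _ _ phi1^T = 0 by rewrite -Y1M W1phi; apply: (map_mx0 (@restr_y k)).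
have X0fC : X0 _ _ f0 *m X0 _ _ C0 = 0 by rewrite -X0M fC0; apply: (map_mx0 (@restr_x k)).
exists (ovx k ^+ e *: (Y1 _ _ V1 *m X0 _ _ C0)).
  exists V0, V1, (ovx k ^+ e *: (Y1 _ _ V1 *m X0 _ _ tau0)); split=> //.
  exact: (congr_transition_frame (ovx k ^+ e) X0one Y1V1phi cphi).
apply: (ample_of_generated QP0 QP1).
(* The factor split off is the O(1) of [ample_of_generated]. *)
have xe : ovx k ^+ e = ovx k * ovx k ^+ e.-1 by rewrite -exprS prednK.
rewrite xe in cf *.
have := congr_transition_sections Y1one Y1W1phi X0fC cf cW.
by rewrite -X0M -Y1M.
Qed.

End VeryFree.

(** * Castelnuovo-Mumford regularity along a curve *)
Lemma mpoly_alg_ind (R : comNzRingType) n (P : {mpoly R[n]} -> Prop) :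
    (forall c, P c%:MP) -> (forall i, P 'X_i) ->
    (forall p q, P p -> P q -> P (p + q)) -> (forall p q, P p -> P q -> P (p * q)) ->
  forall p, P p.
Proof.
move=> PC PX PD PM p; rewrite [p]mpolyE; apply: (big_ind P) => [||m _].
- by rewrite -(mpolyC0 n R); apply: (PC).
- exact: PD.
rewrite -mul_mpolyC mpolyXE_id; apply: (PM) => //; apply: (big_ind P) => [||i _].
- by rewrite -(mpolyC1 n R); apply: (PC).
- exact: PM.
elim: (m i) => [|j IH]; first by rewrite expr0 -(mpolyC1 n R); apply: (PC).
by rewrite exprS; apply: (PM).
Qed.

Lemma chain_rule (R : comNzRingType) n l (F : {mpoly R[n]}) (g : n.-tuple {mpoly R[l]}) j :
  (F \mPo g)^`M(j) = \sum_i (F^`M(i) \mPo g) * (tnth g i)^`M(j).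
Proof.
elim/mpoly_alg_ind: F => [c|i|p q hp hq|p q hp hq].
- rewrite comp_mpolyC mderivC big1 // => i _.
  by rewrite mderivC comp_mpoly0 mul0r.
- rewrite comp_mpolyXU -tnth_nth (bigD1 i) //= big1 => [|i' ii'].
    by rewrite mderivXU eqxx comp_mpoly1 mul1r addr0.
  by rewrite mderivXU eq_sym (negPf ii') comp_mpoly0 mul0r.
- rewrite comp_mpolyD mderivD hp hq -big_split; apply: eq_bigr => i _.
  by rewrite mderivD comp_mpolyD mulrDl.
- rewrite rmorphM /= mderivM hp hq mulr_suml mulr_sumr -big_split; apply: eq_bigr => i _ /=.
  by rewrite mderivM comp_mpolyD !rmorphM /=; ring.
Qed.

(** The remainder is kept polynomial in [t], as [submersion_image_open] requires. *)
Lemma taylor1 (R : comNzRingType) n (F : {mpoly R[n]}) (h : 'I_n -> {mpoly R[n]}) :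
  exists G : {poly {mpoly R[n]}}, forall t,
    F \mPo [tuple 'X_i + t *: h i | i < n]
    = F + t *: (\sum_i h i * F^`M(i)) + t ^+ 2 *: G.[t%:MP].
Proof.
elim/mpoly_alg_ind: F => [c|i|p q [P hP] [Q hQ]|p q [P hP] [Q hQ]].
- exists 0 => t; rewrite comp_mpolyC horner0 scaler0 addr0 big1 ?scaler0 ?addr0 // => i _.
  by rewrite mderivC mulr0.
- exists 0 => t; rewrite comp_mpolyXU -tnth_nth tnth_mktuple horner0 scaler0 addr0.
  rewrite (bigD1 i) //= big1 => [|i' ii']; first by rewrite mderivXU eqxx mulr1 addr0.
  by rewrite mderivXU eq_sym (negPf ii') mulr0.
- exists (P + Q) => t; rewrite comp_mpolyD hP hQ hornerD.
  under [X in _ = _ + _ *: X + _]eq_bigr => i _ do rewrite mderivD mulrDr.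
  by rewrite big_split /= -!mul_mpolyC; ring.
- pose dp := \sum_i h i * p^`M(i); pose dq := \sum_i h i * q^`M(i).
  exists ((dp * dq)%:P + (p%:P + 'X * dp%:P + 'X ^+ 2 * P) * Q + P * (q%:P + 'X * dq%:P)) => t.
  rewrite rmorphM /= hP hQ -/dp -/dq.
  have -> : \sum_i h i * (p * q)^`M(i) = dp * q + p * dq.
    rewrite mulr_suml mulr_sumr -big_split; apply: eq_bigr => i _ /=.
    by rewrite mderivM; ring.
  rewrite !(hornerD, hornerM, hornerC, hornerX, hornerXn) -!mul_mpolyC rmorphXn /=.
  by ring.
Qed.

Section SectionsFromSurjectivity.

Variables (k : closedFieldType) (N e delta : nat) (f phi : 'I_N -> {mpoly k[2]}).
Hypotheses (f_homog : forall i, f i \is e.+2.-homog) (phi_homog : forall i, phi i \is delta.-homog).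
Hypothesis f_phi : \sum_i f i * phi i = 0.

Local Notation s := ('X_ord0 : {mpoly k[2]}).
Local Notation t := ('X_(lift ord0 ord0) : {mpoly k[2]}).

(** Dividing by [s * t] gives f/(st) = A0/s + B0/t, which writes the image of the class 1/(st) as a
    coboundary before [phi] is applied. *)
Variables A0 B0 : 'I_N -> {mpoly k[2]}.
Hypotheses (B0_homog : forall i, B0 i \is e.+1.-homog) (fE : forall i, f i = t * A0 i + s * B0 i).

(* This says that H^1(E(-2)) = 0 for E = ker phi / O f, i.e. that the [u . phi],
   with [u] of degree [e], and the image in H^1((ker phi)(-2)) of the generator
   1/(st) of H^1(O(-2)), represented by [B0 . phi / t], span the forms of degree
   [e + delta].  The latter generator is needed: when the characteristic divides
   the degree of [f], H^1((ker phi)(-2)) <> 0 for anticanonical hypersurfaces. *)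
Definition twisted_onto : Prop := forall chi : {mpoly k[2]}, chi \is (e + delta)%N.-homog ->
  exists (u : 'I_N -> {mpoly k[2]}) (lam : k), (forall i, u i \is e.-homog) /\
    t * chi = \sum_i (t * u i + lam *: B0 i) * phi i.

Lemma vanish_divides (a : 'I_2 -> k) M q : proj_point a -> q \is M.+1.-homog -> q.@[a] = 0 ->
  exists2 q', q' \is M.-homog & q = pt_eqn a * q'.
Proof.
move=> pa hq qa; have [u _ /(_ _ _ hq)[q' hq' ->]] := pt_dual pa.
by exists q' => //; rewrite qa scale0r add0r.
Qed.

Lemma pt_eqn_neq0 (a : 'I_2 -> k) : proj_point a -> pt_eqn a != 0.
Proof.
move=> [i ai]; apply: contraNneq ai => l0.
have l1 := congr1 (mcoeff U_(lift ord0 ord0)) l0.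
have l2 := congr1 (mcoeff U_(ord0)) l0.
move: l1 l2; rewrite !mcoeffB !mcoeffZ !mcoeffXU !mcoeff0 /= !mulr0 !mulr1 subr0 sub0r.
move=> a0 /eqP; rewrite oppr_eq0 => /eqP a1.
have [->|->] : i = ord0 \/ i = lift ord0 ord0.
  by case: i => [[|[|//]]] hi; [left | right]; apply: val_inj.
- exact/eqP.
- exact/eqP.
Qed.

Definition pt_t0 : 'I_2 -> k := fun i => if i == ord0 then 1 else 0.

Lemma pt_t0_proj : proj_point pt_t0.
Proof. by exists ord0; rewrite oner_neq0. Qed.

Lemma pt_t0_eqn : pt_eqn pt_t0 = t.
Proof. by rewrite /pt_eqn /pt_t0 /= scale1r scale0r subr0. Qed.

(* [B . phi / l] represents the generator of H^1(O(-2)) relative to the linear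
   forms [l] and [m] instead of [t] and [s]: up to the [u . phi] it is the same. *)
Lemma sections_of_onto : twisted_onto ->
  forall a, proj_point a -> forall kappa : 'I_N -> k, \sum_i kappa i * (phi i).@[a] = 0 ->
  exists w : 'I_N -> {mpoly k[2]}, [/\ forall i, w i \is e.+1.-homog, \sum_i w i * phi i = 0
      & exists mu, forall i, (w i).@[a] = kappa i + mu * (f i).@[a]].
Proof.
move=> onto a pa kappa hk.
have [u hu expand] := pt_dual pa; move: expand.
set m := u ord0 *: _ + _ => expand; pose l := pt_eqn a.
have l0 : l != 0 := pt_eqn_neq0 pa.
have mh : m \is 1.-homog by rewrite rpredD // rpredZ // dhomogX; apply/eqP/mdeg1.
have mhX j : m ^+ j \is j.-homog by have := dhomogMn j mh; rewrite mul1n.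
have ma : m.@[a] = 1 by rewrite mevalD !mevalZ !mevalXU.
have lh : l \is 1.-homog := pt_eqn_homog a.
have la : l.@[a] = 0 := meval_pt_eqn a.
have vanish (c : 'I_N -> k) : \sum_i c i * (phi i).@[a] = 0 ->
    exists2 q, q \is (e + delta)%N.-homog & \sum_i (c i *: m ^+ e.+1) * phi i = l * q.
  move=> hc; apply: vanish_divides => //.
    apply: rpred_sum => i _; rewrite -addSn; apply: dhomogM => //.
    by apply: rpredZ.
  rewrite raddf_sum -[RHS]hc; apply: eq_bigr => i _ /=.
  by rewrite mevalM mevalZ rmorphXn /= ma expr1n mulr1.
(* [kappa i *: m ^+ e.+1] extends [kappa] but is in the kernel only at [a]; [chi] is the defect
   divided by [l], to be corrected by [onto]. *)
have [chi hchi echi] := vanish kappa hk.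
have fphia : \sum_i (f i).@[a] * (phi i).@[a] = 0.
  have := congr1 (meval a) f_phi; rewrite raddf_sum meval0 => h; apply: etrans h.
  by apply: eq_bigr => i _; rewrite /= mevalM.
have [psia hpsia epsia] := vanish _ fphia.
pose B i := (f i).@[a] *: m ^+ e.+1.
have sumB : \sum_i B i * phi i = l * psia by [].
have /fin_all_exists[A hA] i : exists q, q \is e.+1.-homog /\ f i = m * B i + l * q.
  have [q hq eq] := expand _ _ (f_homog i).
  by exists q; split=> //; rewrite {1}eq /B -scalerAr -exprS.
have Bh i : B i \is e.+1.-homog by apply: rpredZ.
(* This is the cofactor of [s] after expanding [m] and [l] in [f = m * B + l * A]; hence it agrees
   with [B0] modulo [t]. *)
pose B' i := - a (lift ord0 ord0) *: A i + u ord0 *: B i.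
have B'h i : B' i \is e.+1.-homog.
  by rewrite rpredD // rpredZ //; case: (hA i).
have /fin_all_exists[C hC] i : exists q, q \is e.-homog /\ B' i = B0 i + t * q.
  have [||q hq eq] := @vanish_divides pt_t0 e (B' i - B0 i) pt_t0_proj.
  - by rewrite rpredB; [|apply: B'h|apply: B0_homog].
  - have := fE i; rewrite (hA i).2 => /(congr1 (meval pt_t0)); rewrite /B' /m /l /pt_eqn.
    move: (B i) (A i) (A0 i) (B0 i) => b1 a1 a2 b2.
    rewrite !(mevalD, mevalN, mevalM, mevalZ, mevalXU) /= => h.
    have p0 : pt_t0 ord0 = 1 by []. have p1 : pt_t0 (lift ord0 ord0) = 0 by [].
    have -> : b2.@[pt_t0] = pt_t0 (lift ord0 ord0) * a2.@[pt_t0] + pt_t0 ord0 * b2.@[pt_t0].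
      by rewrite p0 p1; ring.
    by rewrite -h p0 p1; ring.
  by exists q; split=> //; rewrite pt_t0_eqn in eq; rewrite -eq addrC subrK.
have sumA : \sum_i A i * phi i = - (m * psia).
  apply: (mulfI l0); have := f_phi.
  under eq_bigr => i _ do rewrite (hA i).2 mulrDl -!mulrA.
  rewrite big_split -!mulr_sumr /= sumB => h.
  by rewrite mulrN mulrCA; apply/eqP; rewrite -addr_eq0 addrC; apply/eqP.
have sumB0 : \sum_i B0 i * phi i = t * (psia - \sum_i C i * phi i).
  have -> : \sum_i B0 i * phi i = \sum_i B' i * phi i - t * \sum_i C i * phi i.
    rewrite mulr_sumr -sumrB; apply: eq_bigr => i _.
    by rewrite (hC i).2; ring.
  rewrite mulrBr; congr (_ - _).
  have -> : \sum_i B' i * phi i = (- a (lift ord0 ord0))%:MP * \sum_i A i * phi i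
                                 + (u ord0)%:MP * \sum_i B i * phi i.
    rewrite !mulr_sumr -big_split; apply: eq_bigr => i _ /=.
    by rewrite /B' -!mul_mpolyC; ring.
  rewrite sumA sumB.
  transitivity ((u ord0 * a ord0 + u (lift ord0 ord0) * a (lift ord0 ord0))%:MP * (t * psia)); last first.
    by rewrite hu mpolyC1 mul1r.
  by rewrite /l /m /pt_eqn -!mul_mpolyC mpolyCD !mpolyCM mpolyCN; ring.
have [v [lam [vh echi']]] := onto chi hchi.
have t0 : t != 0 by rewrite -pt_t0_eqn; apply: pt_eqn_neq0 pt_t0_proj.
have {}echi' : chi = \sum_i (v i - lam *: C i) * phi i + lam%:MP * psia.
  apply: (mulfI t0); rewrite echi'.
  transitivity (t * \sum_i v i * phi i + lam%:MP * \sum_i B0 i * phi i).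
    rewrite !mulr_sumr -big_split; apply: eq_bigr => i _ /=.
    by rewrite -mul_mpolyC; ring.
  have -> : \sum_i (v i - lam *: C i) * phi i = \sum_i v i * phi i - lam%:MP * \sum_i C i * phi i.
    rewrite mulr_sumr -sumrB; apply: eq_bigr => i _.
    by rewrite -mul_mpolyC; ring.
  by rewrite sumB0; ring.
exists (fun i => kappa i *: m ^+ e.+1 - l * (v i - lam *: C i) - lam *: B i); split.
- move=> i; have hq : v i - lam *: C i \is e.-homog.
    by apply: rpredB; [apply: vh | apply: rpredZ; case: (hC i)].
  have lq := dhomogM lh hq; rewrite add1n in lq.
  apply: rpredB; last by apply: rpredZ; apply: Bh.
  by apply: rpredB lq; apply: rpredZ; apply: mhX.
- transitivity (\sum_i (kappa i *: m ^+ e.+1) * phi i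
      - l * \sum_i (v i - lam *: C i) * phi i - lam%:MP * \sum_i B i * phi i).
    rewrite !mulr_sumr -!sumrB; apply: eq_bigr => i _.
    by rewrite -!mul_mpolyC; ring.
  by rewrite echi sumB echi'; ring.
exists (- lam) => i; rewrite !mevalB mevalM la mul0r subr0 !mevalZ rmorphXn /= ma expr1n.
by ring.
Qed.

End SectionsFromSurjectivity.

(** * Moving a curve by linear changes of coordinates *)
Lemma polyfun_eq (k : closedFieldType) (T : finType) (h : (T -> k) -> k) v w :
  polyfun h -> v =1 w -> h v = h w.
Proof. by move=> [p hp] e; rewrite !hp; apply: meval_eq => i; rewrite e. Qed.

Lemma eq_form (k : comNzRingType) n d (c c' : monom n d -> k) : c =1 c' -> form c = form c'.
Proof. by move=> e; apply: eq_bigr => a _; rewrite e. Qed.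

Lemma comp_mpoly_comp (R : comNzRingType) n l r (p : {mpoly R[n]}) (g : n.-tuple {mpoly R[l]})
    (h : l.-tuple {mpoly R[r]}) :
  (p \mPo g) \mPo h = p \mPo [tuple tnth g i \mPo h | i < n].
Proof.
elim/mpoly_alg_ind: p => [c|i|p q hp hq|p q hp hq].
- by rewrite !comp_mpolyC.
- by rewrite !comp_mpolyXU -!tnth_nth tnth_mktuple.
- by rewrite !comp_mpolyD hp hq.
- by rewrite !rmorphM /= hp hq.
Qed.

Lemma mcoeff_horner (k : comNzRingType) n (G : {poly {mpoly k[n]}}) b t :
  (G.[t%:MP])@_b = (\poly_(i < size G) (G`_i)@_b).[t].
Proof.
rewrite horner_poly horner_coef raddf_sum; apply: eq_bigr => i _ /=.
by rewrite -rmorphXn /= mulrC mcoeffCM mulrC.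
Qed.

Section LinearSubstitution.

Variables (k : comNzRingType) (n : nat).

Definition linear_tuple l (A : 'M[k]_(n, l)) : n.-tuple {mpoly k[l]} :=
  [tuple \sum_j A i j *: 'X_j | i < n].

Lemma tnth_linear l (A : 'M[k]_(n, l)) i : tnth (linear_tuple A) i = \sum_j A i j *: 'X_j.
Proof. by rewrite tnth_mktuple. Qed.

Lemma linear_homog l (A : 'M[k]_(n, l)) i : tnth (linear_tuple A) i \is 1.-homog.
Proof.
rewrite tnth_linear; apply: rpred_sum => j _; apply: rpredZ.
by rewrite dhomogX; apply/eqP/mdeg1.
Qed.

Lemma mderiv_linear l (A : 'M[k]_(n, l)) i j : (tnth (linear_tuple A) i)^`M(j) = (A i j)%:MP.
Proof.
rewrite tnth_linear raddf_sum /= (bigD1 j) //= big1 => [|j' jj'].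
  by rewrite mderivZ mderivXU eqxx -mul_mpolyC mulr1 addr0.
by rewrite mderivZ mderivXU (negPf jj') scaler0.
Qed.

Lemma linear_comp l r (A : 'M[k]_(n, l)) (g : l.-tuple {mpoly k[r]}) i :
  tnth (linear_tuple A) i \mPo g = \sum_j A i j *: tnth g j.
Proof.
rewrite tnth_linear raddf_sum; apply: eq_bigr => j _ /=.
by rewrite comp_mpolyZ comp_mpolyXU -tnth_nth.
Qed.

End LinearSubstitution.

Lemma mulmx1_scale (k : comNzRingType) n (A B : 'M[k]_n) (V : lmodType k) (x : 'I_n -> V) i :
  A *m B = 1%:M -> \sum_j A i j *: (\sum_l B j l *: x l) = x i.
Proof.
move=> AB; transitivity (\sum_l (A *m B) i l *: x l).
  under eq_bigr => j _ do rewrite scaler_sumr.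
  rewrite exchange_big; apply: eq_bigr => l _ /=; rewrite mxE scaler_suml.
  by apply: eq_bigr => j _; rewrite scalerA.
rewrite AB (bigD1 i) //= mxE eqxx scale1r [X in _ + X]big1 ?addr0 // => l li.
by rewrite mxE eq_sym (negPf li) scale0r.
Qed.

(* The family of the hypersurfaces [F0 o A] with [F0 o f0 = 0].  At [A = 1] the
   derivative of [(A, F0) |-> F0 o A] is onto as soon as every form of degree
   [d * e] is a combination of the partial derivatives of [F0] along [f0]. *)
Section LinearFamily.

Variables (k : closedFieldType) (m d e : nat) (f0 : m.+2.-tuple {mpoly k[2]}).
Variables (c0 : monom m.+2 d -> k) (H2 : (monom m.+2 d -> k) -> k).

Hypothesis d_gt0 : (0 < d)%N.
Hypothesis f0_homog : forall i, tnth f0 i \is e.-homog.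
Hypothesis f0_base : forall a, proj_point a -> proj_point (fun i => (tnth f0 i).@[a]).
Hypothesis f0_span : forall q : {mpoly k[2]}, q \is e.-homog ->
  exists c : 'I_m.+2 -> k, q = \sum_i c i *: tnth f0 i.
Hypothesis c0_f0 : form c0 \mPo f0 = 0.
Hypothesis submersive : forall chi : {mpoly k[2]}, chi \is (d * e)%N.-homog ->
  exists2 q : 'I_m.+2 -> {mpoly k[2]}, forall i, q i \is e.-homog &
    chi = \sum_i q i * grad_along (form c0) f0 i.
Hypotheses (H2_poly : polyfun H2) (H2_c0 : H2 c0 != 0).
Hypothesis H2_generate : forall c, form c \mPo f0 = 0 -> H2 c != 0 ->
  sections_generate e (form c) f0.

(** The curve and the sections are transported by [B], the gradient by the transpose of [A], so
    pairings are unchanged. *)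
Lemma linear_change_generate (F : {mpoly k[m.+2]}) (A B : 'M[k]_m.+2) : A *m B = 1%:M ->
    F \mPo f0 = 0 -> sections_generate e (F) f0 ->
  exists f, morphism_to (F \mPo linear_tuple A) e f /\
    sections_generate e (F \mPo linear_tuple A) f.
Proof.
move=> AB Ff0 gen0; have BA := mulmx1C AB.
pose f := [tuple \sum_l B j l *: tnth f0 l | j < m.+2].
have Af : [tuple tnth (linear_tuple A) i \mPo f | i < m.+2] = f0.
  apply: eq_from_tnth => i; rewrite tnth_mktuple linear_comp -[RHS](mulmx1_scale (tnth f0) i AB).
  by apply: eq_bigr => j _; rewrite tnth_mktuple.
have gradE j : grad_along (F \mPo linear_tuple A) f j
    = \sum_i A i j *: grad_along (F) f0 i.
  rewrite /grad_along chain_rule raddf_sum; apply: eq_bigr => i _ /=.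
  by rewrite rmorphM /= comp_mpoly_comp Af mderiv_linear comp_mpolyC mulrC mul_mpolyC.
exists f; split.
  split; last by rewrite comp_mpoly_comp Af.
    by move=> j; rewrite tnth_mktuple; apply: rpred_sum => l _; apply/rpredZ/f0_homog.
  move=> a pa; have [i hi] := f0_base pa.
  have [/existsP[j hj]|/existsPn no] := boolP [exists j, (tnth f j).@[a] != 0].
    by exists j.
  case/eqP: hi; rewrite -Af tnth_mktuple linear_comp raddf_sum big1 // => j _ /=.
  by rewrite mevalZ; move/negPn/eqP: (no j) => ->; rewrite mulr0.
move=> a pa kappa hk.
have [|w0 [w0h w0phi [mu hmu]]] := gen0 a pa (fun i => \sum_j A i j * kappa j).
  rewrite -[RHS]hk; under eq_bigr => i _ do rewrite mulr_suml.
  rewrite exchange_big; apply: eq_bigr => j _ /=.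
  rewrite gradE raddf_sum mulr_sumr; apply: eq_bigr => i _ /=.
  by rewrite mevalZ; ring.
exists (fun j => \sum_l B j l *: w0 l); split.
- by move=> j; apply: rpred_sum => l _; apply/rpredZ/w0h.
- rewrite -[RHS]w0phi.
  under [RHS]eq_bigr => i _ do rewrite -(mulmx1_scale w0 i AB) mulr_suml.
  rewrite [RHS]exchange_big; apply: eq_bigr => j _ /=.
  rewrite gradE mulr_sumr; apply: eq_bigr => i _.
  by rewrite -scalerAl -scalerAr.
exists mu => j; rewrite raddf_sum /=.
under eq_bigr => l _ do rewrite mevalZ hmu mulrDr.
rewrite big_split /=; congr (_ + _).
  exact: (mulmx1_scale (kappa : 'I_m.+2 -> k^o) j BA).
rewrite tnth_mktuple raddf_sum mulr_sumr; apply: eq_bigr => l _ /=.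
by rewrite mevalZ; ring.
Qed.

Theorem linear_family_open :
  exists G : (monom m.+2 d -> k) -> k, [/\ polyfun G, exists c, G c != 0 &
    forall F, F \is d.-homog -> G (coefs F) != 0 ->
      exists f, morphism_to F e f /\ sections_generate e F f].
Proof.
pose x (a : monom m.+2 d) : {mpoly k[2]} := 'X_[monom_exp a] \mPo f0.
have hx a : x a \is (d * e)%N.-homog.
  by apply: comp_homog => //; rewrite dhomogX; apply/eqP/mdeg_monom.
have [r [D [hD spanD]]] := relations_fin hx.
have formx (c : monom m.+2 d -> k) : form c \mPo f0 = \sum_a c a *: x a.
  by rewrite raddf_sum; apply: eq_bigr => a _ /=; rewrite comp_mpolyZ.
pose T := (('I_m.+2 * 'I_m.+2) + 'I_r)%type.
pose Av (v : T -> k) : 'M[k]_m.+2 := \matrix_(i, j) v (inl (i, j)).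
pose cf (v : T -> k) a := \sum_(s < r) v (inr s) * D s a.
have cf_f0 v : form (cf v) \mPo f0 = 0.
  rewrite formx /cf; under eq_bigr => a _ do rewrite scaler_suml.
  rewrite exchange_big big1 // => s _; under eq_bigr => a _ do rewrite -scalerA.
  by rewrite -scaler_sumr hD scaler0.
have cf_poly a : polyfun (fun v => cf v a).
  by apply: polyfun_sum => s; apply: polyfunM; [apply: polyfunX | apply: polyfunC].
have Av_poly i j : polyfun (fun v => Av v i j).
  by apply: polyfun_ext (polyfunX k (inl (i, j) : T)) => v; rewrite mxE.
pose Phi v := @coefs k m.+2 d (form (cf v) \mPo linear_tuple (Av v)).
pose H v := \det (Av v) * H2 (cf v).
have [theta0 htheta0] : exists theta, forall a, c0 a = \sum_s theta s * D s a.
  by apply: spanD; rewrite -formx.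
pose p (s : T) : k := match s with inl (i, j) => (i == j)%:R | inr s => theta0 s end.
have Avp : Av p = 1%:M by apply/matrixP => i j; rewrite !mxE.
have cfp : cf p =1 c0 by move=> a; rewrite htheta0.
have [|||c|G [G_poly G_nz hG]] := @submersion_image_open k T (monom m.+2 d) Phi H p.
- move=> a; apply: (mpolyfun_form_comp (g := fun v => linear_tuple (Av v))) => // i.
  apply: (mpolyfun_ext (fun v => esym (tnth_linear (Av v) i))).
  by apply: mpolyfun_sum => j; apply: mpolyfunZ => //; apply: mpolyfunC.
- by apply: polyfunM; [apply: polyfun_det | apply: polyfun_comp].
- by rewrite /H Avp det1 mul1r (polyfun_eq H2_poly cfp).
- have [q qh hq] := submersive (comp_homog (form_homog c) f0_homog).
  have /fin_all_exists[L hL] i := f0_span (qh i).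
  pose Lm : 'M[k]_m.+2 := \matrix_(i, j) L i j.
  pose ell := tnth (linear_tuple Lm).
  pose F' := form c - \sum_i ell i * (form c0)^`M(i).
  have F'h : F' \is d.-homog.
    apply: rpredB; first exact: form_homog.
    apply: rpred_sum => i _.
    have := dhomogM (linear_homog Lm i) (mderiv_homog i (form_homog c0)).
    by rewrite add1n prednK.
  have F'f0 : F' \mPo f0 = 0.
    rewrite comp_mpolyB hq [X in _ - X]raddf_sum -sumrB big1 // => i _ /=.
    rewrite rmorphM /= linear_comp hL; apply/eqP; rewrite subr_eq0; apply/eqP; congr (_ * _).
    by apply: eq_bigr => j _; rewrite mxE.
  have [theta htheta] : exists theta, forall a, @coefs k m.+2 d F' a = \sum_s theta s * D s a.
    by apply: spanD; rewrite -formx form_coefs.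
  exists (fun s : T => match s with inl (i, j) => L i j | inr s => theta s end) => a.
  have [G0 hG0] := taylor1 (form c0) ell; have [G1 hG1] := taylor1 F' ell.
  pose G2 := G0 + (\sum_i ell i * F'^`M(i))%:P + 'X * G1.
  exists (\poly_(i < size G2) (G2`_i)@_(monom_exp a)) => t.
  set v := (X in Phi X _).
  have -> : Phi v a = (form c0 + t *: form c + t ^+ 2 *: G2.[t%:MP])@_(monom_exp a).
    congr _@__.
    have -> : form (cf v) = form c0 + t *: F'.
      rewrite -(form_coefs F'h) /form scaler_sumr -big_split; apply: eq_bigr => b _ /=.
      rewrite scalerA -scalerDl htheta htheta0 mulr_sumr -big_split; congr (_ *: _).
      by apply: eq_bigr => s _ /=; rewrite mulrDl mulrA.
    have -> : linear_tuple (Av v) = [tuple 'X_i + t *: ell i | i < m.+2].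
      apply: eq_from_tnth => i; rewrite tnth_linear tnth_mktuple /ell tnth_linear scaler_sumr.
      rewrite [X in X + _](_ : _ = \sum_j (i == j)%:R *: 'X_j); last first.
        rewrite (bigD1 i) //= eqxx scale1r big1 ?addr0 // => j ji.
        by rewrite eq_sym (negPf ji) scale0r.
      by rewrite -big_split; apply: eq_bigr => j _ /=; rewrite !mxE scalerA -scalerDl.
    rewrite comp_mpolyD comp_mpolyZ hG0 hG1 /G2 !(hornerD, hornerM, hornerC, hornerX).
    have -> : form c = F' + \sum_i ell i * (form c0)^`M(i) by rewrite subrK.
    by rewrite -!mul_mpolyC rmorphXn /=; ring.
  rewrite !mcoeffD !mcoeffZ mcoeff_horner; congr (_ + t * _ + _); last exact: coefs_form.
  rewrite /Phi Avp /coefs (eq_form cfp); congr _@__.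
  rewrite -[LHS]comp_mpoly_id; congr (_ \mPo _); apply: eq_from_tnth => i.
  rewrite tnth_mktuple tnth_linear (bigD1 i) //= mxE eqxx scale1r big1 ?addr0 // => j ji.
  by rewrite mxE eq_sym (negPf ji) scale0r.
exists G; split=> // F Fh /hG[v [hv]].
rewrite /H mulf_eq0 negb_or => /andP[detA H2v].
have FE : F = form (cf v) \mPo linear_tuple (Av v).
  rewrite -(form_coefs Fh) -(eq_form hv) /Phi form_coefs //.
  by have := comp_homog (form_homog (cf v)) (linear_homog (Av v)); rewrite muln1.
rewrite FE; apply: (@linear_change_generate _ _ (invmx (Av v))) => //.
  by rewrite mulmxV // unitmxE unitfE.
exact: H2_generate.
Qed.

End LinearFamily.

(** * A base point: the rational normal curve *)
Section OntoOpen.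

Variables (k : closedFieldType) (N e delta : nat) (f phi B0 : 'I_N -> {mpoly k[2]}).
Variables (A0 : 'I_N -> {mpoly k[2]}).
Local Notation s := ('X_ord0 : {mpoly k[2]}).
Local Notation t := ('X_(lift ord0 ord0) : {mpoly k[2]}).

Hypotheses (phi_homog : forall i, phi i \is delta.-homog) (f_phi : \sum_i f i * phi i = 0).
Hypotheses (B0_homog : forall i, B0 i \is e.+1.-homog) (fE : forall i, f i = t * A0 i + s * B0 i).
Variables (u : monom 2 (e + delta) -> 'I_N -> {mpoly k[2]}) (lam : monom 2 (e + delta) -> k).
Hypothesis u_homog : forall b i, u b i \is e.-homog.

(** The multipliers [u] and [lam] will be fixed while [phi] varies with the equation. The shifted
    exponent divides by [t]. *)
Definition onto_matrix : 'M[k]_#|{: monom 2 (e + delta)}| :=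
  \matrix_(a, b) (\sum_i (t * u (enum_val a) i + lam (enum_val a) *: B0 i) * phi i)
    @_(monom_exp (enum_val b) + U_(lift ord0 ord0)).

Lemma onto_of_det : \det onto_matrix != 0 -> twisted_onto e delta phi B0.
Proof.
move=> det0; pose Z b := \sum_i (t * u b i + lam b *: B0 i) * phi i.
have th : t \is 1.-homog by rewrite dhomogX; apply/eqP/mdeg1.
(* At the point [t = 0], [s = 1] the vector [B0] equals [f], which is orthogonal to [phi]. *)
have /fin_all_exists[psi hpsi] b : exists q, q \is (e + delta)%N.-homog /\ Z b = t * q.
  have [||q hq eq] := @vanish_divides k (pt_t0 k) (e + delta) (Z b) (pt_t0_proj k).
  - apply: rpred_sum => i _; rewrite -addSn; apply: dhomogM => //.
    apply: rpredD; last by apply/rpredZ/B0_homog.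
    by have := dhomogM th (u_homog b i); rewrite add1n.
  - have := congr1 (meval (pt_t0 k)) f_phi; rewrite meval0 raddf_sum => h.
    rewrite raddf_sum -[RHS](mulr0 (lam b)) -[in RHS]h mulr_sumr; apply: eq_bigr => i _ /=.
    rewrite fE !(mevalM, mevalD, mevalZ, mevalXU).
    have p0 : pt_t0 k ord0 = 1 by []. have p1 : pt_t0 k (lift ord0 ord0) = 0 by [].
    by rewrite p0 p1; ring.
  by exists q; rewrite -(pt_t0_eqn k).
move=> chi hchi; pose x : 'rV[k]_#|{: monom 2 (e + delta)}| := \row_j coefs chi (enum_val j).
have uQ : onto_matrix \in unitmx by rewrite unitmxE unitfE.
pose y := x *m invmx onto_matrix.
have yQ : y *m onto_matrix = x by rewrite mulmxKV.
have QE a b : onto_matrix a b = coefs (psi (enum_val a)) (enum_val b).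
  by rewrite mxE -/(Z _) (hpsi _).2 mulrC addmC mcoeffMX.
have chiE : chi = \sum_a y 0 a *: psi (enum_val a).
  rewrite -(form_coefs hchi); set R := RHS.
  have Rh : R \is (e + delta)%N.-homog.
    by apply: rpred_sum => a _; apply: rpredZ; case: (hpsi (enum_val a)).
  rewrite -(form_coefs Rh); apply: eq_form => b.
  have := congr1 (fun M : 'rV_#|{: monom 2 (e + delta)}| => M 0 (enum_rank b)) yQ.
  rewrite /= [RHS]mxE enum_rankK => <-; rewrite mxE /R /coefs raddf_sum; apply: eq_bigr => a _ /=.
  by rewrite QE enum_rankK mcoeffZ.
exists (fun i => \sum_a y 0 a *: u (enum_val a) i), (\sum_a y 0 a * lam (enum_val a)); split.
  by move=> i; apply: rpred_sum => a _; apply/rpredZ/u_homog.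
rewrite [in LHS]chiE mulr_sumr.
under eq_bigr => a _ do rewrite -scalerAr -(hpsi _).2 /Z scaler_sumr.
rewrite exchange_big; apply: eq_bigr => i _ /=.
rewrite mulr_sumr scaler_suml -big_split mulr_suml; apply: eq_bigr => a _ /=.
by rewrite -!mul_mpolyC mpolyCM; ring.
Qed.

End OntoOpen.

Section MonomialCurve.

Variables (k : closedFieldType) (m e : nat).
Hypothesis e_le : (e <= m.+1)%N.
Local Notation s := ('X_ord0 : {mpoly k[2]}).
Local Notation t := ('X_(lift ord0 ord0) : {mpoly k[2]}).

Lemma st_homog i j : s ^+ i * t ^+ j \is (i + j)%N.-homog.
Proof.
have X1 l : ('X_l : {mpoly k[2]}) \is 1.-homog by rewrite dhomogX; apply/eqP/mdeg1.
have XX l r : ('X_l : {mpoly k[2]}) ^+ r \is r.-homog by have := dhomogMn r (X1 l); rewrite mul1n.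
exact: dhomogM.
Qed.

Lemma monom2E M (b : monom 2 M) :
  'X_[monom_exp b] = s ^+ (M - monom_exp b (lift ord0 ord0)) * t ^+ monom_exp b (lift ord0 ord0).
Proof.
rewrite mpolyXE_id !big_ord_recl big_ord0 mulr1; congr (_ ^+ _ * _).
by rewrite -[X in (X - _)%N](mdeg_monom b) mdegE !big_ord_recl big_ord0 addn0 addnK.
Qed.

Lemma monom2_le M (b : monom 2 M) : (monom_exp b (lift ord0 ord0) <= M)%N.
Proof. by rewrite -[X in (_ <= X)%N](mdeg_monom b) mdegE !big_ord_recl big_ord0 addn0 leq_addl. Qed.

(** A line for [e = 1] and the rational normal curve for [e = m.+1]. *)
Definition monomial_curve : m.+2.-tuple {mpoly k[2]} :=
  [tuple if (i <= e)%N then s ^+ (e - i) * t ^+ i else 0 | i < m.+2].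

Lemma monomial_curveE (i : 'I_m.+2) : tnth monomial_curve i
  = if (i <= e)%N then s ^+ (e - i) * t ^+ i else 0.
Proof. by rewrite tnth_mktuple. Qed.

Lemma monomial_curve_homog i : tnth monomial_curve i \is e.-homog.
Proof.
rewrite monomial_curveE; case: ifP => h; last exact: rpred0.
by have := st_homog (e - i) i; rewrite subnK.
Qed.

Lemma monomial_curve_base (a : 'I_2 -> k) :
  proj_point a -> proj_point (fun i => (tnth monomial_curve i).@[a]).
Proof.
have [a0|a0] := eqVneq (a ord0) 0; last first.
  by exists ord0; rewrite monomial_curveE /= subn0 expr0 mulr1 rmorphXn /= mevalXU expf_neq0.
move=> [i ai]; have a1 : a (lift ord0 ord0) != 0.
  case: i ai => [[|[|//]]] hi ai.
    by move: ai; rewrite (_ : Ordinal hi = ord0) ?a0 ?eqxx //; apply: val_inj.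
  by rewrite (_ : lift ord0 ord0 = Ordinal hi) //; apply: val_inj.
have he : (e < m.+2)%N by [].
exists (Ordinal he); rewrite monomial_curveE /= leqnn subnn expr0 mul1r rmorphXn /= mevalXU.
exact: expf_neq0.
Qed.

Lemma monomial_curve_span (q : {mpoly k[2]}) : q \is e.-homog ->
  exists c : 'I_m.+2 -> k, q = \sum_i c i *: tnth monomial_curve i.
Proof.
move=> hq; rewrite -(form_coefs hq); pose P q := exists c : 'I_m.+2 -> k, q = \sum_i c i *: tnth monomial_curve i.
apply: (big_ind P) => [|x y [c ->] [c' ->]|b _].
- by exists (fun=> 0); rewrite big1 // => i _; rewrite scale0r.
- by exists (fun i => c i + c' i); rewrite -big_split; apply: eq_bigr => i _; rewrite scalerDl.
have hb : (monom_exp b (lift ord0 ord0) < m.+2)%N by apply: leq_ltn_trans (monom2_le b) _.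
exists (fun i => coefs q b *+ (i == Ordinal hb)).
rewrite (bigD1 (Ordinal hb)) //= eqxx mulr1n big1 ?addr0 => [|i /negPf ->]; last by rewrite mulr0n scale0r.
by rewrite monomial_curveE /= monom2_le monom2E.
Qed.

End MonomialCurve.

(** The gradient is constant, so a kernel vector at one point is already a global section of degree
    [e - 1 = 0]. No open condition is needed on the equation, hence [H2 = 1]. *)
Lemma general_hyperplane (k : closedFieldType) (m : nat) : (0 < m)%N ->
  exists G : (monom m.+2 1 -> k) -> k, [/\ polyfun G, exists c, G c != 0 &
    forall F, F \is 1.-homog -> G (coefs F) != 0 ->
      exists f, morphism_to F 1 f /\ sections_generate 1 F f].
Proof.
move=> m0.
pose F0 : {mpoly k[m.+2]} := 'X_ord_max.
have F0h : F0 \is 1.-homog by rewrite dhomogX; apply/eqP/mdeg1.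
pose f0 := monomial_curve k m 1.
have gradC (F : {mpoly k[m.+2]}) i : F \is 1.-homog ->
    exists c, grad_along F f0 i = c%:MP.
  move=> hF; exists (F^`M(i))@_0; rewrite /grad_along.
  suff -> : F^`M(i) = ((F^`M(i))@_0)%:MP by rewrite comp_mpolyC mcoeffC eqxx mulr1.
  apply/mpolyP => b; rewrite mcoeffC; have [->|b0] := eqVneq b 0%MM; first by rewrite mulr1.
  rewrite mulr0; apply: (dhomog_nemf_coeff (mderiv_homog i hF)).
  by rewrite /= mdeg_eq0.
pose c0 : monom m.+2 1 -> k := coefs F0.
have F0f0 : form c0 \mPo f0 = 0.
  by rewrite form_coefs // comp_mpolyXU -tnth_nth monomial_curveE /= ltnS leqNgt m0.
have one_poly : polyfun (fun _ : monom m.+2 1 -> k => 1) := polyfunC _ 1.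
apply: (linear_family_open (f0 := f0) (c0 := c0) _ _ _ _ F0f0 _ one_poly) => //.
- exact: monomial_curve_homog.
- exact: monomial_curve_base.
- exact: monomial_curve_span.
- move=> chi hchi; exists (fun i => if i == ord_max then chi else 0).
    by move=> i; case: ifP => _ //; apply: rpred0.
  rewrite form_coefs // (bigD1 ord_max) //= eqxx big1 ?addr0 => [|i /negPf ->]; last by rewrite mul0r.
  by rewrite /grad_along mderivXU eqxx comp_mpoly1 mulr1.
- exact: oner_neq0.
move=> c _ _ a pa kappa hk; exists (fun i => (kappa i)%:MP); split.
- by move=> i; rewrite -[_%:MP]mulr1 mul_mpolyC rpredZ // dhomog1.
- have := congr1 (@mpolyC 2 k) hk; rewrite rmorph_sum mpolyC0 => h; apply: etrans h.
  apply: eq_bigr => i _ /=.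
  have [x ->] := gradC _ i (form_homog c).
  by rewrite mevalC mpolyCM.
by exists 0 => i; rewrite mevalC mul0r addr0.
Qed.

Section RationalNormalCurve.

Variables (k : closedFieldType) (m d : nat).
Hypotheses (m_gt0 : (0 < m)%N) (d_gt1 : (1 < d)%N) (d_le : (d <= m.+1)%N).

Local Notation n := m.+1.
Local Notation s := ('X_ord0 : {mpoly k[2]}).
Local Notation t := ('X_(lift ord0 ord0) : {mpoly k[2]}).
Local Notation f0 := (monomial_curve k m n).

(* The quadrics x_j x_(j+2) - x_(j+1)^2 vanish on the curve, and their gradients
   there are the (0, .., t^2, -2st, s^2, .., 0), up to monomials.  The multipliers
   x_0^(d-2-i) x_n^i with i = min(j, d-2) turn these monomials into the
   s^(top_offset - offset j) t^(offset j), whose offsets increase by at most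
   n + 1. *)
Definition twist_exp j := minn j d.-2.
Definition offset j := (n * twist_exp j + j)%N.
Definition top_offset := (n * d.-2 + m.-1)%N.

Lemma offset_le j : (j < m)%N -> (offset j <= top_offset)%N.
Proof.
move=> jm; rewrite /offset /top_offset leq_add //; last by lia.
by rewrite leq_mul2l geq_minr orbT.
Qed.

(** Each interval contains [D + 3] integers and the next starts at most [n + 1 <= D + 3] later, so
    there is no gap. *)
Lemma offset_cover D p : (n <= D.+2)%N -> (p <= D.+2 + top_offset)%N ->
  exists j, [/\ (j < m)%N, (offset j <= p)%N & (p <= offset j + D.+2)%N].
Proof.
move=> nD hp.
have top : offset m.-1 = top_offset by rewrite /offset /top_offset /twist_exp; congr (_ * _ + _)%N; lia.
suff cover j : (j < m)%N -> (p <= offset j + D.+2)%N ->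
    exists j', [/\ (j' < m)%N, (offset j' <= p)%N & (p <= offset j' + D.+2)%N].
  by apply: (cover m.-1); [lia | rewrite top addnC].
elim: j => [|j IH] jm pj.
  by exists 0%N; split=> //; rewrite /offset /twist_exp min0n muln0.
have [le|lt] := leqP p (offset j + D.+2); first by apply: IH => //; lia.
exists j.+1; split=> //; apply: leq_trans lt.
have : (offset j.+1 <= offset j + n.+1)%N.
  rewrite /offset; have : (n * twist_exp j.+1 <= n * (twist_exp j).+1)%N.
    by rewrite leq_mul2l /twist_exp; lia.
  by rewrite mulnS; lia.
by lia.
Qed.

Definition quadric_coef j : {mpoly k[2]} :=
  s ^+ (top_offset - offset j) * t ^+ offset j.

(* The index is shifted by 2 so that the recurrence of [curve_grad] holds for all
   [l], with zero boundary values. *)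
Definition shifted_coef J : {mpoly k[2]} := \sum_(j < m) (J == j.+2)%:R * quadric_coef j.

Lemma shifted_coef_lt2 J : (J < 2)%N -> shifted_coef J = 0.
Proof.
by move=> hJ; rewrite /shifted_coef big1 // => j _; case: J hJ => [|[|]] // _; rewrite mul0r.
Qed.

Lemma shifted_coef_ge J : (m.+2 <= J)%N -> shifted_coef J = 0.
Proof.
move=> hJ; rewrite /shifted_coef big1 // => j _; have hj := ltn_ord j.
by case: eqP => [eJ|_]; [exfalso; lia | rewrite mul0r].
Qed.

Lemma shifted_coefE j : (j < m)%N -> shifted_coef j.+2 = quadric_coef j.
Proof.
move=> jm; rewrite /shifted_coef (bigD1 (Ordinal jm)) //= eqxx mul1r big1 ?addr0 // => i.
by rewrite -val_eqE /= eq_sym !eqSS => /negPf ->; rewrite mul0r.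
Qed.

Definition curve_grad (l : nat) : {mpoly k[2]} :=
  t ^+ 2 * shifted_coef l.+2 - 2%:R * (s * t * shifted_coef l.+1) + s ^+ 2 * shifted_coef l.

Section Span.

Variables (D : nat) (z : {mpoly k[2]}).
Hypothesis n_le_D : (n <= D.+2)%N.

(** Used with [D = n - 2] and an extra generator [z] for the cohomological condition, and with
    [D = n], [z = 0] for submersivity. *)
Definition in_span x := exists (u : 'I_m.+2 -> {mpoly k[2]}) (lam : k),
  (forall i, u i \is D.-homog) /\ x = \sum_i u i * curve_grad i + lam *: z.

Lemma in_span0 : in_span 0.
Proof.
exists (fun=> 0), 0; split; first by move=> i; apply: rpred0.
by rewrite scale0r addr0 big1 // => i _; rewrite mul0r.
Qed.

Lemma in_spanD x y : in_span x -> in_span y -> in_span (x + y).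
Proof.
move=> [u [a [hu ->]]] [v [b [hv ->]]]; exists (fun i => u i + v i), (a + b); split.
  by move=> i; apply: rpredD; [apply: hu | apply: hv].
rewrite scalerDl addrACA -big_split; congr (_ + _); apply: eq_bigr => i _.
by rewrite mulrDl.
Qed.

Lemma in_spanZ c x : in_span x -> in_span (c *: x).
Proof.
move=> [u [a [hu ->]]]; exists (fun i => c *: u i), (c * a); split.
  by move=> i; apply/rpredZ/hu.
rewrite scalerDr scalerA scaler_sumr; congr (_ + _); apply: eq_bigr => i _.
by rewrite scalerAl.
Qed.

Lemma in_span_rel a l : (a <= D)%N -> (l < m.+2)%N ->
  in_span (s ^+ (D - a) * t ^+ a * curve_grad l).
Proof.
move=> aD lm; exists (fun i => if i == Ordinal lm then s ^+ (D - a) * t ^+ a else 0), 0; split.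
  move=> i; case: ifP => _; last exact: rpred0.
  by have := st_homog k (D - a) a; rewrite subnK.
by rewrite scale0r addr0 (bigD1 (Ordinal lm)) //= eqxx big1 ?addr0 // => i /negPf ->; rewrite mul0r.
Qed.

Definition grid i J : {mpoly k[2]} := shifted_coef J * (s ^+ (D.+2 - i) * t ^+ i).

(** A second-difference relation along a diagonal. Its outer coefficients are 1, so it can be solved
    in both directions in every characteristic. *)
Lemma grid_rel a l : (a <= D)%N -> (l < m.+2)%N ->
  in_span (grid a.+2 l.+2 - 2%:R *: grid a.+1 l.+1 + grid a l).
Proof.
move=> aD lm; have := in_span_rel aD lm; congr in_span.
rewrite /grid /curve_grad.
have -> : (D.+2 - a.+2 = D - a)%N by lia.
have -> : (D.+2 - a.+1 = (D - a).+1)%N by lia.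
have -> : (D.+2 - a = (D - a).+2)%N by lia.
by rewrite -mul_mpolyC mpolyC_nat !exprS expr0; ring.
Qed.

Lemma grid_up_step i J : (i <= D)%N -> in_span (grid i.+1 J.+1) -> in_span (grid i J) ->
  in_span (grid i.+2 J.+2).
Proof.
move=> iD h1 h0; have [lt|ge] := ltnP J m.+2; last first.
  by rewrite /grid shifted_coef_ge ?mul0r; [apply: in_span0 | lia].
have -> : grid i.+2 J.+2 = (grid i.+2 J.+2 - 2%:R *: grid i.+1 J.+1 + grid i J)
    + (2%:R *: grid i.+1 J.+1 + (- 1) *: grid i J).
  by rewrite scaleN1r; ring.
by apply: in_spanD (grid_rel iD lt) _; apply: in_spanD; apply: in_spanZ.
Qed.

Lemma grid_down_step i J : (i <= D)%N -> (J < m.+2)%N ->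
  in_span (grid i.+1 J.+1) -> in_span (grid i.+2 J.+2) -> in_span (grid i J).
Proof.
move=> iD lt h1 h2.
have -> : grid i J = (grid i.+2 J.+2 - 2%:R *: grid i.+1 J.+1 + grid i J)
    + (2%:R *: grid i.+1 J.+1 + (- 1) *: grid i.+2 J.+2).
  by rewrite scaleN1r; ring.
by apply: in_spanD (grid_rel iD lt) _; apply: in_spanD; apply: in_spanZ.
Qed.

Lemma grid_small i J : (J < 2)%N -> in_span (grid i J).
Proof. by move=> hJ; rewrite /grid shifted_coef_lt2 // mul0r; apply: in_span0. Qed.

Lemma grid_large i J : (m.+2 <= J)%N -> in_span (grid i J).
Proof. by move=> hJ; rewrite /grid shifted_coef_ge // mul0r; apply: in_span0. Qed.

Lemma grid_upper i J : (J <= i)%N -> (i <= D.+2)%N -> in_span (grid i J).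
Proof.
have [N] := ubnP J; elim: N i J => // N IH i [|[|J]] hN Ji iD; try exact: grid_small.
case: i Ji iD => [|[|i]] // Ji iD.
by apply: grid_up_step; [lia | apply: IH; lia | apply: IH; lia].
Qed.

Lemma grid_lower i J : (i.+2 <= J)%N -> in_span (grid i J).
Proof.
have [N] := ubnP (m.+2 - J); elim: N i J => // N IH i J hN iJ.
have [lt|ge] := ltnP J m.+2; last exact: grid_large.
by apply: grid_down_step => //; [lia | apply: IH; lia | apply: IH; lia].
Qed.

(* By the recurrence each diagonal i - J = constant is generated upwards or
   downwards from its zero boundary values.  On the diagonal J = i + 1 this depends
   on [D]. *)
Lemma span_all : (forall i J, J = i.+1 -> (i <= D.+2)%N -> in_span (grid i J)) ->
  forall chi, chi \is (D.+2 + top_offset)%N.-homog -> in_span chi.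
Proof.
move=> diag chi hchi; rewrite -(form_coefs hchi).
apply: (big_ind in_span) => [||b _]; [exact: in_span0 | exact: in_spanD |].
apply: in_spanZ; rewrite monom2E.
have := monom2_le b; set p := monom_exp b _ => hp.
(* Each monomial is some quadric coefficient times a monomial of degree [D + 2], hence a grid
   element. *)
have [j [jm oj pj]] := offset_cover n_le_D hp.
have -> : s ^+ (D.+2 + top_offset - p) * t ^+ p = grid (p - offset j) j.+2.
  rewrite /grid shifted_coefE // /quadric_coef mulrACA -!exprD.
  have := offset_le jm => oj'.
  by congr (_ ^+ _ * _ ^+ _); lia.
have [h|h] := leqP j.+2 (p - offset j); first by apply: grid_upper => //; lia.
have [h'|h'] := leqP (p - offset j).+2 j.+2; first exact: grid_lower.
by apply: diag; lia.
Qed.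

End Span.

Local Notation x j := ('X_(inord j) : {mpoly k[m.+2]}).

Definition rnc_equation : {mpoly k[m.+2]} :=
  \sum_(j < m) x 0%N ^+ (d.-2 - twist_exp j) * x n ^+ twist_exp j
    * (x j * x j.+2 - x j.+1 ^+ 2).

Lemma rnc_equation_homog : rnc_equation \is d.-homog.
Proof.
have xh j : x j \is 1.-homog by rewrite dhomogX; apply/eqP/mdeg1.
have xXh j r : x j ^+ r \is r.-homog by have := dhomogMn r (xh j); rewrite mul1n.
apply: rpred_sum => j _.
have h1 := dhomogM (xXh 0%N (d.-2 - twist_exp j)%N) (xXh n (twist_exp j)).
have h2 : x j * x j.+2 - x j.+1 ^+ 2 \is 2.-homog.
  by apply: rpredB; [apply: (dhomogM (xh j) (xh j.+2)) | apply: xXh].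
have := dhomogM h1 h2; rewrite subnK; last by rewrite geq_minr.
by have -> : (d.-2 + 2 = d)%N by lia.
Qed.

Lemma comp_rnc j : (j <= n)%N -> x j \mPo f0 = s ^+ (n - j) * t ^+ j.
Proof.
by move=> hj; rewrite comp_mpolyXU -tnth_nth monomial_curveE inordK // hj.
Qed.

Lemma comp_quadric j : (j < m)%N -> (x j * x j.+2 - x j.+1 ^+ 2) \mPo f0 = 0.
Proof.
move=> jm; rewrite rmorphB rmorphXn rmorphM /= !comp_rnc; try lia.
have -> : (n - j = (n - j.+2).+2)%N by lia.
have -> : (n - j.+1 = (n - j.+2).+1)%N by lia.
by rewrite !exprS; ring.
Qed.

Lemma rnc_equation_comp : rnc_equation \mPo f0 = 0.
Proof.
by rewrite raddf_sum big1 // => j _; rewrite /= rmorphM /= comp_quadric // mulr0.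
Qed.

Lemma rnc_gradient (l : 'I_m.+2) : grad_along rnc_equation f0 l = curve_grad l.
Proof.
have dx a : (a <= n)%N -> (x a)^`M(l) = (a == l)%:R.
  by move=> ha; rewrite mderivXU -val_eqE /= inordK.
rewrite /grad_along /rnc_equation (raddf_sum (mderiv l)) (raddf_sum (comp_mpoly f0)) /curve_grad /shifted_coef !mulr_sumr.
rewrite -sumrB -big_split; apply: eq_bigr => -[j jm] _ /=.
rewrite mderivM comp_mpolyD !rmorphM /= comp_quadric // mulr0 add0r.
have -> : (x j * x j.+2 - x j.+1 ^+ 2)^`M(l)
    = (j == l)%:R * x j.+2 + (j.+2 == l)%:R * x j - 2%:R * (j.+1 == l)%:R * x j.+1.
  by rewrite mderivB mderivM mderivXn !dx; try lia; ring.
rewrite rmorphB rmorphD !rmorphM !rmorphXn !rmorph_nat /= !comp_rnc; try lia.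
have -> : quadric_coef j = (s ^+ (n - 0) * t ^+ 0) ^+ (d.-2 - twist_exp j)
    * (s ^+ (n - n) * t ^+ n) ^+ twist_exp j * (s ^+ (n - j.+2) * t ^+ j).
  rewrite subn0 subnn !expr0 mulr1 mul1r -!exprM mulrACA -!exprD /quadric_coef.
  have : (twist_exp j <= d.-2)%N by rewrite geq_minr.
  rewrite /top_offset /offset => le; congr (_ ^+ _ * _ ^+ _).
  rewrite mulnBr; have : (n * twist_exp j <= n * d.-2)%N by rewrite leq_mul2l le orbT.
  by lia.
rewrite !eqSS ![(_ : nat) == l]eq_sym.
have -> : (n - j = (n - j.+2).+2)%N by lia.
have -> : (n - j.+1 = (n - j.+2).+1)%N by lia.
by rewrite !exprS; ring.
Qed.

Theorem general_hypersurface_sections :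
  exists G : (monom m.+2 d -> k) -> k, [/\ polyfun G, exists c, G c != 0 &
    forall F, F \is d.-homog -> G (coefs F) != 0 ->
      exists f, morphism_to F n f /\ sections_generate n F f].
Proof.
pose c0 : monom m.+2 d -> k := coefs rnc_equation.
have c0E : form c0 = rnc_equation by rewrite form_coefs // rnc_equation_homog.
have en : (m.-1).+2 = n by lia.
pose D := m.-1; pose delta := (d.-1 * n)%N.
have degE : (D.+2 + top_offset = D + delta)%N.
  rewrite en /D /delta /top_offset; have -> : d.-1 = (d.-2).+1 by lia.
  by rewrite mulSn mulnC; lia.
have degE' : (n.+2 + top_offset = d * n)%N.
  rewrite /top_offset; have -> : (d * n = n * d.-2 + n * 2)%N by rewrite -mulnDr mulnC; congr (_ * _)%N; lia.
  by lia.
pose A0 (i : 'I_m.+2) : {mpoly k[2]} := if i == ord0 then 0 else s ^+ (n - i) * t ^+ i.-1.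
pose B0 (i : 'I_m.+2) : {mpoly k[2]} := if i == ord0 then s ^+ D.+1 else 0.
have fE i : tnth f0 i = t * A0 i + s * B0 i.
  rewrite monomial_curveE -ltnS ltn_ord /A0 /B0; have [->|i0] := eqVneq i ord0.
    by rewrite subn0 expr0 mulr1 mulr0 add0r -exprS en.
  have i1 : (i : nat) = i.-1.+1 by rewrite prednK // lt0n.
  by rewrite {2}i1 exprS; ring.
have B0h i : B0 i \is D.+1.-homog.
  rewrite /B0; case: ifP => _; last exact: rpred0.
  by have := st_homog k D.+1 0; rewrite expr0 mulr1 addn0.
(* This is [B0 . phi / t] for the explicit equation. Together with [grid D 0 1 = 0] it starts the
   recurrence on the diagonal [J = i + 1]. *)
pose z := grid D 1 2.
have zE : t * z = \sum_i B0 i * curve_grad i.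
  rewrite (bigD1 ord0) //= big1 => [|i /negPf i0]; last by rewrite /B0 i0 mul0r.
  rewrite /B0 eqxx addr0 /curve_grad [shifted_coef 1]shifted_coef_lt2 //.
  rewrite [shifted_coef 0]shifted_coef_lt2 // /z /grid (_ : D.+2 - 1 = D.+1)%N; last by lia.
  by rewrite /= !exprS expr0; ring.
have onto0 chi : chi \is (D + delta)%N.-homog -> exists ul : ('I_m.+2 -> {mpoly k[2]}) * k,
    (forall i, ul.1 i \is D.-homog) /\
    t * chi = \sum_i (t * ul.1 i + ul.2 *: B0 i) * curve_grad i.
  rewrite -degE => hchi; have [|i J|u [lam [hu ->]]] := @span_all D z _ _ chi hchi.
  - by rewrite /D en.
  - move=> -> {J}; have [N] := ubnP i; elim: N i => // N IH [|[|i]] hN hi.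
    + exact: grid_small.
    + exists (fun=> 0), 1; split; first by move=> i; apply: rpred0.
      by rewrite scale1r big1 ?add0r // => i _; rewrite mul0r.
    by apply: grid_up_step; [lia | lia | apply: IH; lia | apply: IH; lia].
  exists (u, lam); split=> //=; rewrite mulrDr -scalerAr zE scaler_sumr mulr_sumr -big_split.
  by apply: eq_bigr => i _ /=; rewrite mulrDl mulrA scalerAl.
have /fin_all_exists[ul hul] (b : monom 2 (D + delta)) :=
  onto0 'X_[monom_exp b] (etrans (dhomogX _ _ _ _) (introT eqP (mdeg_monom b))).
pose Q (c : monom m.+2 d -> k) := onto_matrix (grad_along (form c) f0) B0 (fun b => (ul b).1) (fun b => (ul b).2).
apply: (linear_family_open (f0 := f0) (c0 := c0) (H2 := fun c => \det (Q c))); first lia.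
- exact: monomial_curve_homog.
- exact: monomial_curve_base.
- exact: monomial_curve_span.
- by rewrite c0E rnc_equation_comp.
- move=> chi hchi; rewrite c0E; rewrite -degE' in hchi.
  have [|i J|u [lam [hu ->]]] := @span_all n 0 _ _ chi hchi; first by lia.
    (* For [D = n] the relations reach past the top of this diagonal, where two consecutive elements
       are zero; it is generated downwards without [z]. *)
    move=> -> {J}; have [N] := ubnP (m.+2 - i); elim: N i => // N IH i hN hi.
    have [lt|ge] := ltnP i.+1 m.+2; last exact: grid_large.
    by apply: grid_down_step; [lia | lia | lia | apply: IH; lia | apply: IH; lia].
  exists u => //; rewrite scaler0 addr0; apply: eq_bigr => i _.
  by rewrite rnc_gradient.
- apply: polyfun_det => a b.
  have hgrad l : mpolyfun (fun c : monom m.+2 d -> k => grad_along (form c) f0 l).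
    apply: (@mpolyfun_ext _ _ _ (fun c => \sum_a c a *: grad_along 'X_[monom_exp a] f0 l)).
      move=> c; rewrite /grad_along (raddf_sum (mderiv l)) (raddf_sum (comp_mpoly f0)).
      by apply: eq_bigr => a1 _ /=; rewrite mderivZ comp_mpolyZ.
    by apply: mpolyfun_sum => a'; apply: mpolyfunZ; [apply: polyfunX | apply: mpolyfunC].
  have hsum : mpolyfun (fun c : monom m.+2 d -> k =>
      \sum_i (t * (ul (enum_val a)).1 i + (ul (enum_val a)).2 *: B0 i) * grad_along (form c) f0 i).
    by apply: mpolyfun_sum => i; apply: mpolyfunM => //; apply: mpolyfunC.
  apply: polyfun_ext (hsum (monom_exp (enum_val b) + U_(lift ord0 ord0))%MM) => c.
  by rewrite /Q mxE.
(* The multipliers were chosen to produce the monomials themselves for [c0]. *)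
- suff -> : Q c0 = 1%:M by rewrite det1 oner_neq0.
  apply/matrixP => a b; rewrite !mxE c0E.
  under eq_bigr => i _ do rewrite rnc_gradient.
  rewrite -(hul _).2 mulrC addmC mcoeffMX mcoeffX.
  by rewrite (inj_eq (@monom_exp_inj _ _)) (inj_eq enum_val_inj).
move=> c cf0 Qc a pa kappa hk.
have gh i : grad_along (form c) f0 i \is delta.-homog.
  by apply: comp_homog; [apply/mderiv_homog/form_homog | apply: monomial_curve_homog].
have f_phi : \sum_i tnth f0 i * grad_along (form c) f0 i = 0.
  have := congr1 (comp_mpoly f0) (euler_formula (form_homog c)).
  rewrite raddfMn /= cf0 mul0rn raddf_sum => h; apply: etrans h; apply: eq_bigr => i _ /=.
  by rewrite rmorphM /= comp_mpolyXU -tnth_nth.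
have onto := onto_of_det gh f_phi B0h fE (fun b => (hul b).1) Qc.
have f0h i : tnth f0 i \is (D.+2).-homog by rewrite en; apply: monomial_curve_homog.
have [w [wh wphi hw]] := sections_of_onto f0h gh f_phi B0h fE onto pa hk.
by exists w; split=> //= i; have := wh i; rewrite (_ : D.+1 = m) //; lia.
Qed.

End RationalNormalCurve.

(** * General hypersurfaces *)
Lemma not_smooth0 (k : fieldType) n : ~ smooth_hypersurface (0 : {mpoly k[n.+1]}).
Proof.
move=> sm; have [|i] := sm (fun=> 1) _ (meval0 _); first by exists ord0; rewrite oner_neq0.
by rewrite mderiv0 meval0 eqxx.
Qed.

(* A nonvanishing inhomogeneous condition gives a homogeneous one: if some
   homogeneous component of it does not vanish at [F], then the condition
   itself does not vanish at some multiple of [F]. *)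
Lemma general_of_polyfun (k : closedFieldType) (n d : nat) (P : {mpoly k[n.+1]} -> Prop)
    (G : (monom n.+1 d -> k) -> k) :
    polyfun G -> (exists c, G c != 0) ->
    (forall F, F \is d.-homog -> G (coefs F) != 0 -> P F) -> ~ P 0 ->
    (forall t F, t != 0 -> P (t *: F) -> P F) ->
  @for_general_hypersurface k n d P.
Proof.
move=> [p hp] [c Gc] hG nP0 scale.
exists (fun q => exists e, q = pihomog mdeg e p); split.
- by move=> _ [e ->]; exists e; apply: pihomogP.
- have Pc : P (form c).
    apply: hG; first exact: form_homog.
    by rewrite (polyfun_eq (ex_intro _ p hp) (coefs_form c)).
  exists (form c).
    by rewrite /hypersurface form_homog andbT; apply/negP => /eqP c0; rewrite c0 in Pc.
  have [/existsP[e he]|/existsPn no] :=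
    boolP [exists e : 'I_(msize p), coeff_eval (pihomog mdeg e p) (form c) != 0].
    by exists (pihomog mdeg e p) => //; exists e.
  case/eqP: Gc; rewrite hp (pihomog_partitionE (leqnn (msize p))) raddf_sum big1 // => e _ /=.
  move/negPn/eqP: (no e); rewrite /coeff_eval => h; apply: etrans h; apply: meval_eq => i.
  by rewrite -[LHS]coefs_form.
move=> F /andP[_ Fh] [_ [e ->] he].
have [[t t0 Gt]|no] := excluded_middle_informative (exists2 t, t != 0 & G (coefs (t *: F)) != 0).
  by apply: (scale t) => //; apply: hG => //; apply: rpredZ.
case/eqP: he; apply: (pihomog_eq0_on_line (R := p)) => t t0.
have [h|h] := eqVneq (G (coefs (t *: F))) 0; last by case: no; exists t.
rewrite -h hp; apply: meval_eq => i; by rewrite /coefs mcoeffZ.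
Qed.

Theorem theorem1p4 (k : closedFieldType) (n d : nat)
    (hn : (2 <= n)%N) (hd : (1 <= d <= n)%N) :
  @for_general_hypersurface k n d
    (fun F => smooth_hypersurface F /\ separably_rationally_connected F).
Proof.
case: n hn hd => [|m] // m0 /andP[d0 dn].
have [Gs [Gs_poly Gs_nz smooth]] := @general_smooth k m.+1 d (ltn0Sn m) d0.
have [e e0 [Gv [Gv_poly Gv_nz curves]]] : exists2 e, (0 < e)%N &
    exists G : (monom m.+2 d -> k) -> k, [/\ polyfun G, exists c, G c != 0 &
    forall F, F \is d.-homog -> G (coefs F) != 0 ->
      exists f, morphism_to F e f /\ sections_generate e F f].
  have [d1|d1] := leqP d 1.
    have -> : d = 1%N by apply/eqP; rewrite eqn_leq d1.
    by exists 1%N => //; apply: general_hyperplane.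
  by exists m.+1 => //; apply: general_hypersurface_sections.
(* Stated through sections rather than ampleness, since their existence is easily seen to be
   invariant under scaling [F], as [general_of_polyfun] demands. *)
pose P (F : {mpoly k[m.+2]}) := smooth_hypersurface F /\
  exists f, F \is d.-homog /\ morphism_to F e f /\ sections_generate e F f.
suff : @for_general_hypersurface k m.+1 d P.
  move=> [I [hI hne hP]]; exists I; split=> // F hF UF.
  have [sm [f [Fh [fm gen]]]] := hP F hF UF; split=> //.
  exact: (very_free_src Fh fm sm gen).
apply: (general_of_polyfun (polyfunM Gs_poly Gv_poly)).
- exact: polyfunM_nonzero.
- move=> F Fh; rewrite mulf_eq0 negb_or => /andP[GsF GvF].
  by split; [apply: smooth | have [f hf] := curves F Fh GvF; exists f].
- by move=> [/not_smooth0].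
move=> t F t0 [sm [f [Fh [[fh fb Ff] gen]]]]; split.
  move=> p pp Fp; have [|i] := sm p pp; first by rewrite mevalZ Fp mulr0.
  by rewrite mderivZ mevalZ mulf_eq0 negb_or => /andP[_ hi]; exists i.
have gradZ i : grad_along (t *: F) f i = t *: grad_along F f i.
  by rewrite /grad_along mderivZ comp_mpolyZ.
exists f; split; first by rewrite -(scalerK t0 F) rpredZ.
split.
  split=> //; move/eqP: Ff; rewrite comp_mpolyZ mscalerI (negPf t0) => /eqP //.
move=> a pa kappa hk; have [|w [wh wphi hw]] := gen a pa kappa.
  rewrite -[RHS](mulr0 t) -[in RHS]hk mulr_sumr; apply: eq_bigr => i _.
  by rewrite gradZ mevalZ mulrCA.
exists w; split=> //; apply: (scalerI t0); rewrite scaler0 -[RHS]wphi scaler_sumr.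
by apply: eq_bigr => i _; rewrite gradZ scalerAr.
Qed.
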